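(* Let $\alpha>0$, $\beta\in(\tfrac12,1)$, $n\ge1$, and set $\Omega=(0,1)^n$ and $\omega_\alpha^n=\omega_\alpha\times\cdots\times\omega_\alpha$ ($n$ factors), where $\omega_\alpha=\{i^{-\alpha}:i=1,2,\ldots\}$. Then there exists $C>0$ such that $\mathrm{spec}((0,1)^n,\omega_\alpha^n,C,\beta)$ holds. Therefore, there exists $C>0$ such that for every $T>0$ and every $u_0\in L^2(\Omega)$, the solution $u$ of the heat equation on $\Omega$ with Dirichlet boundary conditions and initial datum $u_0$ satisfies $$\|u(T,\cdot)\|_{L^\infty(\Omega)}\le C\exp\left(C\,T^{-\beta/(1-\beta)}\right)\int_0^T\sup_{x\in\omega_\alpha^n}|u(t,x)|\,dt.$$
   Context: Heat equation: for $u_0\in L^2(\Omega)$, $u$ denotes the unique weak solution in $L^2(0,T;H^1_0(\Omega))\cap H^1(0,T;H^{-1}(\Omega))$ of $\partial_tu-\Delta u=0$ in $(0,T)\times\Omega$, $u=0$ on $(0,T)\times\partial\Omega$, $u(0,\cdot)=u_0$. For $t>0$, $u(t,\cdot)$ is identified with its continuous representative on $\overline\Omega$ (vanishing on $\partial\Omega$). Spectral projector: $(\varphi_k)_{k\ge1}$ is an orthonormal basis of $L^2(\Omega)$ of Dirichlet eigenfunctions of $-\Delta$ on $\Omega$ with eigenvalues $\lambda_k$, and $\Pi_\Lambda u=\sum_{\lambda_k\le\Lambda}\langle u,\varphi_k\rangle_{L^2}\varphi_k$, regarded as a continuous function on $\overline\Omega$ (vanishing on $\partial\Omega$). The property $\mathrm{spec}(\Omega,\omega,C,\beta)$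 is said to hold if $\|\Pi_\Lambda u\|_{L^2(\Omega)}\le C\exp(C\Lambda^\beta)\sup_{x\in\omega}|\Pi_\Lambda u(x)|$ for all $\Lambda>0$ and all $u\in L^2(\Omega)$. Points of $\omega_\alpha^n$ having a coordinate equal to $1$ lie on $\partial\Omega$, where the functions considered vanish, so they do not contribute to the suprema. *)

(* Defs.v *)
From HB Require Import structures.
From mathcomp Require Import all_boot all_order all_algebra.
From mathcomp Require Import all_classical all_reals all_analysis.

Set Implicit Arguments.
Unset Strict Implicit.
Unset Printing Implicit Defensive.
Import Order.TTheory GRing.Theory Num.Theory.
Import numFieldNormedType.Exports.

Local Open Scope classical_set_scope.
Local Open Scope ring_scope.


Fact rV_display : measure_display. Proof. exact: default_measure_display. Qed.

(* As the library does for [n.-tuple T], 'rV[R]_n carries the sigma-algebra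
   generated by the coordinates, i.e. the Borel sets of R^n. *)
Section measurable_rV.
Variables (R : realType) (n : nat).

Definition rV_coord (i : 'I_n) (x : 'rV[R]_n) : R := x ord0 i.

Let rV_set0 : g_sigma_preimage rV_coord set0.
Proof. exact: sigma_algebra0. Qed.

Let rV_setC A : g_sigma_preimage rV_coord A ->
  g_sigma_preimage rV_coord (~` A).
Proof. exact: sigma_algebraC. Qed.

Let rV_bigcup (F : _^nat) : (forall i, g_sigma_preimage rV_coord (F i)) ->
  g_sigma_preimage rV_coord (\bigcup_i (F i)).
Proof. exact: sigma_algebra_bigcup. Qed.

HB.instance Definition _ := @isMeasurable.Build rV_display
  'rV[R]_n (g_sigma_preimage rV_coord) rV_set0 rV_setC rV_bigcup.

Lemma measurable_rV_coord (i : 'I_n) : measurable_fun setT (rV_coord i).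
Proof.
move=> _ Y mY; rewrite setTI; apply: sub_sigma_algebra.
rewrite (bigD1 i)//=; left; exists Y => //; by rewrite setTI.
Qed.

Lemma measurable_fun_rV d (T : measurableType d) (f : T -> 'rV[R]_n) :
  (forall i, measurable_fun setT (rV_coord i \o f)) -> measurable_fun setT f.
Proof.
move=> mf; apply: (@measurability _ _ _ _ _ _
  (\big[setU/set0]_(i < n) preimage_set_system setT (rV_coord i) measurable)).
  by [].
move=> _ [B + <-].
elim/big_ind : _ => [//|A1 A2 h1 h2 [/h1//|/h2//]|i _ [C mC <-]].
by rewrite setTI; apply: mf.
Qed.

End measurable_rV.

Section lebesgue_rV.
Variable R : realType.

Definition rV_cons (n : nat) (z : measurableTypeR R * 'rV[R]_n) : 'rV[R]_n.+1 :=
  row_mx (const_mx z.1 : 'rV[R]_1) z.2.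

Definition rV_uncons (n : nat) (x : 'rV[R]_n.+1) : measurableTypeR R * 'rV[R]_n :=
  (x ord0 ord0, \row_i x ord0 (lift ord0 i)).

Lemma rV_consK n : cancel (@rV_cons n) (@rV_uncons n).
Proof.
move=> [a v]; congr pair => /=.
  rewrite /rV_cons mxE; case: splitP => [j _|k /=]; first by rewrite mxE.
  by [].
apply/rowP => i; rewrite !mxE; case: splitP => [j /= |k /=].
  by move: (ltn_ord j) => /[swap] <-.
by rewrite /bump /= => -[] /ord_inj ->.
Qed.

Lemma measurable_rV_cons n : measurable_fun setT (@rV_cons n).
Proof.
apply: measurable_fun_rV => i; rewrite /rV_coord /rV_cons /comp.
case: (split_ordP (i : 'I_(1 + n))) => j ->.
  rewrite (_ : (fun _ => _) = fst); first exact: measurable_fst.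
  by apply/funext => z; exact: etrans (row_mxEl _ _ _ _) (mxE _ _ _ _).
rewrite (_ : (fun _ => _) = @rV_coord R n j \o snd).
  apply: measurableT_comp; [exact: measurable_rV_coord|exact: measurable_snd].
by apply/funext => z; exact: row_mxEr.
Qed.

Lemma measurable_rV_uncons n : measurable_fun setT (@rV_uncons n).
Proof.
apply/measurable_fun_pairP; split; first exact: (@measurable_rV_coord R n.+1 ord0).
apply: measurable_fun_rV => i; rewrite /rV_coord /comp.
rewrite (_ : (fun _ => _) = @rV_coord R n.+1 (lift ord0 i)).
  exact: measurable_rV_coord.
by apply/funext => z; rewrite mxE.
Qed.

Section succ.
Variables (n : nat) (mu : {sigma_finite_measure set 'rV[R]_n -> \bar R}).

Definition lebesgue_rV_succ : set 'rV[R]_n.+1 -> \bar R :=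
  pushforward (@lebesgue_measure R \x mu)%E (@rV_cons n).

Let succ0 : lebesgue_rV_succ set0 = 0%E.
Proof. by rewrite /lebesgue_rV_succ /pushforward preimage_set0 measure0. Qed.

Let succ_ge0 A : (0 <= lebesgue_rV_succ A)%E.
Proof. by rewrite /lebesgue_rV_succ /pushforward; apply: measure_ge0. Qed.

Let succ_sigma_additive : semi_sigma_additive lebesgue_rV_succ.
Proof.
move=> F mF tF mUF; rewrite /lebesgue_rV_succ /pushforward preimage_bigcup.
apply: measure_semi_sigma_additive.
- by move=> i; rewrite -[X in measurable X]setTI; exact: measurable_rV_cons.
- apply/trivIsetP => i j _ _ ij; rewrite -preimage_setI.
  by move/trivIsetP : tF => /(_ _ _ _ _ ij) ->//; rewrite preimage_set0.
- rewrite -preimage_bigcup -[X in measurable X]setTI.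
  exact: measurable_rV_cons.
Qed.

HB.instance Definition _ := isMeasure.Build _ _ _
  lebesgue_rV_succ succ0 succ_ge0 succ_sigma_additive.

Let succ_sigma_finite : sigma_finite setT lebesgue_rV_succ.
Proof.
have /sigma_finiteP[F [TF ndF Foo]] := sigma_finiteT (@lebesgue_measure R).
have /sigma_finiteP[G [TG ndG Goo]] := sigma_finiteT mu.
exists (fun k => @rV_uncons n @^-1` (F k `*` G k)).
  rewrite -preimage_bigcup (_ : \bigcup_k (F k `*` G k) = setT) ?preimage_setT//.
  apply/seteqP; split => // -[x y] _.
  have [i _ Fix] : (\bigcup_k F k) x by rewrite -TF.
  have [j _ Gjy] : (\bigcup_k G k) y by rewrite -TG.
  exists (maxn i j) => //; split => /=.
  - by move: x Fix; exact/subsetPset/ndF/leq_maxl.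
  - by move: y Gjy; exact/subsetPset/ndG/leq_maxr.
move=> k; have [mF Fk] := Foo k; have [mG Gk] := Goo k; split.
  by rewrite -[X in measurable X]setTI; apply: measurable_rV_uncons => //;
    exact: measurableX.
rewrite /lebesgue_rV_succ /pushforward -comp_preimage.
rewrite (_ : _ \o _ = id) ?preimage_id; last first.
  by apply/funext => z /=; exact: rV_consK.
by rewrite product_measure1E// lte_mul_pinfty// ge0_fin_numE.
Qed.

HB.instance Definition _ := Measure_isSigmaFinite.Build _ _ _
  lebesgue_rV_succ succ_sigma_finite.

End succ.

Fixpoint lebesgue_rV (n : nat) :
    {sigma_finite_measure set 'rV[R]_n -> \bar R} :=
  match n with
  | 0%N => \d_(0 : 'rV[R]_0)
  | n'.+1 => lebesgue_rV_succ (lebesgue_rV n')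
  end.

End lebesgue_rV.

Arguments lebesgue_rV {R n}.


(* Functions on [Omega] are represented by functions on the whole of R^n whose
   values outside [Omega] (outside [closure Omega], when boundary values
   matter) are irrelevant. *)
Section function_spaces.
Variables (R : realType) (n : nat).
Implicit Types (Omega : set 'rV[R]_n) (f g : 'rV[R]_n -> R).

Definition LpOn Omega (p : \bar R) f : bool :=
  (f \_ Omega) \in Lfun (@lebesgue_rV R n) p.

Definition LpNorm Omega (p : \bar R) f : \bar R :=
  ('N[@lebesgue_rV R n]_p [EFin \o (f \_ Omega)])%E.

Definition L2_inner Omega f g : R := \int[@lebesgue_rV R n]_(x in Omega) (f x * g x).

Definition partial (i : 'I_n) f : 'rV[R]_n -> R :=
  fun x => 'D_(delta_mx ord0 i) f x.

Definition smooth f : Prop := forall s : seq 'I_n,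
  continuous (foldr partial f s) /\
  forall i x, derivable (foldr partial f s) x (delta_mx ord0 i).

Definition test_function Omega f : Prop :=
  [/\ smooth f, compact (closure [set x | f x != 0]) &
      closure [set x | f x != 0] `<=` Omega].

Definition weak_partial Omega (i : 'I_n) f g : Prop :=
  forall psi, test_function Omega psi ->
    L2_inner Omega f (partial i psi) = - L2_inner Omega g psi.

(* An element of H^1 is represented by the pair of a function and its weak
   gradient. *)
Definition sobolev : lmodType R :=
  (('rV[R]_n -> R^o) * ('I_n -> 'rV[R]_n -> R^o))%type.

Definition H1 Omega (F : sobolev) : Prop :=
  LpOn Omega 2%:E F.1 /\
  forall i, LpOn Omega 2%:E (F.2 i) /\ weak_partial Omega i F.1 (F.2 i).

Definition H1_norm Omega (F : sobolev) : \bar R :=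
  ((LpNorm Omega 2%:E F.1 ^+ 2 + \sum_(i < n) LpNorm Omega 2%:E (F.2 i) ^+ 2)
     `^ 2^-1)%E.

Definition H10 Omega : set sobolev := [set F | H1 Omega F /\
  forall e : R, 0 < e -> exists2 psi, test_function Omega psi &
    (H1_norm Omega (F - ((psi, fun i => partial i psi) : sobolev)) < e%:E)%E].

Definition dirichlet_form Omega (F G : sobolev) : R :=
  \sum_(i < n) L2_inner Omega (F.2 i) (G.2 i).

(* H^{-1} is the dual of H^1_0; only the values on [H10 Omega] matter. *)
Definition Hm1 Omega : set (sobolev -> R) := [set l |
  (forall (a : R) F G, H10 Omega F -> H10 Omega G ->
     l (a *: F + G) = a * l F + l G) /\
  exists M : R, forall F, H10 Omega F ->
    (`|l F|%:E <= M%:E * H1_norm Omega F)%E].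

Definition Hm1_norm Omega (l : sobolev -> R) : \bar R :=
  ereal_sup [set `|l F|%:E | F in
    [set F | H10 Omega F /\ (H1_norm Omega F <= 1)%E]].

Definition continuous_vanishing Omega f : Prop :=
  {within closure Omega, continuous f} /\
  forall x, (closure Omega `\` interior Omega) x -> f x = 0.

End function_spaces.


Section bochner.
Variables (R : realType) (X : zmodType) (A : set X) (nrm : X -> \bar R).

Definition simple_function (s : R -> X) : Prop :=
  [/\ finite_set (range s), range s `<=` A &
      forall y, measurable (s @^-1` [set y])].

(* L^2(I; A), with strong measurability, [A] being seminormed by [nrm]. *)
Definition bochner_L2 (I : set R) (F : R -> X) : Prop :=
  [/\ {ae lebesgue_measure, forall t, I t -> A (F t)},
      (exists s : nat -> R -> X, (forall m, simple_function (s m)) /\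
        {ae lebesgue_measure, forall t, I t ->
          nrm (F t - s m t) @[m --> \oo] --> 0%E}) &
      (\int[lebesgue_measure]_(t in I) (nrm (F t) ^+ 2) < +oo)%E].

End bochner.


Section spectral.
Variables (R : realType) (n : nat).
Implicit Types (Omega omega : set 'rV[R]_n).

Definition dirichlet_eigenfunction Omega (lambda : R) (phi : 'rV[R]_n -> R) :=
  [/\ continuous_vanishing Omega phi,
      LpNorm Omega 2%:E phi != 0%E &
      exists G, H10 Omega (phi, G) /\
        forall V, H10 Omega V ->
          dirichlet_form Omega (phi, G) V = lambda * L2_inner Omega phi V.1].

Definition dirichlet_eigenbasis Omega (phi : nat -> 'rV[R]_n -> R)
    (lambda : nat -> R) : Prop :=
  [/\ forall k, dirichlet_eigenfunction Omega (lambda k) (phi k),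
      forall j k, L2_inner Omega (phi j) (phi k) = (j == k)%:R &
      forall f, LpOn Omega 2%:E f ->
        LpNorm Omega 2%:E
          (f - \sum_(k < N) (L2_inner Omega f (phi k) \*o phi k))
        @[N --> \oo] --> 0%E].

(* For a bounded Omega only finitely many eigenvalues are <= Lambda, so that
   the finitely supported sum is the whole sum. *)
Definition spectral_projector Omega (phi : nat -> 'rV[R]_n -> R)
    (lambda : nat -> R) (Lambda : R) (u : 'rV[R]_n -> R) (x : 'rV[R]_n) : R :=
  \sum_(k \in [set k | lambda k <= Lambda]) (L2_inner Omega u (phi k) * phi k x).

Definition sup_on omega (f : 'rV[R]_n -> R) : \bar R :=
  ereal_sup [set `|f x|%:E | x in omega].

(* [spectral_projector] does not depend on the choice of the orthonormal basis
   of eigenfunctions, hence the quantification over all of them. *)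
Definition spec Omega omega (C beta : R) : Prop :=
  forall phi lambda, dirichlet_eigenbasis Omega phi lambda ->
  forall (Lambda : R) (u : 'rV[R]_n -> R), 0 < Lambda -> LpOn Omega 2%:E u ->
    let Pu := spectral_projector Omega phi lambda Lambda u in
    (LpNorm Omega 2%:E Pu <=
       (C * expR (C * Lambda `^ beta))%:E * sup_on omega Pu)%E.

End spectral.


Definition open_cube (R : realType) (n : nat) : set 'rV[R]_n :=
  [set x | forall i, 0 < x ord0 i < 1].

Definition omega1 (R : realType) (alpha : R) : set R :=
  [set i%:R `^ (- alpha) | i in [set i : nat | (1 <= i)%N]].

Definition omega_n (R : realType) (alpha : R) (n : nat) : set 'rV[R]_n :=
  [set x | forall i, omega1 alpha (x ord0 i)].

Arguments open_cube : clear implicits.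
Arguments omega1 {R} alpha.
Arguments omega_n {R} alpha n.


Section heat.
Variables (R : realType) (n : nat).
Implicit Types (Omega : set 'rV[R]_n).

Definition time_test_function (I : set R) (eta : R -> R) : Prop :=
  [/\ forall k x, derivable (derive1n k eta) x 1,
      compact (closure [set t | eta t != 0]) &
      closure [set t | eta t != 0] `<=` I].

(* [du] is the derivative of [u] in the sense of H^{-1}-valued distributions,
   through the embedding of L^2 into H^{-1}. *)
Definition weak_time_derivative Omega (I : set R) (u : R -> 'rV[R]_n -> R)
    (du : R -> sobolev R n -> R) : Prop :=
  forall V eta, H10 Omega V -> time_test_function I eta ->
    \int[lebesgue_measure]_(t in I) (derive1 eta t * L2_inner Omega (u t) V.1) =
    - \int[lebesgue_measure]_(t in I) (eta t * du t V).

Definition heat_weak_solution Omega (T : R) (u0 : 'rV[R]_n -> R)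
    (u : R -> 'rV[R]_n -> R) : Prop :=
  (exists (G : R -> 'I_n -> 'rV[R]_n -> R) (du : R -> sobolev R n -> R),
  [/\ bochner_L2 (H10 Omega) (H1_norm Omega) `]0, T[%classic
        (fun t => (u t, G t) : sobolev R n),
      bochner_L2 (Hm1 Omega) (Hm1_norm Omega) `]0, T[%classic
        (du : R -> sobolev R n -> R^o),
      weak_time_derivative Omega `]0, T[%classic u du,
      {ae lebesgue_measure, forall t, t \in `]0, T[ -> forall V, H10 Omega V ->
         du t V + dirichlet_form Omega (u t, G t) V = 0} &
      (forall t : R, t \in `[0, T] -> LpOn Omega 2%:E (u t) /\
         LpNorm Omega 2%:E (u s - u t)
           @[s --> within `[0, T]%classic (nbhs t)] --> 0%E)]) /\
  LpNorm Omega 2%:E (u 0 - u0) = 0%E.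

Definition heat_solution Omega (T : R) (u0 : 'rV[R]_n -> R)
    (u : R -> 'rV[R]_n -> R) : Prop :=
  heat_weak_solution Omega T u0 u /\
  forall t : R, t \in `]0, T] -> continuous_vanishing Omega (u t).

End heat.

(* Main.v *)
Require Import Defs.
From HB Require Import structures.
From mathcomp Require Import all_boot all_order all_algebra finmap.
From mathcomp Require Import all_classical all_reals all_analysis.
From mathcomp Require Import measurable_realfun.
From mathcomp Require Import ring lra.

Set Implicit Arguments.
Unset Strict Implicit.
Unset Printing Implicit Defensive.
Import Order.TTheory GRing.Theory Num.Theory.
Import numFieldNormedType.Exports.

Local Open Scope classical_set_scope.
Local Open Scope ring_scope.

(** Everything is reduced to the products of sines s_k(x) = prod_i sin (k_i pi x_i) with
    k_i >= 1, and to their eigenvalues mu_k = pi^2 sum_i k_i^2.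

    Each s_k belongs to H^1_0 ([sine_H10]), so that it may be tested against any element of
    H^1_0.  The resulting identity [H10_sine] says that s_k is an eigenfunction in the weak
    sense.  Hence a Dirichlet eigenfunction is orthogonal to every s_k with another eigenvalue
    ([eigenfunction_sine_orthogonal]), and along a weak solution of the heat equation the
    coefficient of s_k satisfies c' = - mu_k c, so it is exp (- mu_k t) c(0) ([heat_coef]).
    A bounded function is recovered from its sine coefficients at its points of continuity by
    Fejer summation ([fejer_cvg]).  Together, an eigenfunction with eigenvalue at most Lambda is
    on the cube a combination of the s_k with k_i <= N, where N is of the order of sqrt Lambda
    ([eigenfunction_sine_sum]).

    The spectral inequality is therefore a statement on sine polynomials ([finite_spectral]).
    In dimension one, sin (k pi x) is sin (pi x) times a polynomial of degree less than k in
    cos (pi x), so Lagrange interpolation at N points of omega_alpha determines the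
    coefficients of a sine polynomial with frequencies at most N.  The points i^(-alpha) are
    separated by negative powers of i ([omega_nodes]), so the interpolation weights are at most
    N^(O(N)) = exp (O(N log N)); products of such weights do the same in dimension n.  Since
    beta > 1/2, N log N = O(N^(2 beta)), which is O(1 + Lambda^beta).

    For the heat equation, let F(t) be the sum of the moduli of the sine coefficients at time t.
    It bounds |u(t, x)|, is nonincreasing, and is O(t^(-n)).  Cutting the series at frequency N
    and applying the spectral inequality to the low part gives, for s < t ([heat_observation]),
      F(t) <= 2 exp (D N^(2 beta)) (sup_omega |u(t)| + exp (- N^2 (t - s)) F(s)).
    This is used between the times T 2^(-m-1) and T 2^(-m), with N of the order of
    (T 2^(-m))^(-1/(2 (1 - beta))): the factor exp (- N^2 (t - s)) then compensates the constant
    of the next step, the inequalities telescope after integration in t, and only the constant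
    of the first step remains, namely exp (C T^(-beta/(1 - beta)))
    ([frequency_schedule], [observability_le1]). *)

(** * Lebesgue measure on the open cube *)

Section CubeMeasure.
Variable R : realType.
Implicit Types n : nat.

Lemma rV_nbhsP n (x : 'rV[R]_n) (A : set 'rV[R]_n) :
  nbhs x A <-> exists2 d : R, 0 < d &
    forall y : 'rV[R]_n, (forall i, `|x ord0 i - y ord0 i| < d) -> A y.
Proof.
split=> [/nbhs_ballP[d d0 dA]|[d d0 dA]].
  exists d => // y xy; apply: dA; split => // i j.
  by rewrite (ord1 i); exact: xy.
apply/nbhs_ballP; exists d => // y [_ xy]; apply: dA => i; exact: xy.
Qed.

Lemma cvg_rV n T (F : set_system T) {FF : Filter F} (f : T -> 'rV[R]_n)
    (l : 'rV[R]_n) :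
  (forall i, f t ord0 i @[t --> F] --> l ord0 i) -> f t @[t --> F] --> l.
Proof.
move=> h A /rV_nbhsP[d d0 dA].
suff : \forall t \near F, forall i, `|l ord0 i - f t ord0 i| < d.
  by apply: filterS => t; exact: dA.
by apply: filter_forall => i; move: (h i) => /cvgrPdist_lt /(_ _ d0).
Qed.

(** The function is the pointwise limit of its values on the grids of mesh 1 / (m + 1): rounding
    to a grid point takes countably many values, each on a box. *)
Lemma continuous_measurable_rV n (f : 'rV[R]_n -> R) :
  continuous f -> measurable_fun setT f.
Proof.
move=> cf.
pose disc (m : nat) (z : 'rV[int]_n) : 'rV[R]_n := \row_i ((z ord0 i)%:~R / m.+1%:R).
pose fl (m : nat) (x : 'rV[R]_n) : 'rV[int]_n :=
  \row_i Num.floor (m.+1%:R * x ord0 i).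
apply: (@measurable_fun_cvg _ _ _ _
  (fun m x => f (disc m (fl m x)))) => [m|x _].
  move=> _ B mB; rewrite setTI.
  rewrite (_ : _ @^-1` B = \bigcup_(z : 'rV[int]_n)
    ([set x | fl m x = z] `&` [set x | B (f (disc m z))])); last first.
    apply/seteqP; split => [x /= Bx|x [z _ [/= -> //]]].
    by exists (fl m x).
  apply: countable_bigcupT_measurable; first exact: countableP.
  move=> z; apply: measurableI; last first.
    have [Bz|nBz] := pselect (B (f (disc m z))).
      by rewrite (_ : [set _ | _] = setT)//; apply/seteqP; split.
    by rewrite (_ : [set _ | _] = set0)//; apply/seteqP; split.
  rewrite (_ : [set x | _] = \bigcap_(i in [set: 'I_n])
     (rV_coord i @^-1` [set y | (z ord0 i)%:~R <= m.+1%:R * y < (z ord0 i + 1)%:~R])).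
    apply: fin_bigcap_measurable; first exact: finite_finset.
    move=> i _; rewrite -[X in measurable X]setTI; apply: measurable_rV_coord => //.
    rewrite (_ : [set y | _] =
      `[((z ord0 i)%:~R / m.+1%:R)%R, ((z ord0 i + 1)%:~R / m.+1%:R)%R[%classic)//.
    by apply/seteqP; split => y /=;
      rewrite in_itv/= ler_pdivrMr// ltr_pdivlMr// ![y * _]mulrC.
  apply/seteqP; split => [x /= <- i _ /=|x /= h].
    by rewrite mxE floor_itv.
  by apply/rowP => i; rewrite mxE; apply/floor_def/h.
apply: continuous_cvg; first exact: cf.
apply: cvg_rV => i; apply/cvgrPdist_lt => e e0.
near=> m; rewrite !mxE.
have hm : m.+1%:R^-1 < e by near: m; exact: (near_infty_natSinv_lt (PosNum e0)).
have /andP[h1 h2] := floor_itv (m.+1%:R * x ord0 i).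
have m0 : 0 < m.+1%:R :> R by [].
set z := (Num.floor _)%:~R in h1 *.
apply: le_lt_trans hm.
have -> : x ord0 i - z / m.+1%:R = (m.+1%:R * x ord0 i - z) / m.+1%:R.
  by rewrite mulrBl mulrAC mulfV ?mul1r ?gt_eqF.
rewrite normrM [X in _ * X]gtr0_norm ?invr_gt0// ler_piMl ?invr_ge0 ?ltW//.
by rewrite ger0_norm ?subr_ge0//; move: h2; rewrite intrD -/z; lra.
Unshelve. all: by end_near. Qed.

Lemma open_cubeE n : open_cube R n =
  \bigcap_(i in [set: 'I_n]) (rV_coord i @^-1` `]0, 1[).
Proof.
apply/seteqP; split => x /= h i; first by move=> _ /=; rewrite in_itv; exact: h.
by have /= := h i I; rewrite in_itv.
Qed.

Lemma measurable_open_cube n : measurable (open_cube R n).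
Proof.
rewrite open_cubeE; apply: fin_bigcap_measurable; first exact: finite_finset.
by move=> i _; rewrite -[X in measurable X]setTI; apply: measurable_rV_coord.
Qed.

Lemma rV_cons0 n (z : measurableTypeR R * 'rV[R]_n) : rV_cons z ord0 ord0 = z.1.
Proof. by have := rV_consK z; rewrite /rV_uncons => /(congr1 fst). Qed.

Lemma rV_consS n (z : measurableTypeR R * 'rV[R]_n) i :
  rV_cons z ord0 (lift ord0 i) = z.2 ord0 i.
Proof.
have := rV_consK z; rewrite /rV_uncons => /(congr1 snd)/= <-.
by rewrite mxE.
Qed.

Lemma open_cube_cons n (z : measurableTypeR R * 'rV[R]_n) :
  open_cube R n.+1 (rV_cons z) <-> (`]0, 1[%classic `*` open_cube R n) z.
Proof.
split=> [h|[h1 h2] i].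
  split; first by rewrite /= in_itv/=; have := h ord0; rewrite rV_cons0.
  by move=> i; have := h (lift ord0 i); rewrite rV_consS.
case: (unliftP ord0 i) => [j|] ->; first by rewrite rV_consS.
by rewrite rV_cons0; move: h1; rewrite /= in_itv.
Qed.

Lemma lebesgue_open_cube n : lebesgue_rV (open_cube R n) = 1%E.
Proof.
elim: n => [|n IH].
  rewrite /= diracE mem_set//; by case.
rewrite /= /lebesgue_rV_succ /pushforward.
rewrite (_ : _ @^-1` _ = `]0, 1[%classic `*` open_cube R n); last first.
  by apply/seteqP; split => z /open_cube_cons.
rewrite product_measure1E//; last exact: measurable_open_cube.
by rewrite [X in (X * _)%E](lebesgue_measure_itv `]0, 1[)/= lte_fin ltr01 oppr0 adde0 mul1e IH.
Qed.

Definition cube_bounded n (f : 'rV[R]_n -> R) :=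
  exists B : R, forall x, open_cube R n x -> `|f x| <= B.

Lemma cube_integrable n (f : 'rV[R]_n -> R) :
  measurable_fun (open_cube R n) f -> cube_bounded f ->
  lebesgue_rV.-integrable (open_cube R n) (EFin \o f).
Proof.
move=> mf [B fB]; apply: measurable_bounded_integrable => //.
- exact: measurable_open_cube.
- by rewrite [X in (X < _)%E]lebesgue_open_cube ltry.
- exists B; split; first exact: num_real.
  by move=> M BM x /fB h; exact: le_trans h (ltW BM).
Qed.

Local Notation leb := (@lebesgue_measure R).

(** Both orders are stated because an induction on the dimension singles out the first
    coordinate, which is integrated first or last according to the direction of a derivative. *)
Lemma cube_fubini n (f : 'rV[R]_n.+1 -> R) :
  measurable_fun (open_cube R n.+1) f -> cube_bounded f ->
  \int[lebesgue_rV]_(x in open_cube R n.+1) f x =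
    \int[leb]_(a in `]0, 1[) \int[lebesgue_rV]_(v in open_cube R n) f (rV_cons (a, v))
  /\
  \int[lebesgue_rV]_(x in open_cube R n.+1) f x =
    \int[lebesgue_rV]_(v in open_cube R n) \int[leb]_(a in `]0, 1[) f (rV_cons (a, v)).
Proof.
move=> mf [B fB].
have mC : measurable (open_cube R n.+1) by exact: measurable_open_cube.
pose fC : 'rV[R]_n.+1 -> R := f \_ (open_cube R n.+1).
have mfC : measurable_fun setT fC.
  exact: (measurable_restrictT f mC).1 mf.
have fCB x : `|fC x| <= `|B|.
  rewrite /fC patchE; case: ifPn => [/set_mem/fB h|_]; last by rewrite normr0.
  exact: le_trans h (ler_norm _).
pose g (z : measurableTypeR R * 'rV[R]_n) : \bar R :=
  (fC (rV_cons z))%:E.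
have mg : measurable_fun setT g.
  by apply/measurable_EFinP; apply: measurableT_comp => //; exact: measurable_rV_cons.
have gout z : ~ (`]0, 1[%classic `*` open_cube R n) z -> g z = 0%E.
  by move=> h; rewrite /g /fC patchE memNset// => /open_cube_cons.
have gin z : (`]0, 1[%classic `*` open_cube R n) z -> g z = (f (rV_cons z))%:E.
  by move=> h; rewrite /g /fC patchE mem_set//; apply/open_cube_cons.
have mP : measurable (`]0, 1[%classic `*` open_cube R n : set (measurableTypeR R * 'rV[R]_n)).
  by apply: measurableX => //; exact: measurable_open_cube.
have ig : (leb \x (@lebesgue_rV R n))%E.-integrable setT g.
  have : (leb \x (@lebesgue_rV R n))%E.-integrable
      (`]0, 1[%classic `*` open_cube R n) g.
    apply: measurable_bounded_integrable => //.
    - rewrite [X in (X < _)%E]product_measure1E//; last exact: measurable_open_cube.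
      rewrite [X in (X * _)%E](lebesgue_measure_itv `]0, 1[)/= lte_fin ltr01 oppr0 adde0.
      by rewrite mul1e [X in (X < _)%E]lebesgue_open_cube ltry.
    - by apply: measurable_funTS; move/measurable_EFinP : mg.
    - exists `|B|; split; first exact: num_real.
      by move=> M BM x _; exact: le_trans (fCB _) (ltW BM).
  move=> h; rewrite (_ : g = g \_ (`]0, 1[%classic `*` open_cube R n)).
    by apply/integrable_restrict => //; rewrite setTI.
  apply/funext => z; rewrite patchE; case: ifPn => // /negP hz.
  by apply: gout => hz'; apply: hz; rewrite inE.
have E0 : (\int[lebesgue_rV]_(x in open_cube R n.+1) (f x)%:E)%E =
    (\int[leb \x (@lebesgue_rV R n)]_z g z)%E.
  rewrite integral_mkcond restrict_EFin.
  transitivity (\int[pushforward (leb \x (@lebesgue_rV R n))%E (@rV_cons R n)]_x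
      (EFin \o fC) x)%E.
    by [].
  rewrite integral_pushforward//; first exact: measurable_rV_cons.
  by apply/measurable_EFinP.
split; rewrite /Rintegral E0.
- rewrite -integral12_prod_meas1//.
  congr fine; rewrite [RHS]integral_mkcond; apply: eq_integral => a _.
  rewrite /fubini_F patchE; case: ifPn => [/set_mem ha|/negP ha]; last first.
    rewrite integral0_eq// => v _; apply: gout => -[h _]; apply: ha.
    by rewrite inE.
  have -> : (\int[lebesgue_rV]_v g (a, v) =
      \int[lebesgue_rV]_(v in open_cube R n) (f (rV_cons (a, v)))%:E)%E.
    rewrite [RHS]integral_mkcond; apply: eq_integral => v _.
    rewrite patchE; case: ifPn => [/set_mem hv|/negP hv]; first exact: gin.
    by apply: gout => -[_ hv']; apply: hv; rewrite inE.
  rewrite fineK//; apply: integrable_fin_num; first exact: measurable_open_cube.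
  apply: cube_integrable.
    have mh : measurable_fun setT (fun v : 'rV[R]_n => rV_cons (a, v)).
      by apply: measurableT_comp; [exact: measurable_rV_cons|exact: pair1_measurable].
    apply: (measurable_comp (F := open_cube R n.+1)) mf (measurable_funTS mh).
      exact: measurable_open_cube.
    by move=> _ [v hv <-]; apply/open_cube_cons.
  by exists B => v hv; apply: fB; apply/open_cube_cons.
- rewrite -integral21_prod_meas1//.
  congr fine; rewrite [RHS]integral_mkcond; apply: eq_integral => v _.
  rewrite /fubini_G patchE; case: ifPn => [/set_mem hv|/negP hv]; last first.
    rewrite integral0_eq// => a _; apply: gout => -[_ h]; apply: hv.
    by rewrite inE.
  have -> : (\int[leb]_a g (a, v) =
      \int[leb]_(a in `]0%R, 1%R[) (f (rV_cons (a, v)))%:E)%E.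
    rewrite [RHS]integral_mkcond; apply: eq_integral => a _.
    rewrite patchE; case: ifPn => [/set_mem ha|/negP ha]; first exact: gin.
    by apply: gout => -[ha' _]; apply: ha; rewrite inE.
  rewrite fineK//; apply: integrable_fin_num => //.
  apply: measurable_bounded_integrable => //.
  + by rewrite [X in (X < _)%E](lebesgue_measure_itv `]0, 1[)/= lte_fin ltr01 oppr0 adde0 ltry.
  + have mh : measurable_fun setT (fun a : measurableTypeR R => rV_cons (a, v)).
      by apply: measurableT_comp; [exact: measurable_rV_cons|exact: pair2_measurable].
    apply: (measurable_comp (F := open_cube R n.+1)) mf (measurable_funTS mh).
      exact: measurable_open_cube.
    by move=> _ [a ha <-]; apply/open_cube_cons.
  + exists B; split; first exact: num_real.
    move=> M BM a ha; apply: le_trans (ltW BM).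
    by apply: fB; apply/open_cube_cons.
Qed.

Lemma compact_closed_cube n :
  compact [set x : 'rV[R]_n | forall i, `[0, 1]%classic (x ord0 i)].
Proof.
have := @rV_compact R n (fun=> `[0:R, 1]%classic) (fun=> @segment_compact _ _ _).
exact.
Qed.

Lemma continuous_cube_bounded n (f : 'rV[R]_n -> R) :
  {within [set x : 'rV[R]_n | forall i, `[0, 1]%classic (x ord0 i)],
    continuous f} -> cube_bounded f.
Proof.
move=> cf; have := compact_bounded (continuous_compact cf (@compact_closed_cube n)).
move=> [M [_ HM]]; exists (M + 1) => x xC.
have M1 : M < M + 1 by rewrite ltrDl.
apply: (HM _ M1 (f x)); exists x => // i /=; rewrite in_itv/=; have /andP[h1 h2] := xC i.
by rewrite !ltW.
Qed.

Lemma continuousT_cube_bounded n (f : 'rV[R]_n -> R) :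
  continuous f -> cube_bounded f.
Proof. by move=> cf; apply: continuous_cube_bounded; apply: continuous_subspaceT. Qed.

Lemma continuousT_cube_integrable n (f : 'rV[R]_n -> R) : continuous f ->
  lebesgue_rV.-integrable (open_cube R n) (EFin \o f).
Proof.
move=> cf; apply: cube_integrable; last exact: continuousT_cube_bounded.
by apply: measurable_funTS; exact: continuous_measurable_rV.
Qed.

Lemma continuous_bigsum (T : topologicalType) I (r : seq I) (P : pred I)
    (F : I -> T -> R) : (forall i, continuous (F i)) ->
  continuous (fun x => \sum_(i <- r | P i) F i x).
Proof. by move=> cF x; apply: cvg_big => [|i _]; [exact: add_continuous|exact: cF]. Qed.

Lemma continuous_bigprod (T : topologicalType) I (r : seq I) (P : pred I)
    (F : I -> T -> R) : (forall i, continuous (F i)) ->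
  continuous (fun x => \prod_(i <- r | P i) F i x).
Proof. by move=> cF x; apply: cvg_big => [|i _]; [exact: mul_continuous|exact: cF]. Qed.

Lemma continuous_coord n (g : R -> R) (i : 'I_n) :
  continuous g -> continuous (fun x : 'rV[R]_n => g (x ord0 i)).
Proof.
by move=> cg x; apply: (continuous_comp (@coord_continuous _ _ _ _ _ x)); exact: cg.
Qed.

Lemma continuous_coord_prod n (g : 'I_n -> R -> R) (P : pred 'I_n) :
  (forall i, continuous (g i)) ->
  continuous (fun x : 'rV[R]_n => \prod_(i | P i) g i (x ord0 i)).
Proof. by move=> cg; apply: continuous_bigprod => i; exact: continuous_coord. Qed.

Lemma continuous_integrable_itv (f : R -> R) : continuous f ->
  leb.-integrable `]0, 1[ (EFin \o f).
Proof.
move=> cf; apply: (@integrableS _ _ R leb (`[0 : R, 1]%classic : set (measurableTypeR R))) => //.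
  exact: subset_itv_oo_cc.
apply: continuous_compact_integrable; first exact: segment_compact.
exact: continuous_subspaceT.
Qed.

Lemma continuous_cons_l n (v : 'rV[R]_n) :
  continuous ((fun a => rV_cons (a, v)) : R -> 'rV[R]_n.+1).
Proof.
move=> a; apply: cvg_rV => i; case: (unliftP ord0 i) => [j|] ->.
  by under eq_fun do rewrite rV_consS; rewrite rV_consS; exact: cst_continuous.
by under eq_fun do rewrite rV_cons0; rewrite rV_cons0; exact: cvg_id.
Qed.

Lemma continuous_cons_r n (a : R) :
  continuous (fun v : 'rV[R]_n => rV_cons (a, v)).
Proof.
move=> v; apply: (@cvg_rV _ _ (nbhs v) (@nbhs_filter _ v)) => i; case: (unliftP ord0 i) => [j|] ->.
  under eq_fun do rewrite rV_consS; rewrite rV_consS; exact: coord_continuous.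
by under eq_fun do rewrite rV_cons0; rewrite rV_cons0; exact: cst_continuous.
Qed.

Lemma cube_integral_prod n (g : 'I_n -> R -> R) :
  (forall i, continuous (g i)) ->
  \int[lebesgue_rV]_(x in open_cube R n) \prod_i g i (x ord0 i) =
  \prod_i \int[leb]_(a in `]0, 1[) g i a.
Proof.
elim: n g => [|n IH] g cg.
  under eq_Rintegral do rewrite big_ord0.
  rewrite Rintegral_cst; last exact: measurable_open_cube.
  by rewrite [X in fine X]lebesgue_open_cube mul1r big_ord0.
have cp := @continuous_coord_prod n.+1 g xpredT cg.
have cp' := @continuous_coord_prod n (fun i => g (lift ord0 i)) xpredT (fun i => cg _).
rewrite (cube_fubini _ _).1; last 2 first.
- by apply: measurable_funTS; exact: continuous_measurable_rV.
- exact: continuousT_cube_bounded.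
transitivity (\int[leb]_(a in `]0, 1[)
    (g ord0 a * \prod_(i < n) \int[leb]_(b in `]0, 1[) g (lift ord0 i) b)).
  apply: eq_Rintegral => a _.
  under eq_Rintegral => v _.
    rewrite big_ord_recl rV_cons0.
    under eq_bigr do rewrite rV_consS.
    over.
  rewrite /= RintegralZl; first last.
  - exact: (continuousT_cube_integrable cp').
  - exact: measurable_open_cube.
  by rewrite (IH (fun i => g (lift ord0 i))).
rewrite RintegralZr//; last exact: continuous_integrable_itv.
by rewrite big_ord_recl.
Qed.

(** A directional derivative depends only on the restriction to a line; this moves it between
    a function on row vectors and a function of one variable, or of fewer coordinates. *)
Lemma is_derive_along (U V W : normedModType R) (f : V -> W) (g : U -> W)
    (a u : U) (b v : V) (d : W) :
  (forall h : R, g (h *: u + a) = f (h *: v + b)) ->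
  is_derive b v f d -> is_derive a u g d.
Proof.
move=> gf [fv fd].
have ga : g a = f b by have := gf 0; rewrite !scale0r !add0r.
have E : (fun h : R => h^-1 *: (g (h *: u + a) - g a)) =
    (fun h : R => h^-1 *: (f (h *: v + b) - f b)).
  by apply/funext => h /=; rewrite gf ga.
by split; [rewrite /derivable E|rewrite -fd /derive E].
Qed.

Lemma FTC_open01 (f g : R -> R) : continuous g ->
  (forall x : R, is_derive x 1 f (g x)) ->
  \int[leb]_(a in `]0, 1[) g a = f 1 - f 0.
Proof.
move=> cg fg; have ig := continuous_integrable_itv cg.
rewrite Rintegral_itv_obnd_cbnd// Rintegral_itv_bndo_bndc; last first.
  apply: (@integrableS _ _ R leb (`[0 : R, 1]%classic : set (measurableTypeR R))) => //.
    exact: subset_itv_co_cc.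
  apply: continuous_compact_integrable; first exact: segment_compact.
  exact: continuous_subspaceT.
rewrite /Rintegral (@continuous_FTC2 _ g f)//.
- exact: continuous_subspaceT.
- have cf x : {for x, continuous f}.
    by apply: differentiable_continuous; apply/derivable1_diffP; case: (fg x).
  split; first by move=> x _; case: (fg x).
  + exact: cvg_at_right_filter (cf 0).
  + exact: cvg_at_left_filter (cf 1).
- by move=> x _; rewrite derive1E; case: (fg x).
Qed.

(** On each line parallel to the i-th axis the integral of [g] is the difference of the values
    of [f] at two points of the boundary, where [f] vanishes. *)
Lemma cube_integral_derive0 n (i : 'I_n) (f g : 'rV[R]_n -> R) :
  continuous g -> (forall x, is_derive x (delta_mx ord0 i) f (g x)) ->
  (forall x, ~ open_cube R n x -> f x = 0) ->
  \int[lebesgue_rV]_(x in open_cube R n) g x = 0.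
Proof.
elim: n i f g => [[]//|n IH] i f g cg fg f0.
have mg : measurable_fun (open_cube R n.+1) g.
  by apply: measurable_funTS; exact: continuous_measurable_rV.
have bg := continuousT_cube_bounded cg.
case: (unliftP ord0 i) => [j|] ij.
- rewrite (cube_fubini mg bg).1.
  transitivity (\int[leb]_(a in `]0%R, 1%R[) (0 : R)); last first.
    by rewrite Rintegral_cst// mul0r.
  apply: eq_Rintegral => a _.
  apply: (IH j (f \o (fun v => rV_cons (a, v)))).
  + by move=> v; apply: (continuous_comp (@continuous_cons_r _ _ v)); exact: cg.
  + move=> v; apply: is_derive_along (fg _) => h /=; congr f.
    apply/rowP => k; rewrite ij.
    case: (unliftP ord0 k) => [l|] ->.
      rewrite rV_consS [RHS]mxE [X in _ = X + _]mxE rV_consS /= !mxE.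
      by rewrite (inj_eq lift_inj).
    rewrite rV_cons0 [RHS]mxE [X in _ = X + _]mxE rV_cons0 /= !mxE.
    by rewrite mulr0 add0r.
  + by move=> v nv /=; apply: f0 => /open_cube_cons[].
- rewrite (cube_fubini mg bg).2.
  transitivity (\int[lebesgue_rV]_(v in open_cube R n) (0 : R)); last first.
    by rewrite Rintegral_cst ?mul0r//; exact: measurable_open_cube.
  apply: eq_Rintegral => v _.
  have fb (b : R) : b = 0 \/ b = 1 -> f (rV_cons (b, v)) = 0.
    by move=> hb; apply: f0 => /open_cube_cons[/=];
      case: hb => ->; rewrite in_itv/= ltxx ?andbF.
  transitivity (f (rV_cons (1 : R, v)) - f (rV_cons (0 : R, v))); last first.
    by rewrite !fb ?subrr//; [left|right].
  apply: (@FTC_open01 (fun a : R => f (rV_cons (a, v)))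
                       (fun a : R => g (rV_cons (a, v)))).
  + by move=> a; apply: (continuous_comp (@continuous_cons_l _ v a)); exact: cg.
  + move=> a.
    apply: (@is_derive_along R^o _ _ _ _ _ _ _ _ _ _ (fg _)) => h; congr f.
    apply/rowP => k; rewrite ij.
    case: (unliftP ord0 k) => [l|] ->.
      rewrite rV_consS [RHS]mxE [X in _ = X + _]mxE rV_consS /= !mxE.
      by rewrite mulr0 add0r.
    by rewrite rV_cons0 [RHS]mxE [X in _ = X + _]mxE rV_cons0 /= !mxE.
Qed.

End CubeMeasure.

(** * Smooth functions of one variable *)

Section SmoothLine.
Variable R : realType.
Implicit Types (f g : R -> R) (k : nat).

(** Derivability at every order already gives the continuity of all derivatives, so that no
    continuity is recorded along the recursion. *)
Fixpoint Ck k f : Prop :=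
  if k is k'.+1 then (forall x : R, derivable f x 1) /\ Ck k' (derive1 f) else True.

Definition smooth1 f := forall k, Ck k f.

Lemma CkS k f f' : (forall x : R, is_derive x 1 f (f' x)) -> Ck k f' -> Ck k.+1 f.
Proof.
move=> ff' cf'; split; first by move=> x; case: (ff' x).
by rewrite (_ : f^`()%classic = f')//; apply/funext => x; rewrite derive1E; case: (ff' x).
Qed.

Lemma Ck_is_derive k f (x : R) : Ck k.+1 f -> is_derive x 1 f (derive1 f x).
Proof. by move=> [df _]; rewrite derive1E; split. Qed.

Lemma Ck_pred k f : Ck k.+1 f -> Ck k f.
Proof. by elim: k f => // k IH f [df cf]; split => //; exact: IH. Qed.

Lemma is_derive1D f g (x a b : R) : is_derive x 1 f a -> is_derive x 1 g b ->
  is_derive x 1 (fun y => f y + g y) (a + b).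
Proof. by move=> fa gb; have := @is_deriveD _ _ _ f g x 1 a b fa gb. Qed.

Lemma is_derive1M f g (x a b : R) : is_derive x 1 f a -> is_derive x 1 g b ->
  is_derive x 1 (fun y => f y * g y) (f x * b + g x * a).
Proof. by move=> fa gb; have := @is_deriveM _ _ f g x 1 a b fa gb. Qed.

Lemma is_derive1X f n (x a : R) : is_derive x 1 f a ->
  is_derive x 1 (fun y => f y ^+ n) (n%:R * f x ^+ n.-1 * a).
Proof.
move=> fa; have := @is_deriveX _ _ f n x 1 a fa.
rewrite (_ : f ^+ n = fun y => f y ^+ n)//.
by apply/funext => y; elim: n => // n IH; rewrite !exprS -IH.
Qed.

Lemma CkD k f g : Ck k f -> Ck k g -> Ck k (fun x => f x + g x).
Proof.
elim: k f g => // k IH f g cf cg.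
apply: (@CkS _ _ (fun x => derive1 f x + derive1 g x)); last first.
  by apply: IH; [case: cf|case: cg].
by move=> x; exact: is_derive1D (Ck_is_derive x cf) (Ck_is_derive x cg).
Qed.

Lemma CkM k f g : Ck k f -> Ck k g -> Ck k (fun x => f x * g x).
Proof.
elim: k f g => // k IH f g cf cg.
apply: (@CkS _ _ (fun x => f x * derive1 g x + g x * derive1 f x)).
  by move=> x; exact: is_derive1M (Ck_is_derive x cf) (Ck_is_derive x cg).
by apply: CkD; apply: IH; [exact: Ck_pred|case: cg|exact: Ck_pred|case: cf].
Qed.

Lemma Ck_comp k f g : Ck k f -> Ck k g -> Ck k (f \o g).
Proof.
elim: k f g => // k IH f g cf cg.
apply: (@CkS _ _ (fun x => derive1 f (g x) * derive1 g x)).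
  by move=> x; exact: is_derive1_comp (Ck_is_derive (g x) cf) (Ck_is_derive x cg).
apply: CkM; last by case: cg.
by apply: IH; [case: cf|exact: Ck_pred].
Qed.

Lemma Ck_cst k (c : R) : Ck k (fun=> c).
Proof.
elim: k c => // k IH c; apply: (@CkS _ _ (fun=> 0)); exact: IH.
Qed.

Lemma Ck_id k : Ck k id.
Proof.
case: k => // k; apply: (@CkS _ _ (fun=> 1)); exact: Ck_cst.
Qed.

Lemma Ck_sin_cos k : Ck k (@sin R) /\ Ck k (@cos R).
Proof.
elim: k => // k [IHs IHc]; split; first exact: (@CkS _ _ cos).
apply: (@CkS _ _ (fun x => - sin x)).
rewrite (_ : (fun x : R => - sin x) = (fun x => -1 * sin x)).
  by apply: CkM => //; exact: Ck_cst.
by apply/funext => x; rewrite mulN1r.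
Qed.

Lemma smooth1_derivable f (x : R) : smooth1 f -> derivable f x 1.
Proof. by move=> /(_ 1%N)[]. Qed.

Lemma smooth1_is_derive f (x : R) : smooth1 f -> is_derive x 1 f (derive1 f x).
Proof. by move=> /(_ 1%N) /Ck_is_derive. Qed.

Lemma smooth1_derive1 f : smooth1 f -> smooth1 (derive1 f).
Proof. by move=> cf k; have [] := cf k.+1. Qed.

Lemma smooth1_continuous f : smooth1 f -> continuous f.
Proof.
move=> cf x; apply: differentiable_continuous; apply/derivable1_diffP.
exact: smooth1_derivable.
Qed.

Lemma smooth1_derive1n f k (x : R) : smooth1 f -> derivable (derive1n k f) x 1.
Proof.
move=> cf; suff : smooth1 (derive1n k f) by exact: smooth1_derivable.
by elim: k => // k IH; exact: smooth1_derive1.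
Qed.

(** The exponential of 1 / y is at least each term of its power series. *)
Lemma expRN_le k (y : R) : 0 < y -> expR (- y^-1) <= k.+1`!%:R * y ^+ k.+1.
Proof.
move=> y0; rewrite expRN -[leRHS]invrK lef_pV2 ?posrE ?expR_gt0//; last first.
  by rewrite invr_gt0 mulr_gt0 ?exprn_gt0// ltr0n fact_gt0.
have yi0 : 0 <= y^-1 by rewrite invr_ge0 ltW.
apply: le_trans (expR_ge1Dxn k yi0).
by rewrite invfM exprVn mulrC lerDr.
Qed.

(** The functions x^(-m) exp (-1/x), extended by 0, are stable under differentiation up to
    linear combinations: a single induction on the order treats all of them, and [theta 0] is
    the usual flat function. *)
Definition theta (m : nat) (x : R) : R :=
  if 0 < x then x^-1 ^+ m * expR (- x^-1) else 0.

Lemma theta_ge0 m x : 0 <= theta m x.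
Proof.
by rewrite /theta; case: ifP => // x0; rewrite mulr_ge0 ?expR_ge0 ?exprn_ge0 ?invr_ge0 ?ltW.
Qed.

Lemma theta_bound m k x : 0 < x -> theta m x <= (m + k).+1`!%:R * x ^+ k.+1.
Proof.
move=> x0; rewrite /theta x0.
have xm : 0 < x ^+ m by rewrite exprn_gt0.
rewrite exprVn mulrC ler_pdivrMr// -mulrA -exprD addSn [(k + m)%N]addnC.
exact: expRN_le.
Qed.

(** At 0 the difference quotient tends to 0 by [theta_bound]. *)
Lemma theta_is_derive m (x : R) :
  is_derive x 1 (theta m) (- m%:R * theta m.+1 x + theta m.+2 x).
Proof.
have [x0|x0|->] := ltgtP x 0.
- rewrite /theta !ltNge (ltW x0)/= mulr0 addr0.
  apply: (@near_eq_is_derive _ _ _ (fun=> 0)).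
    near=> y; rewrite ltNge ifF//; apply/negbF.
    by rewrite ltW//; near: y; exact: lt_nbhsl.
- rewrite /theta x0.
  apply: (@near_eq_is_derive R R^o R^o (fun y : R => y^-1 ^+ m * expR (- y^-1))).
    by near=> y; rewrite ifT//; near: y; exact: lt_nbhsr.
  have xn0 : x != 0 by rewrite gt_eqF.
  have dV : is_derive x 1 (fun y : R => y^-1) (- x ^- 2).
    have := @is_deriveV _ id x 1 1 xn0 (is_derive_id _ _).
    by rewrite [_ *: _]mulr1.
  have dX : is_derive x 1 (fun y : R => y^-1 ^+ m) (m%:R * x^-1 ^+ m.-1 * - x ^- 2).
    exact: is_derive1X dV.
  have dE : is_derive x 1 (fun y : R => expR (- y^-1)) (expR (- x^-1) * x ^- 2).
    have := @is_derive1_comp _ expR (fun y => - y^-1) x _ (x ^- 2) (is_derive_expR _).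
    apply; rewrite -[x ^- 2]opprK; exact: is_deriveN.
  apply: is_derive_eq (is_derive1M dX dE) _.
  rewrite -exprVn; case: m dX => [|m] _ /=; first by rewrite !expr0 !mul0r; ring.
  by rewrite !exprS; ring.
- rewrite {2 3}/theta !ltxx mulr0 addr0.
  have H : (fun h : R => h^-1 *: (theta m (h *: 1 + 0) - theta m 0)) @ 0^' --> 0.
    apply/cvgrPdist_le => e e0; near=> h.
    rewrite [_ *: 1]mulr1 addr0 [theta m 0]/theta ltxx subr0 sub0r normrN [_ *: _]mulrC.
    have [h0|h0] := ltP 0 h; last first.
      by rewrite /theta ltNge h0/= mul0r normr0 ltW.
    rewrite normrM ger0_norm ?theta_ge0// gtr0_norm ?invr_gt0//.
    rewrite ler_pdivrMr//; apply: le_trans (theta_bound m 1 h0) _.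
    rewrite expr2 mulrA ler_pM2r//.
    rewrite -ler_pdivlMl ?ltr0n ?fact_gt0//.
    have : `|h| <= (m + 1).+1`!%:R^-1 * e.
      near: h; apply: dnbhs0_le; rewrite mulr_gt0// invr_gt0 ltr0n fact_gt0//.
    exact: le_trans (ler_norm _).
  split; first by rewrite /derivable; apply/cvg_ex; exists 0.
  exact: cvg_lim H.
Unshelve. all: by end_near. Qed.

End SmoothLine.

(** * Approximation of a sine by test functions *)

Section SineApprox.
Variable R : realType.

Lemma sin_natpi k : sin (k%:R * pi) = 0 :> R.
Proof.
elim: k => [|k IH]; first by rewrite mul0r sin0.
by rewrite mulrSr mulrDl mul1r sinDpi IH oppr0.
Qed.

Lemma normr_sin_le (x : R) : `|sin x| <= `|x|.
Proof.
wlog x0 : x / 0 <= x => [H|].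
  have [/H//|x0] := leP 0 x.
  by have := H (- x); rewrite oppr_ge0 sinN !normrN; apply; exact: ltW.
have cs : {within `[0, x], continuous (@sin R)}.
  by apply: continuous_subspaceT => y; exact: continuous_sin.
have [c _] := @MVT_segment _ (@sin R) cos 0 x x0 (fun y _ => is_derive_sin y) cs.
rewrite sin0 !subr0 => ->; rewrite normrM ler_piMl//.
by rewrite ler_norml cos_geN1 cos_le1.
Qed.

Lemma normr_sin_natpi_le k (y : R) : 0 <= y <= 1 ->
  `|sin (k%:R * pi * y)| <= 2 * k%:R * pi * (y * (1 - y)).
Proof.
move=> /andP[y0 y1].
have kp : 0 <= k%:R * pi :> R by rewrite mulr_ge0 ?pi_ge0.
have h1 : `|sin (k%:R * pi * y)| <= k%:R * pi * y.
  by rewrite (le_trans (normr_sin_le _))// ger0_norm// mulr_ge0.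
have h2 : `|sin (k%:R * pi * y)| <= k%:R * pi * (1 - y).
  have -> : k%:R * pi * y = k%:R * pi - k%:R * pi * (1 - y) by ring.
  rewrite sinB sin_natpi mul0r sub0r normrN normrM.
  have c1 : `|cos (k%:R * pi)| <= 1 :> R by rewrite ler_norml cos_geN1 cos_le1.
  apply: le_trans (ler_piMl _ c1) _ => //.
  by rewrite (le_trans (normr_sin_le _))// ger0_norm// mulr_ge0// subr_ge0.
have [yh|yh] := leP y 2^-1.
- apply: le_trans h1 _.
  have -> : 2 * k%:R * pi * (y * (1 - y)) = k%:R * pi * y * (2 * (1 - y)) by ring.
  rewrite ler_peMr//; first by rewrite mulr_ge0.
  by lra.
- apply: le_trans h2 _.
  have -> : 2 * k%:R * pi * (y * (1 - y)) = k%:R * pi * (1 - y) * (2 * y) by ring.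
  rewrite ler_peMr//; first by rewrite mulr_ge0// subr_ge0.
  by lra.
Qed.

Lemma theta_le1 (z : R) : [/\ theta 0 z <= 1, theta 1 z <= 1 & theta 2 z <= 2].
Proof.
rewrite /theta; case: ifPn => z0; last by split.
have zi : 0 <= z^-1 by rewrite invr_ge0 ltW.
have e0 : 0 < expR z^-1 by exact: expR_gt0.
rewrite expRN expr0 mul1r expr1; split.
- by rewrite invf_le1// (le_trans _ (expR_ge1Dx _))// lerDl.
- by rewrite ler_pdivrMr// mul1r (le_trans _ (expR_ge1Dx _))// lerDr.
- rewrite ler_pdivrMr//.
  have := expR_ge1Dxn 1 zi; rewrite (_ : 2`! = 2)%N//.
  by lra.
Qed.

Lemma theta_large (z : R) : 1 <= z ->
  [/\ `|theta 0 z - 1| <= z^-1 & theta 2 z * (z + 1) <= 2 / z].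
Proof.
move=> z1; have z0 : 0 < z by exact: lt_le_trans z1.
rewrite /theta z0 expr0 mul1r.
have zi : 0 < z^-1 by rewrite invr_gt0.
have e1 : expR (- z^-1) <= 1 by rewrite expR_le1 oppr_le0 ltW.
split.
  rewrite ler0_norm ?subr_le0// opprB.
  by have := expR_ge1Dx (- z^-1); lra.
have -> : 2 / z = z^-1 ^+ 2 * (2 * z) by field; rewrite gt_eqF.
rewrite -mulrA ler_pM2l ?exprn_gt0//.
by apply: le_trans (ler_piMl _ e1) _; lra.
Qed.

(** The cutoff theta 0 (m y (1 - y) - 1) vanishes near the end points and tends to 1 inside.
    Its derivative is of size m in a layer of width 1 / m, where the sine is O(y (1 - y)): the
    derivative of the product stays bounded, as needed for dominated convergence. *)
Lemma sine_approx k : exists p : nat -> R -> R,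
  [/\ forall m, smooth1 (p m),
      forall m, exists2 e : R, 0 < e & forall y, p m y != 0 -> e <= y * (1 - y),
      forall y : R, 0 < y < 1 ->
        (p m y @[m --> \oo] --> sin (k%:R * pi * y)) /\
        (derive1 (p m) y @[m --> \oo] --> derive1 (fun y => sin (k%:R * pi * y)) y) &
      exists B : R, forall m (y : R), 0 < y < 1 ->
        `|p m y| <= B /\ `|derive1 (p m) y| <= B].
Proof.
(* The shift by 1 makes the cutoff vanish wherever y (1 - y) <= 1 / (m + 1). *)
pose z m (y : R) := m.+1%:R * (y * (1 - y)) - 1.
pose s (y : R) := sin (k%:R * pi * y).
pose c (y : R) := k%:R * pi * cos (k%:R * pi * y).
pose p m y := theta 0 (z m y) * s y.
have lin (a b : R) j : Ck j (fun y : R => a * y + b).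
  by apply: CkD; [apply: CkM; [exact: Ck_cst|exact: Ck_id]|exact: Ck_cst].
have cth m j : Ck j (theta m : R -> R).
  elim: j m => // j IH m.
  apply: CkS (theta_is_derive m) _; apply: CkD => //.
  by apply: CkM => //; exact: Ck_cst.
have cs j : Ck j s.
  rewrite /s (_ : (fun y => _) = sin \o (fun y => k%:R * pi * y + 0)).
    by apply: Ck_comp => //; case: (Ck_sin_cos R j).
  by apply/funext => y /=; rewrite addr0.
have cz m j : Ck j (z m).
  rewrite /z (_ : (fun y => _) = (fun y => m.+1%:R * (y * (-1 * y + 1)) + -1)).
    apply: CkD; last exact: Ck_cst.
    apply: CkM; first exact: Ck_cst.
    by apply: CkM; [exact: Ck_id|exact: lin].
  by apply/funext => y; ring.
have dz m (y : R) : is_derive y 1 (z m) (m.+1%:R * (1 - 2 * y)).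
  have d1 : is_derive y 1 (fun y : R => 1 - y) (-1).
    have := is_derive1D (is_derive_cst (1 : R) y 1) (is_deriveN (is_derive_id y (1 : R))).
    by rewrite add0r.
  have d2 := is_derive1M (is_derive_id y (1:R)) d1.
  have d3 := is_derive1M (is_derive_cst (m.+1%:R : R) y 1) d2.
  have d4 := is_derive1D d3 (is_derive_cst (-1 : R) y 1).
  by apply: is_derive_eq d4 _; rewrite /cst/=; ring.
have ds (y : R) : is_derive y 1 s (c y).
  have d1 := is_derive1M (is_derive_cst (k%:R * pi : R) y 1) (is_derive_id y (1:R)).
  have d2 := is_derive1_comp (is_derive_sin (k%:R * pi * y)) d1.
  by apply: is_derive_eq d2 _; rewrite /c /cst /= mulr0 addr0 mulr1 mulrC.
have dp m (y : R) : is_derive y 1 (p m)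
    (theta 0 (z m y) * c y + s y * (theta 2 (z m y) * (m.+1%:R * (1 - 2 * y)))).
  have d1 := is_derive1_comp (theta_is_derive 0 (z m y)) (dz m y).
  have := is_derive1M d1 (ds y).
  by rewrite oppr0 mul0r add0r.
have dpE m y : derive1 (p m) y =
    theta 0 (z m y) * c y + s y * (theta 2 (z m y) * (m.+1%:R * (1 - 2 * y))).
  by rewrite derive1E; case: (dp m y).
have dsE y : derive1 s y = c y by rewrite derive1E; case: (ds y).
have s1 y : `|s y| <= 1 by rewrite ler_norml sin_geN1 sin_le1.
have kp : 0 <= k%:R * pi :> R by rewrite mulr_ge0 ?pi_ge0.
have c1 y : `|c y| <= k%:R * pi.
  rewrite /c normrM ger0_norm// ler_piMr//.
  by rewrite ler_norml cos_geN1 cos_le1.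
have s2 m y : 0 < y < 1 ->
    `|s y * (theta 2 (z m y) * (m.+1%:R * (1 - 2 * y)))| <=
    2 * (k%:R * pi) * (theta 2 (z m y) * (z m y + 1)).
  move=> /andP[y0 y1].
  have hs : `|s y| <= 2 * k%:R * pi * (y * (1 - y)).
    by apply: normr_sin_natpi_le; rewrite !ltW.
  have t2 := theta_ge0 2 (z m y).
  have -> : s y * (theta 2 (z m y) * (m.+1%:R * (1 - 2 * y))) =
    theta 2 (z m y) * m.+1%:R * (s y * (1 - 2 * y)) by ring.
  have -> : 2 * (k%:R * pi) * (theta 2 (z m y) * (z m y + 1)) =
    theta 2 (z m y) * m.+1%:R * (2 * k%:R * pi * (y * (1 - y))).
    by rewrite /z; ring.
  rewrite normrM ger0_norm ?mulr_ge0// ler_wpM2l ?mulr_ge0//.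
  rewrite normrM; apply: le_trans hs; rewrite ler_piMr//.
  by rewrite ler_norml; lra.
exists p; split.
- by move=> m j; apply: CkM => //; apply: Ck_comp.
- move=> m; exists m.+1%:R^-1; first by rewrite invr_gt0.
  move=> y; apply: contraNle => h; rewrite /p /theta ltNge.
  suff -> : z m y <= 0 by rewrite mul0r.
  by rewrite /z subr_le0 -ler_pdivlMl// mulr1 ltW.
- move=> y /[dup] y01 /andP[y0 y1].
  have a0 : 0 < y * (1 - y) by rewrite mulr_gt0// subr_gt0.
  have zoo (C : R) : \forall m \near \oo, C < z m y.
    near=> m; rewrite /z ltrBrDr -ltr_pdivrMr//.
    have : (C + 1) / (y * (1 - y)) < m%:R.
      by near: m; exact: nbhs_infty_gtr.
    by move=> h; apply: lt_le_trans h _; rewrite ler_nat.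
  split.
    apply/cvgrPdist_le => e e0; near=> m.
    have z1 : 1 <= z m y by apply: ltW; near: m; exact: zoo.
    have ze : (z m y)^-1 <= e.
      rewrite invf_ple ?posrE//; last exact: lt_le_trans z1.
      by apply: ltW; near: m; exact: zoo.
    have [t0 _] := theta_large z1.
    rewrite -/(s y) -normrN opprB /p -[X in _ - X]mul1r -mulrBl normrM.
    by apply: le_trans (ler_piMr _ (s1 y)) _ => //; exact: le_trans t0 _.
  rewrite dsE; apply/cvgrPdist_le => e e0; near=> m.
  have z1 : 1 <= z m y by apply: ltW; near: m; exact: zoo.
  have z0 : 0 < z m y by exact: lt_le_trans z1.
  have ze : 5 * (k%:R * pi) / z m y <= e.
    rewrite ler_pdivrMr// [e * _]mulrC -ler_pdivrMr//.
    by apply: ltW; near: m; exact: zoo.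
  have [t0 t2] := theta_large z1.
  apply: le_trans ze; rewrite dpE -normrN opprB addrAC -[X in _ - X + _]mul1r -mulrBl.
  apply: le_trans (ler_normD _ _) _.
  have -> : 5 * (k%:R * pi) / z m y = (z m y)^-1 * (k%:R * pi) + 2 * (k%:R * pi) * (2 / z m y).
    by field; rewrite gt_eqF.
  apply: lerD; first by rewrite normrM ler_pM.
  by apply: le_trans (s2 m y y01) _; rewrite ler_wpM2l// mulr_ge0.
- exists (1 + 7 * (k%:R * pi)) => m y y01.
  have [t0 t1 t2] := theta_le1 (z m y).
  have hth : `|theta 0 (z m y)| <= 1 by rewrite ger0_norm ?theta_ge0.
  split.
    rewrite /p normrM; apply: le_trans (ler_pM _ _ hth (s1 y)) _ => //.
    by rewrite mulr1 lerDl mulr_ge0.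
  rewrite dpE; apply: le_trans (ler_normD _ _) _.
  have h3 : theta 2 (z m y) * (z m y + 1) <= 3.
    have [z0|z0] := leP (z m y) 0.
      by rewrite /theta ltNge z0/= mul0r.
    rewrite mulrDr mulr1.
    have -> : theta 2 (z m y) * z m y = theta 1 (z m y).
      by rewrite /theta z0; field; rewrite gt_eqF.
    by lra.
  have h4 : `|theta 0 (z m y) * c y| <= k%:R * pi.
    by rewrite normrM -[leRHS]mul1r ler_pM.
  have h5 := s2 m y y01.
  have h6 : 2 * (k%:R * pi) * (theta 2 (z m y) * (z m y + 1)) <= 2 * (k%:R * pi) * 3.
    by rewrite ler_wpM2l// mulr_ge0.
  by lra.
Unshelve. all: by end_near. Qed.

End SineApprox.

(** * Square integrable functions on the cube *)

Section RintegralSum.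
Context d (T : measurableType d) (R : realType) (mu : {measure set T -> \bar R}).

Lemma integrable_EFinZ (D : set T) (c : R) (f : T -> R) : measurable D ->
  mu.-integrable D (EFin \o f) -> mu.-integrable D (EFin \o (fun x => c * f x)).
Proof. by move=> mD If; apply: eq_integrable (integrableZl mD c If). Qed.

Lemma integrable_EFinD (D : set T) (f g : T -> R) : measurable D ->
  mu.-integrable D (EFin \o f) -> mu.-integrable D (EFin \o g) ->
  mu.-integrable D (EFin \o (fun x => f x + g x)).
Proof. by move=> mD If Ig; apply: eq_integrable (integrableD mD If Ig). Qed.

Lemma integrable_EFinB (D : set T) (f g : T -> R) : measurable D ->
  mu.-integrable D (EFin \o f) -> mu.-integrable D (EFin \o g) ->
  mu.-integrable D (EFin \o (fun x => f x - g x)).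
Proof. by move=> mD If Ig; apply: eq_integrable (integrableB mD If Ig). Qed.

Lemma Rintegral_bigsum (D : set T) I (r : seq I) (F : I -> T -> R) : measurable D ->
  (forall i, mu.-integrable D (EFin \o F i)) ->
  mu.-integrable D (EFin \o (fun x => \sum_(i <- r) F i x)) /\
  \int[mu]_(x in D) (\sum_(i <- r) F i x) = \sum_(i <- r) \int[mu]_(x in D) F i x.
Proof.
move=> mD iF; elim: r => [|i r [IH1 IH2]].
  split; first by under eq_fun do rewrite big_nil; exact: integrable0.
  under eq_Rintegral do rewrite big_nil.
  by rewrite big_nil /Rintegral integral0.
split.
  rewrite (_ : (fun x => _) = fun x => F i x + \sum_(j <- r) F j x).
    exact: integrable_EFinD.
  by apply/funext => x; rewrite big_cons.
under eq_Rintegral do rewrite big_cons.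
by rewrite RintegralD// IH2 big_cons.
Qed.

End RintegralSum.

Section L2Cube.
Variables (R : realType) (n : nat).
Implicit Types (f g h : 'rV[R]_n -> R).
Local Notation Om := (open_cube R n).
Local Notation mu := (@lebesgue_rV R n).
Let mOm : measurable Om. Proof. exact: measurable_open_cube. Qed.

Lemma LpNorm2E f : LpNorm Om 2%:E f =
  ((\int[mu]_(x in Om) (f x ^+ 2)%:E) `^ 2^-1)%E.
Proof.
rewrite /LpNorm unlock; congr (_ `^ _)%E; rewrite [RHS]integral_mkcond.
apply: eq_integral => x _ /=; rewrite !patchE; case: ifPn => _.
  by rewrite powR_mulrn// -normrX ger0_norm// sqr_ge0.
by rewrite normr0 powR0.
Qed.

Lemma LpOn2P f : LpOn Om 2%:E f <->
  measurable_fun Om f /\ (\int[mu]_(x in Om) (f x ^+ 2)%:E < +oo)%E.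
Proof.
have E : finite_norm mu 2%:E (f \_ Om) <-> (\int[mu]_(x in Om) (f x ^+ 2)%:E < +oo)%E.
  rewrite /finite_norm -[X in (X < _)%E]/(LpNorm Om 2%:E f) LpNorm2E.
  by split=> [/lty_poweRy|/(poweR_lty _)]; apply.
split.
  rewrite /LpOn inE => /andP[]; rewrite !inE/= => h1 /E h2; split => //.
  exact: (measurable_restrictT f mOm).2 h1.
move=> [h1 /E h2]; rewrite /LpOn inE; apply/andP; split; rewrite inE//=.
exact: (measurable_restrictT f mOm).1 h1.
Qed.

Lemma LpOn2_integrable_sqr f : LpOn Om 2%:E f ->
  mu.-integrable Om (fun x => (f x ^+ 2)%:E).
Proof.
move=> /LpOn2P[mf If]; apply/integrableP; split.
  by apply/measurable_EFinP; exact: measurable_funX.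
by under eq_integral do rewrite abse_EFin ger0_norm ?sqr_ge0//.
Qed.

Lemma LpOn2_bounded f : measurable_fun Om f -> cube_bounded f -> LpOn Om 2%:E f.
Proof.
move=> mf [B fB]; apply/LpOn2P; split => //.
have /integrableP[_] : mu.-integrable Om (EFin \o (fun x => f x ^+ 2)).
  apply: cube_integrable; first exact: measurable_funX.
  by exists (B ^+ 2) => x /fB h; rewrite normrX lerXn2r ?nnegrE// (le_trans _ h).
by under eq_integral do rewrite /= ger0_norm ?sqr_ge0//.
Qed.

Lemma continuous_LpOn2 f : continuous f -> LpOn Om 2%:E f.
Proof.
move=> cf; apply: LpOn2_bounded; last exact: continuousT_cube_bounded.
by apply: measurable_funTS; exact: continuous_measurable_rV.
Qed.

Lemma LpOn2_mul_integrable f g : LpOn Om 2%:E f -> LpOn Om 2%:E g ->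
  mu.-integrable Om (EFin \o (fun x => f x * g x)).
Proof.
move=> lf lg; have [mf _] := (LpOn2P f).1 lf; have [mg _] := (LpOn2P g).1 lg.
apply: le_integrable (integrableD mOm (LpOn2_integrable_sqr lf) (LpOn2_integrable_sqr lg)) => //.
  by apply/measurable_EFinP; exact: measurable_funM.
move=> x _ /=; rewrite lee_fin normrM [leRHS]ger0_norm ?addr_ge0 ?sqr_ge0//.
rewrite -[f x ^+ 2]real_normK ?num_real// -[g x ^+ 2]real_normK ?num_real//.
have := normr_ge0 (f x); have := normr_ge0 (g x).
by set a := `|f x|; set b := `|g x|; nra.
Qed.

Lemma LpOn2B f g : LpOn Om 2%:E f -> LpOn Om 2%:E g -> LpOn Om 2%:E (f - g).
Proof.
move=> lf lg; have [mf If] := (LpOn2P f).1 lf; have [mg Ig] := (LpOn2P g).1 lg.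
apply/LpOn2P; split; first exact: measurable_funB.
have i2 := integrableD mOm (LpOn2_integrable_sqr lf) (LpOn2_integrable_sqr lg).
have /integrableP[_] : mu.-integrable Om (EFin \o (fun x => (f x - g x) ^+ 2)).
  apply: le_integrable (integrableZl mOm 2 i2) => //.
    by apply/measurable_EFinP; apply: measurable_funX; exact: measurable_funB.
  move=> x _ /=; rewrite lee_fin ger0_norm ?sqr_ge0// ger0_norm; last first.
    by rewrite mulr_ge0// addr_ge0 ?sqr_ge0.
  by set a := f x; set b := g x; have := sqr_ge0 (a + b); nra.
by under eq_integral do rewrite /= ger0_norm ?sqr_ge0//.
Qed.

Lemma L2_innerB f g h : LpOn Om 2%:E f -> LpOn Om 2%:E g -> LpOn Om 2%:E h ->
  L2_inner Om (f - g) h = L2_inner Om f h - L2_inner Om g h.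
Proof.
move=> lf lg lh; rewrite /L2_inner -RintegralB//; last 2 first.
- exact: LpOn2_mul_integrable.
- exact: LpOn2_mul_integrable.
by apply: eq_Rintegral => x _; rewrite mulrBl.
Qed.

Lemma L2_innerC f g : L2_inner Om f g = L2_inner Om g f.
Proof. by apply: eq_Rintegral => x _; rewrite mulrC. Qed.

Lemma LpNorm2_le f (e : R) : 0 <= e ->
  (LpNorm Om 2%:E f <= e%:E)%E <-> (\int[mu]_(x in Om) (f x ^+ 2)%:E <= (e ^+ 2)%:E)%E.
Proof.
move=> e0; rewrite LpNorm2E; set I := integral _ _ _.
have I0 : (0 <= I)%E by apply: integral_ge0 => x _; rewrite lee_fin sqr_ge0.
have e2 : e%:E = ((e ^+ 2)%:E `^ 2^-1)%E.
  by rewrite poweR_EFin -powR_mulrn// -powRrM mulfV// powRr1.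
have pI : I = ((I `^ 2^-1) `^ 2)%E by rewrite -poweRrM mulVf// poweRe1.
split=> h; last first.
  rewrite e2; apply: gt0_ler_poweR => //.
  - by rewrite in_itv/= I0 leey.
  - by rewrite in_itv/= lee_fin sqr_ge0 leey.
rewrite pI (_ : (e ^+ 2)%:E = e%:E `^ 2)%E; last by rewrite poweR_EFin powR_mulrn.
apply: gt0_ler_poweR => //.
- by rewrite in_itv/= poweR_ge0 leey.
- by rewrite in_itv/= lee_fin e0 leey.
Qed.

(** Integrates |f| B <= B e / 2 + B f^2 / (2 e), the measure of the cube being 1. *)
Lemma L2_inner_le f h (e B : R) : LpOn Om 2%:E f -> LpOn Om 2%:E h ->
  0 < e -> (LpNorm Om 2%:E f <= e%:E)%E ->
  (forall x, Om x -> `|h x| <= B) -> 0 <= B -> `|L2_inner Om f h| <= B * e.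
Proof.
move=> lf lh e0 /(LpNorm2_le _ (ltW e0)) fe hB B0.
have ifh := LpOn2_mul_integrable lf lh.
have i2 := LpOn2_integrable_sqr lf.
have i1 : mu.-integrable Om (EFin \o cst (B * e / 2)).
  apply: cube_integrable; first exact: measurable_cst.
  by exists `|B * e / 2|.
have i3 := integrableZl mOm (B / (2 * e)) i2.
apply: le_trans (le_normr_Rintegral mOm ifh) _.
have i4 : mu.-integrable Om (EFin \o (fun x => B * e / 2 + B / (2 * e) * f x ^+ 2)).
  by apply: eq_integrable (integrableD mOm i1 i3).
apply: (@le_trans _ _ (\int[mu]_(x in Om) (B * e / 2 + B / (2 * e) * f x ^+ 2))).
  apply: le_Rintegral => //.
    by have := integrable_norm ifh.
  move=> x xO /=; rewrite normrM.
  apply: (@le_trans _ _ (`|f x| * B)); first by rewrite ler_wpM2l// hB.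
  rewrite -[f x ^+ 2]real_normK ?num_real//.
  have -> : B * e / 2 + B / (2 * e) * `|f x| ^+ 2 =
    `|f x| * B + B / (2 * e) * (`|f x| - e) ^+ 2 by field; rewrite gt_eqF.
  by rewrite lerDl mulr_ge0 ?sqr_ge0// divr_ge0// mulr_ge0// ltW.
rewrite RintegralD//= Rintegral_cst// [X in fine X]lebesgue_open_cube mulr1.
rewrite RintegralZl//.
have : \int[mu]_(x in Om) f x ^+ 2 <= e ^+ 2.
  rewrite -lee_fin fineK//; exact: integrable_fin_num i2.
move=> h2; apply: (@le_trans _ _ (B * e / 2 + B / (2 * e) * e ^+ 2)).
  by rewrite lerD2l ler_wpM2l// divr_ge0// mulr_ge0// ltW.
rewrite le_eqVlt; apply/orP; left; apply/eqP.
by field; rewrite gt_eqF.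
Qed.

End L2Cube.

(** * Products of functions of one variable *)

Section ProductFunctions.
Variables (R : realType) (n : nat).
Local Notation Om := (open_cube R n).
Local Notation mu := (@lebesgue_rV R n).
Implicit Types (g : 'I_n -> R -> R).
Let mOm : measurable Om. Proof. exact: measurable_open_cube. Qed.

Definition tensor g (x : 'rV[R]_n) : R := \prod_i g i (x ord0 i).

Definition tensor_deriv (i : 'I_n) g : 'I_n -> R -> R :=
  fun j => if j == i then derive1 (g j) else g j.

Lemma tensor_deriv_smooth i g :
  (forall j, smooth1 (g j)) -> forall j, smooth1 (tensor_deriv i g j).
Proof. by move=> gs j; rewrite /tensor_deriv; case: ifP => // _; exact: smooth1_derive1. Qed.

Lemma tensor_continuous g : (forall j, smooth1 (g j)) -> continuous (tensor g).
Proof.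
by move=> gs; apply: continuous_coord_prod => i; exact: smooth1_continuous.
Qed.

Lemma tensor_is_derive i g x : (forall j, smooth1 (g j)) ->
  is_derive x (delta_mx ord0 i) (tensor g) (tensor (tensor_deriv i g) x).
Proof.
move=> gs; pose c := \prod_(j | j != i) g j (x ord0 j).
have d1 : is_derive (x ord0 i) 1 (fun y => g i y * c) (derive1 (g i) (x ord0 i) * c).
  have := is_derive1M (smooth1_is_derive (x ord0 i) (gs i)) (is_derive_cst c (x ord0 i) 1).
  by rewrite mulr0 add0r mulrC.
have -> : tensor (tensor_deriv i g) x = derive1 (g i) (x ord0 i) * c.
  rewrite /tensor (bigD1 i)//= /tensor_deriv eqxx; congr (_ * _).
  by apply: eq_bigr => j /negPf ->.
apply: is_derive_along d1 => h.
rewrite /tensor (bigD1 i)//=; congr (_ * _).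
  by rewrite !mxE !eqxx /=.
apply: eq_bigr => j /negPf ji.
by rewrite !mxE ji andbF /= mulr0 add0r.
Qed.

Lemma partial_tensor i g : (forall j, smooth1 (g j)) ->
  partial i (tensor g) = tensor (tensor_deriv i g).
Proof. by move=> gs; apply/funext => x; case: (tensor_is_derive i x gs). Qed.

Lemma tensor_smooth g : (forall j, smooth1 (g j)) -> smooth (tensor g).
Proof.
move=> gs s.
have [h [hs ->]] : exists h, (forall j, smooth1 (h j)) /\
    foldr (@partial R n) (tensor g) s = tensor h.
  elim: s => [|i s [h [hs IH]]]; first by exists g.
  exists (tensor_deriv i h); split; first exact: tensor_deriv_smooth.
  by rewrite /= IH partial_tensor.
split; first exact: tensor_continuous.
by move=> i x; case: (tensor_is_derive i x hs).
Qed.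

(** A product vanishes as soon as one factor does, so its support stays in a smaller closed
    cube. *)
Lemma tensor_test_function g : (forall j, smooth1 (g j)) ->
  (exists2 e : R, 0 < e & forall j y, g j y != 0 -> e <= y * (1 - y)) ->
  test_function Om (tensor g).
Proof.
move=> gs [e e0 ge].
pose K := \bigcap_(i in [set: 'I_n])
  ((fun x : 'rV[R]_n => x ord0 i * (1 - x ord0 i)) @^-1` [set y | e <= y]).
have Kcl : closed K.
  apply: closed_bigI => i _; apply: preimage_closed; last exact: closed_ge.
  move=> x _; apply: (@continuous_coord R n (fun y => y * (1 - y)) i) => y.
  by apply: cvgM => //; apply: cvgB => //; exact: cvg_cst.
have SK : closure [set x | tensor g x != 0] `<=` K.
  rewrite closureE => x; apply; split => // y /= gy i _ /=.
  apply: (ge i); apply: contra gy => /eqP h.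
  by rewrite /tensor (bigD1 i)//= h mul0r.
have K01 x : K x -> forall i, 0 < x ord0 i < 1.
  move=> Kx i; have /= := Kx i I; set y := x ord0 i => h.
  by apply/andP; split; nra.
split; first exact: tensor_smooth.
- apply: (subclosed_compact (@closed_closure _ _) (@compact_closed_cube R n)).
  move=> x /SK/K01 h i; rewrite /= in_itv/=; have /andP[h1 h2] := h i.
  by rewrite !ltW.
- by move=> x /SK/K01.
Qed.

Lemma test_function_out psi x : test_function Om psi -> ~ Om x -> psi x = 0.
Proof.
move=> [_ _ h] nx; apply/eqP/negPn/negP => px; apply: nx; apply: h.
exact: subset_closure.
Qed.

Lemma smooth_partial i psi : smooth psi -> continuous (@partial R n i psi) /\
  forall x, is_derive x (delta_mx ord0 i) psi (partial i psi x).
Proof.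
move=> ps; split; first by have [] := ps [:: i].
by move=> x; have [_ h] := ps [::]; split => //; exact: (h i x).
Qed.

Lemma smooth_continuous psi : smooth psi -> continuous (psi : 'rV[R]_n -> R).
Proof. by move=> ps; have [] := ps [::]. Qed.

(** The product [psi * f] vanishes outside the cube, so the integral of its i-th derivative
    is zero. *)
Lemma integration_by_parts i psi f f' : test_function Om psi ->
  continuous f -> continuous f' ->
  (forall x, is_derive x (delta_mx ord0 i) f (f' x)) ->
  L2_inner Om f (partial i psi) = - L2_inner Om f' psi.
Proof.
move=> tpsi cf cf' df.
have [spsi _ _] := tpsi; have [cpi dpi] := smooth_partial i spsi.
have cpsi := smooth_continuous spsi.
have c1 : continuous (fun x => f x * partial i psi x).
  by move=> x; exact: cvgM (cf x) (cpi x).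
have c2 : continuous (fun x => f' x * psi x).
  by move=> x; exact: cvgM (cf' x) (cpsi x).
apply/eqP; rewrite -subr_eq0 opprK /L2_inner -RintegralD//; last 2 first.
- by apply: LpOn2_mul_integrable; exact: continuous_LpOn2.
- by apply: LpOn2_mul_integrable; exact: continuous_LpOn2.
apply/eqP; apply: (@cube_integral_derive0 _ _ i (fun x => f x * psi x)).
- by move=> x; exact: cvgD (c1 x) (c2 x).
- move=> x; have := @is_deriveM _ _ f psi x (delta_mx ord0 i) _ _ (df x) (dpi x).
  by rewrite /GRing.scale/= [psi x * _]mulrC.
- by move=> x nx; rewrite (test_function_out tpsi nx) mulr0.
Qed.

End ProductFunctions.

(** * Smooth functions in the Sobolev space *)

Section SmoothSobolev.
Variables (R : realType) (n : nat).
Local Notation Om := (open_cube R n).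
Local Notation mu := (@lebesgue_rV R n).
Let mOm : measurable Om. Proof. exact: measurable_open_cube. Qed.

(** Smooth functions enter H^1 with their classical gradient. *)
Definition sob (f : 'rV[R]_n -> R) : sobolev R n := (f, fun i => partial i f).

Lemma smooth_H1 f : smooth f -> H1 Om (sob f).
Proof.
move=> sf; have cf := smooth_continuous sf.
split; first exact: continuous_LpOn2.
move=> i; have [cp dp] := smooth_partial i sf; split; first exact: continuous_LpOn2.
by move=> psi tpsi; apply: integration_by_parts.
Qed.

Lemma H1_norm_sq (F : sobolev R n) : H1_norm Om F =
  ((\int[mu]_(x in Om) (F.1 x ^+ 2)%:E +
    \sum_(i < n) \int[mu]_(x in Om) (F.2 i x ^+ 2)%:E) `^ 2^-1)%E.
Proof.
have sq f : (LpNorm Om 2%:E f ^+ 2 = \int[mu]_(x in Om) (f x ^+ 2)%:E)%E.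
  rewrite LpNorm2E; set I := integral _ _ _.
  have I0 : (0 <= I)%E by apply: integral_ge0 => x _; rewrite lee_fin sqr_ge0.
  have pI : I = ((I `^ 2^-1) `^ 2)%E by rewrite -poweRrM mulVf// poweRe1.
  rewrite [RHS]pI; set J := poweR I _; have : (0 <= J)%E by exact: poweR_ge0.
  case: J => [r||]// r0; first by rewrite poweR_EFin powR_mulrn// EFin_expe.
  by rewrite poweRyr ?pnatr_eq0.
by rewrite /H1_norm sq; under eq_bigr do rewrite sq.
Qed.

Lemma LpNorm_le_H1_norm (F : sobolev R n) (e : R) : 0 <= e ->
  (H1_norm Om F <= e%:E)%E ->
  (LpNorm Om 2%:E F.1 <= e%:E)%E /\ forall i, (LpNorm Om 2%:E (F.2 i) <= e%:E)%E.
Proof.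
move=> e0 Fe.
have i0 f : (0 <= \int[mu]_(x in Om) (f x ^+ 2)%:E)%E.
  by apply: integral_ge0 => x _; rewrite lee_fin sqr_ge0.
have s0 (P : pred 'I_n) : (0 <= \sum_(i < n | P i) \int[mu]_(x in Om) (F.2 i x ^+ 2)%:E)%E.
  by apply: sume_ge0.
have key f : (\int[mu]_(x in Om) (f x ^+ 2)%:E <= \int[mu]_(x in Om) (F.1 x ^+ 2)%:E +
    \sum_(i < n) \int[mu]_(x in Om) (F.2 i x ^+ 2)%:E)%E ->
    (LpNorm Om 2%:E f <= e%:E)%E.
  move=> h; apply: le_trans Fe; rewrite LpNorm2E H1_norm_sq.
  apply: gt0_ler_poweR => //; rewrite in_itv/= leey andbT//.
  by rewrite adde_ge0// (s0 xpredT).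
split; first by apply: key; rewrite leeDl// (s0 xpredT).
move=> i; apply: key; rewrite (bigD1 i)//= addeCA leeDl//.
by rewrite adde_ge0// (s0 (fun j => j != i)).
Qed.

End SmoothSobolev.

(** * The sines in the Sobolev space *)

Section SineEigen.
Variables (R : realType) (n : nat).
Local Notation Om := (open_cube R n).
Local Notation mu := (@lebesgue_rV R n).
Let mOm : measurable Om. Proof. exact: measurable_open_cube. Qed.
Implicit Types (k : 'I_n -> nat).

Definition sines k : 'I_n -> R -> R := fun i y => sin ((k i)%:R * pi * y).

Definition sine k : 'rV[R]_n -> R := tensor (sines k).

Definition sine_eigenvalue k : R := \sum_i ((k i)%:R * pi) ^+ 2.

Lemma sin_scale_is_derive (a y : R) :
  is_derive y 1 (fun y => sin (a * y)) (a * cos (a * y)).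
Proof.
have d1 := is_derive1M (is_derive_cst a y 1) (is_derive_id y (1:R)).
have d2 := is_derive1_comp (is_derive_sin (a * y)) d1.
by apply: is_derive_eq d2 _; rewrite /cst /= mulr0 addr0 mulr1 mulrC.
Qed.

Lemma cos_scale_is_derive (a y : R) :
  is_derive y 1 (fun y => cos (a * y)) (- (a * sin (a * y))).
Proof.
have d1 := is_derive1M (is_derive_cst a y 1) (is_derive_id y (1:R)).
have d2 := is_derive1_comp (is_derive_cos (a * y)) d1.
by apply: is_derive_eq d2 _; rewrite /cst /= mulr0 addr0 mulr1 mulNr mulrC.
Qed.

Lemma sines_smooth k i : smooth1 (sines k i).
Proof.
move=> j; rewrite /sines (_ : (fun y => _) = sin \o (fun y => (k i)%:R * pi * y)).
  apply: Ck_comp; first by case: (Ck_sin_cos R j).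
  by apply: CkM; [exact: Ck_cst|exact: Ck_id].
by apply/funext.
Qed.

Lemma sine_continuous k : continuous (sine k).
Proof. by apply: tensor_continuous; exact: sines_smooth. Qed.

Lemma sine_LpOn2 k : LpOn Om 2%:E (sine k).
Proof. exact/continuous_LpOn2/sine_continuous. Qed.

Lemma normr_sine_le1 k x : `|sine k x| <= 1.
Proof.
rewrite normr_prod; apply: prodr_ile1 => i _.
by rewrite normr_ge0 ler_norml sin_geN1 sin_le1.
Qed.

Lemma sine_smooth k : smooth (sine k).
Proof. by apply: tensor_smooth; exact: sines_smooth. Qed.

Lemma partial2_sine k i :
  partial i (partial i (sine k)) = fun x => - ((k i)%:R * pi) ^+ 2 * sine k x.
Proof.
rewrite partial_tensor; last exact: sines_smooth.
rewrite partial_tensor; last by apply: tensor_deriv_smooth; exact: sines_smooth.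
apply/funext => x; rewrite /sine /tensor (bigD1 i)//= [in RHS](bigD1 i)//= mulrA.
congr (_ * _); last by apply: eq_bigr => j /negPf ji; rewrite /tensor_deriv ji.
rewrite /tensor_deriv eqxx /sines; set a := _%:R * pi.
have -> : derive1 (fun y : R => sin (a * y)) = fun y => a * cos (a * y).
  by apply/funext => y; rewrite derive1E; case: (sin_scale_is_derive a y).
have d1 := is_derive1M (is_derive_cst a (x ord0 i) 1) (cos_scale_is_derive a (x ord0 i)).
by rewrite derive1E; case: d1 => _ ->; rewrite /cst; ring.
Qed.

(** Dominated convergence: the products are bounded by the product of the bounds. *)
Lemma tensor_sq_cvg (g : 'I_n -> R -> R) (gm : 'I_n -> nat -> R -> R) :
  (forall i, continuous (g i)) -> (forall i m, continuous (gm i m)) ->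
  (forall i y, 0 < y < 1 -> gm i m y @[m --> \oo] --> g i y) ->
  (exists B : R, forall i m y, 0 < y < 1 -> `|gm i m y| <= B) ->
  (\int[mu]_(x in Om) ((tensor g x - tensor (fun i => gm i m) x) ^+ 2)%:E)%E
    @[m --> \oo] --> (0 : \bar R).
Proof.
move=> cg cgm gmg [B0 gmB0]; pose B := `|B0|.
have B_ge0 : 0 <= B by exact: normr_ge0.
have gmB i m y : 0 < y < 1 -> `|gm i m y| <= B.
  by move=> y01; apply: le_trans (gmB0 i m y y01) (ler_norm _).
have ctg : continuous (tensor g) by exact: continuous_coord_prod.
have ctm m : continuous (tensor (fun i => gm i m)).
  by apply: continuous_coord_prod => i.
have [B2 hB2] := continuousT_cube_bounded ctg.
pose d m x := (tensor g x - tensor (fun i => gm i m) x) ^+ 2.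
have md m : measurable_fun Om (d m).
  apply: measurable_funX; apply: measurable_funB; apply: measurable_funTS;
    exact: continuous_measurable_rV.
have := @dominated_convergence _ _ R mu Om mOm (fun m x => (d m x)%:E) (cst 0%E)
  (EFin \o cst ((B2 + B ^+ n) ^+ 2)).
case.
- by move=> m; apply/measurable_EFinP.
- exact: measurable_cst.
- apply: aeW => x xO; apply: cvg_EFin; first by near=> m.
  rewrite [X in _ --> X](_ : _ = (tensor g x - tensor g x) ^+ 2); last first.
    by rewrite subrr expr0n.
  rewrite /d /comp/=.
  apply: (cvg_comp (fun m => tensor g x - tensor (fun i => gm i m) x) (fun y => y ^+ 2));
    last exact: exprn_continuous.
  apply: cvgB; first exact: cvg_cst.
  rewrite /tensor; move: (index_enum _) => r.
  elim: r => [|i r IH].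
    by under eq_fun do rewrite big_nil; rewrite big_nil; exact: cvg_cst.
  under eq_fun do rewrite big_cons; rewrite big_cons.
  by apply: cvgM => //; apply: gmg; exact: xO.
- apply: cube_integrable; first exact: measurable_cst.
  by exists `|(B2 + B ^+ n) ^+ 2|.
- apply: aeW => x m xO; rewrite lee_fin /d /= normrX lerXn2r ?nnegrE//.
    by apply: addr_ge0; [exact: le_trans (hB2 x xO)|rewrite exprn_ge0].
  apply: le_trans (ler_normB _ _) _; apply: lerD; first exact: hB2.
  rewrite normr_prod.
  apply: (@le_trans _ _ (\prod_(i < n) B)).
    by apply: ler_prod => i _; rewrite normr_ge0 gmB.
  by rewrite prodr_const card_ord.
move=> _ _; rewrite integral_cst//= mul0e.
exact.
Unshelve. all: by end_near. Qed.

(** The approximants are products of the functions of [sine_approx]; their partial derivatives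
    are again products, so [tensor_sq_cvg] handles the functions and their gradients alike. *)
Lemma sine_H10 k : H10 Om (sob (sine k)).
Proof.
split; first exact/smooth_H1/sine_smooth.
move=> e e0.
have /choice[P HP] := fun i : 'I_n => @sine_approx R (k i).
pose psi m := tensor (fun i => P i m).
have Ps m i : smooth1 (P i m) by have [h _ _ _] := HP i.
have tpsi m : test_function Om (psi m).
  apply: tensor_test_function => //.
  have /choice[d hd] : forall i, exists d : R, 0 < d /\
      forall y, P i m y != 0 -> d <= y * (1 - y).
    by move=> i; have [_ /(_ m)[d d0 hd] _ _] := HP i; exists d.
  exists (\big[Num.min/1]_i d i).
    by apply: lt_bigmin => // i _; have [] := hd i.
  move=> j y /((hd j).2); apply: le_trans.
  exact: bigmin_le_cond.
have bnd i : exists B : R, forall m (y : R), 0 < y < 1 ->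
    `|P i m y| <= B /\ `|derive1 (P i m) y| <= B.
  by have [_ _ _] := HP i.
have /choice[B hB] := bnd.
have [BB hBB] : exists BB, forall i, B i <= BB.
  exists (\big[Num.max/0]_i B i) => i; exact: le_bigmax.
pose I0 m := (\int[mu]_(x in Om) ((sine k x - psi m x) ^+ 2)%:E)%E.
pose I1 i m := (\int[mu]_(x in Om)
  ((partial i (sine k) x - partial i (psi m) x) ^+ 2)%:E)%E.
have cI0 : I0 m @[m --> \oo] --> (0 : \bar R).
  apply: (@tensor_sq_cvg _ P) => //.
  - by move=> i; exact/smooth1_continuous/sines_smooth.
  - by move=> i m; exact/smooth1_continuous.
  - by move=> i y y01; have [_ _ /(_ y y01)[]] := HP i.
  - exists BB => i m y y01; apply: le_trans (hBB i).
    by have [] := hB i m y y01.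
have cI1 i : I1 i m @[m --> \oo] --> (0 : \bar R).
  rewrite /I1 partial_tensor; last exact: sines_smooth.
  under eq_fun do rewrite partial_tensor//.
  apply: (@tensor_sq_cvg _ (fun j m => tensor_deriv i (fun j => P j m) j)).
  - by move=> j; apply/smooth1_continuous; apply: tensor_deriv_smooth; exact: sines_smooth.
  - by move=> j m; apply/smooth1_continuous; exact: tensor_deriv_smooth.
  - move=> j y y01; have [_ _ /(_ y y01)[h1 h2] _] := HP j.
    by rewrite /tensor_deriv; case: ifP.
  - exists BB => j m y y01; apply: le_trans (hBB j).
    by rewrite /tensor_deriv; have [h1 h2] := hB j m y y01; case: ifP.
(* The squared H^1 norm is a sum of n + 1 integrals. *)
pose de : R := (e / 2) ^+ 2 / n.+1%:R.
have de0 : 0 < de by rewrite divr_gt0// exprn_gt0// divr_gt0.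
have near0 (I : nat -> \bar R) : I m @[m --> \oo] --> (0 : \bar R) ->
    \forall m \near \oo, (I m <= de%:E)%E.
  move=> /fine_cvgP[fI]; move/cvgrPdist_le => /(_ _ de0) h.
  near=> m.
  have fm : I m \is a fin_num by near: m.
  rewrite -(fineK fm) lee_fin (le_trans (ler_norm _))//.
  by rewrite -normrN -sub0r; near: m.
have [m [m0 m1]] : exists m, (I0 m <= de%:E)%E /\ forall i, (I1 i m <= de%:E)%E.
  suff : \forall m \near \oo, (I0 m <= de%:E)%E /\ forall i, (I1 i m <= de%:E)%E.
    by move=> /filter_ex.
  near=> m; split; first by near: m; exact: near0.
  by near: m; apply: filter_forall => i; exact: near0.
exists (psi m) => //.
apply: (@le_lt_trans _ _ (e / 2)%:E); last by rewrite lte_fin ltr_pdivrMr// ltr_pMr// ltr1n.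
rewrite H1_norm_sq.
have -> : (e / 2)%:E = (((e / 2) ^+ 2)%:E `^ 2^-1)%E.
  rewrite poweR_EFin -powR_mulrn ?divr_ge0 ?(ltW e0)// -powRrM mulfV//.
  by rewrite powRr1// divr_ge0// ltW.
apply: gt0_ler_poweR => //.
- rewrite in_itv/= leey andbT adde_ge0//.
    by apply: integral_ge0 => x _; rewrite lee_fin sqr_ge0.
  by apply: sume_ge0 => i _; apply: integral_ge0 => x _; rewrite lee_fin sqr_ge0.
- by rewrite in_itv/= leey andbT lee_fin sqr_ge0.
apply: (@le_trans _ _ (de%:E + \sum_(i < n) de%:E)%E).
  by apply: leeD => //; apply: lee_sum => i _; exact: m1.
rewrite sumEFin sumr_const card_ord -EFinD lee_fin -mulrS -(mulr_natr de).
by rewrite /de divfK// pnatr_eq0.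
Unshelve. all: by end_near. Qed.

Lemma dirichlet_form_test_sine k psi : test_function Om psi ->
  dirichlet_form Om (sob psi) (sob (sine k)) =
  sine_eigenvalue k * L2_inner Om psi (sine k).
Proof.
move=> tpsi; rewrite /dirichlet_form mulr_suml; apply: eq_bigr => i _ /=.
have [cp dp] := smooth_partial i (@sine_smooth k).
have sp : smooth (partial i (sine k)).
  by move=> s; have := @sine_smooth k (rcons s i); rewrite foldr_rcons.
have [cp2 dp2] := smooth_partial i sp.
rewrite L2_innerC (integration_by_parts tpsi cp cp2 dp2) partial2_sine.
rewrite L2_innerC /L2_inner -RintegralZl//; last first.
  apply: LpOn2_mul_integrable; last exact: sine_LpOn2.
  by apply: continuous_LpOn2; apply: smooth_continuous; case: tpsi.
rewrite -mulN1r -RintegralZl//; last first.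
  apply: LpOn2_mul_integrable.
    by apply: continuous_LpOn2; apply: smooth_continuous; case: tpsi.
  rewrite -partial2_sine; exact: continuous_LpOn2.
by apply: eq_Rintegral => x _; ring.
Qed.

(** Both sides are continuous in [F] for the H^1 norm, and they agree on test functions by
    integration by parts. *)
Lemma H10_sine k F : H10 Om F ->
  dirichlet_form Om F (sob (sine k)) = sine_eigenvalue k * L2_inner Om F.1 (sine k).
Proof.
move=> [[lF HF] aF].
have cp i : continuous (partial i (sine k)).
  by have [] := smooth_partial i (@sine_smooth k).
have /choice[B hB] := fun i => continuousT_cube_bounded (cp i).
pose C := \sum_i `|B i| + `|sine_eigenvalue k|.
apply/eqP; rewrite -subr_eq0 -normr_le0.
suff H (e : R) : 0 < e -> `|dirichlet_form Om F (sob (sine k)) -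
    sine_eigenvalue k * L2_inner Om F.1 (sine k)| <= C * e.
  have C0 : 0 <= C by rewrite addr_ge0// sumr_ge0.
  apply/ler_addgt0Pr => e e0; rewrite add0r.
  have C1 : 0 < C + 1 by rewrite ltr_wpDl.
  apply: le_trans (H (e / (C + 1)) _) _; first by rewrite divr_gt0.
  rewrite mulrA ler_pdivrMr// mulrC ler_pM2l//.
  by rewrite lerDl.
move=> e0; have [psi tpsi hpsi] := aF e e0.
have [spsi _ _] := tpsi.
have lpsi : LpOn Om 2%:E psi by apply: continuous_LpOn2; exact: smooth_continuous.
have ldpsi i : LpOn Om 2%:E (partial i psi).
  by apply: continuous_LpOn2; have [] := smooth_partial i spsi.
have [h1 h2] := LpNorm_le_H1_norm (ltW e0) (ltW hpsi).
have E1 : dirichlet_form Om F (sob (sine k)) - sine_eigenvalue k * L2_inner Om F.1 (sine k) =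
  \sum_i L2_inner Om (F.2 i - partial i psi) (partial i (sine k)) -
    sine_eigenvalue k * L2_inner Om (F.1 - psi) (sine k).
  rewrite (L2_innerB lF lpsi (sine_LpOn2 k)) mulrBr.
  under eq_bigr => i _.
    rewrite L2_innerB//; [|by have [] := HF i|exact: continuous_LpOn2].
    over.
  rewrite sumrB -/(dirichlet_form Om (sob psi) (sob (sine k))).
  rewrite (dirichlet_form_test_sine k tpsi) /dirichlet_form /=.
  by ring.
rewrite E1; apply: le_trans (ler_normB _ _) _; rewrite mulrDl; apply: lerD.
  apply: le_trans (ler_norm_sum _ _ _) _; rewrite mulr_suml; apply: ler_sum => i _.
  apply: L2_inner_le => //.
  - by apply: LpOn2B => //; have [] := HF i.
  - exact: continuous_LpOn2.
  - exact: h2.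
  - by move=> x xO; apply: le_trans (hB i x xO) (ler_norm _).
rewrite normrM ler_wpM2l//.
rewrite -[leRHS]mul1r; apply: L2_inner_le => //.
- exact: LpOn2B.
- exact: sine_LpOn2.
- by move=> x _; exact: normr_sine_le1.
Qed.

(** Testing the equation of [phi] with the sine, and [H10_sine] with [phi], multiplies the same
    inner product by two different numbers. *)
Lemma eigenfunction_sine_orthogonal lambda phi k :
  dirichlet_eigenfunction Om lambda phi -> lambda != sine_eigenvalue k ->
  L2_inner Om phi (sine k) = 0.
Proof.
move=> [_ _ [G [HG eig]]] lk.
have := eig _ (sine_H10 k); rewrite (H10_sine k HG) /= => /eqP.
rewrite -subr_eq0 -mulrBl mulf_eq0 subr_eq0 => /orP[/eqP h|/eqP //].
by rewrite h eqxx in lk.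
Qed.

End SineEigen.

(** * Interpolation by sine polynomials *)

Section Lagrange.
Variable F : fieldType.

Lemma lagrange_interpolation N (y : 'I_N -> F) (p : {poly F}) (c : F) :
  injective y -> (size p <= N)%N ->
  p.[c] = \sum_j p.[y j] * \prod_(l | l != j) ((c - y l) / (y j - y l)).
Proof.
move=> yI pN.
pose L j := \prod_(l | l != j) ((y j - y l)^-1 *: ('X - (y l)%:P)).
have LE j x : (L j).[x] = \prod_(l | l != j) ((x - y l) / (y j - y l)).
  by rewrite horner_prod; apply: eq_bigr => l _; rewrite !hornerE mulrC.
have LN j : (size (L j) <= N)%N.
  apply: leq_trans (size_prod_leq _ _) _.
  have cj : (#|[pred l : 'I_N | l != j]|.+1 = N)%N.
    have := cardC1 j; rewrite card_ord => cE.
    by rewrite (eq_card (B := predC1 j))// cE prednK// (leq_ltn_trans _ (ltn_ord j)).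
  rewrite leq_subLR -[X in (_ < X + _)%N]/(#|[pred l : 'I_N | l != j]|).
  apply: (@leq_ltn_trans (\sum_(l < N | l != j) 2)); last first.
    by rewrite sum_nat_const muln2 -addnn ltn_add2l cj.
  apply: leq_sum => l _; apply: leq_trans (size_scale_leq _ _) _.
  by rewrite size_XsubC.
pose q := p - \sum_j p.[y j] *: L j.
have qy i : q.[y i] = 0.
  rewrite /q hornerE hornerN horner_sum (bigD1 i)//= hornerZ LE big1 ?mulr1; last first.
    by move=> l li; rewrite divff// subr_eq0 (inj_eq yI) eq_sym.
  rewrite big1 ?addr0 ?subrr// => j ji; rewrite hornerZ LE.
  by rewrite (bigD1 i) 1?eq_sym//= subrr mul0r mul0r mulr0.
have qN : (size q <= N)%N.
  apply: leq_trans (size_polyD _ _) _; rewrite geq_max pN size_polyN.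
  apply: leq_trans (size_sum _ _ _) _; apply/bigmax_leqP => j _.
  exact: leq_trans (size_scale_leq _ _) (LN j).
have q0 : q = 0.
  apply/eqP/negPn/negP => qn0.
  have := @max_poly_roots _ q [seq y i | i : 'I_N] qn0.
  rewrite map_inj_uniq// enum_uniq size_map size_enum_ord ltnNge qN => h.
  suff : false by []. apply: h => //.
  by apply/allP => _ /mapP[i _ ->]; rewrite /root qy.
have : q.[c] = 0 by rewrite q0 horner0.
rewrite /q hornerD hornerN => /eqP; rewrite subr_eq0 => /eqP ->.
by rewrite horner_sum; apply: eq_bigr => j _; rewrite hornerZ LE.
Qed.

End Lagrange.

Section SineBasis.
Variable R : realType.
Local Notation leb := (@lebesgue_measure R).

(** These are the Chebyshev polynomials of the second kind.  The recursion
    sin ((k + 2) t) = 2 cos t sin ((k + 1) t) - sin (k t) involves two previous terms, so two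
    consecutive polynomials are carried along the induction. *)
Lemma sin_mul_poly k : exists2 U : {poly R}, (size U <= k.+1)%N &
  forall t : R, sin (k.+1%:R * t) = sin t * U.[cos t].
Proof.
suff [U [V [U1 V1 UE VE]]] : exists U V : {poly R}, [/\ (size U <= k)%N,
    (size V <= k.+1)%N, forall t : R, sin (k%:R * t) = sin t * U.[cos t] &
    forall t : R, sin (k.+1%:R * t) = sin t * V.[cos t]] by exists V.
elim: k => [|k [U [V [U1 V1 UE VE]]]].
  exists 0, 1; split; rewrite ?size_poly0 ?size_poly1// => t.
    by rewrite mul0r sin0 horner0 mulr0.
  by rewrite mul1r hornerC mulr1.
exists V, ('X * V *+ 2 - U); split => //.
  apply: leq_trans (size_polyD _ _) _; rewrite size_polyN geq_max.
  have U2 : (size U <= k.+2)%N by apply: leq_trans U1 _; rewrite ltnW.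
  rewrite U2 andbT -scaler_nat; apply: leq_trans (size_scale_leq _ _) _.
  apply: leq_trans (size_polyMleq _ _) _; rewrite size_polyX.
  exact: V1.
move=> t; rewrite hornerD hornerN hornerMn hornerM hornerX mulrBr -UE.
have -> : sin t * (cos t * V.[cos t] *+ 2) = 2 * cos t * (sin t * V.[cos t]) by ring.
rewrite -VE.
have -> : k.+2%:R * t = k.+1%:R * t + t by rewrite -[k.+2%:R]natr1; ring.
have -> : k%:R * t = k.+1%:R * t - t by rewrite -[k.+1%:R]natr1; ring.
by rewrite sinD sinB; ring.
Qed.

Lemma continuous_cos_scale (a : R) : continuous (fun y : R => cos (a * y)).
Proof.
move=> y; apply: (continuous_comp (f := fun y : R => a * y)); last exact: continuous_cos.
by apply: cvgM; [exact: cvg_cst|exact: cvg_id].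
Qed.

Lemma continuous_sin_scale (a : R) : continuous (fun y : R => sin (a * y)).
Proof.
move=> y; apply: (continuous_comp (f := fun y : R => a * y)); last exact: continuous_sin.
by apply: cvgM; [exact: cvg_cst|exact: cvg_id].
Qed.

Lemma integral_cos_natpi j : \int[leb]_(y in `]0, 1[) cos (j%:R * pi * y) = (j == 0)%N%:R.
Proof.
case: j => [|j].
  under eq_Rintegral do rewrite !mul0r cos0.
  rewrite Rintegral_cst// [X in fine X](lebesgue_measure_itv `]0, 1[)/= lte_fin ltr01.
  by rewrite oppr0 adde0 mul1r.
set a := _%:R * pi.
have a0 : a != 0 by rewrite mulf_neq0 ?pnatr_eq0// gt_eqF// pi_gt0.
transitivity (a^-1 * sin (a * 1) - a^-1 * sin (a * 0)); last first.
  by rewrite mulr1 mulr0 sin0 sin_natpi mulr0 subrr.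
apply: (@FTC_open01 _ (fun y => a^-1 * sin (a * y)) (fun y => cos (a * y))).
  exact: continuous_cos_scale.
move=> y; have := is_derive1M (is_derive_cst (a^-1) y 1) (sin_scale_is_derive a y).
by rewrite mulr0 addr0 mulrA mulVf// mul1r.
Qed.

Lemma integral_sin_sin k l :
  \int[leb]_(y in `]0, 1[) (2 * (sin (k.+1%:R * pi * y) * sin (l.+1%:R * pi * y)))
  = (k == l)%:R.
Proof.
wlog kl : k l / (l <= k)%N.
  move=> H; have [/H//|/ltnW/H] := leqP l k.
  rewrite eq_sym => <-; apply: eq_Rintegral => y _; congr (2 * _).
  by rewrite mulrC.
transitivity (\int[leb]_(y in `]0, 1[)
    (cos ((k - l)%N%:R * pi * y) - cos ((k.+1 + l.+1)%N%:R * pi * y))).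
  apply: eq_Rintegral => y _; rewrite natrB// natrD -!natr1.
  set a := k%:R; set b := l%:R.
  have -> : (a - b) * pi * y = (a + 1) * pi * y - (b + 1) * pi * y by ring.
  have -> : (a + 1 + (b + 1)) * pi * y = (a + 1) * pi * y + (b + 1) * pi * y by ring.
  by rewrite cosB cosD; ring.
rewrite RintegralB//; last 2 first.
- exact/continuous_integrable_itv/continuous_cos_scale.
- exact/continuous_integrable_itv/continuous_cos_scale.
rewrite !integral_cos_natpi addSn subr0.
by rewrite subn_eq0 [in RHS]eqn_leq kl andbT.
Qed.

(** The weights read off the coefficients of a sine polynomial from its samples: divided by
    sin (pi t), it is a polynomial of degree less than N in cos (pi t), hence equal to its
    Lagrange interpolant, and integration against 2 sin ((k + 1) pi t) isolates one coefficient.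
    The separation [g] of the nodes bounds the N - 1 factors of the interpolation basis. *)
Lemma sampling_weights N (x : 'I_N -> R) (s g : R) :
  0 < s -> 0 < g -> (forall j, s <= sin (pi * x j)) ->
  (forall j l, j != l -> g <= `|cos (pi * x j) - cos (pi * x l)|) ->
  exists w : 'I_N -> 'I_N -> R,
    (forall k l : 'I_N, \sum_j w k j * sin (l.+1%:R * pi * x j) = (k == l)%:R) /\
    forall k j, `|w k j| <= 2 / s * (2 / g) ^+ N.-1.
Proof.
move=> s0 g0 sx gx.
pose y j := cos (pi * x j).
have yI : injective y.
  move=> j l jl; apply/eqP/negPn/negP => /gx; rewrite -/(y j) -/(y l) jl subrr normr0.
  by rewrite leNgt g0.
pose L j (t : R) := \prod_(l | l != j) ((cos (pi * t) - y l) / (y j - y l)).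
have cL j : continuous (L j).
  apply: continuous_bigprod => l t; apply: cvgM; last exact: cvg_cst.
  by apply: cvgB; [exact: continuous_cos_scale|exact: cvg_cst].
pose h (k j : 'I_N) (t : R) := 2 * (sin (k.+1%:R * pi * t) * (sin (pi * t) * L j t)).
have ch k j : continuous (h k j).
  move=> t; apply: cvgM; first exact: cvg_cst.
  apply: cvgM; first exact: continuous_sin_scale.
  by apply: cvgM; [exact: continuous_sin_scale|exact: cL].
have ih k j := continuous_integrable_itv (ch k j).
have sx0 j : 0 < sin (pi * x j) by exact: lt_le_trans (sx j).
exists (fun k j => (sin (pi * x j))^-1 * \int[leb]_(t in `]0, 1[) h k j t).
split=> [k l|k j].
  have [U UN UE] := sin_mul_poly l.
  have UN' : (size U <= N)%N by exact: leq_trans UN (ltn_ord l).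
  transitivity (\sum_j U.[y j] * \int[leb]_(t in `]0, 1[) h k j t).
    apply: eq_bigr => j _; rewrite -[_ * pi * _]mulrA UE -/(y j).
    by field; rewrite gt_eqF.
  rewrite -(integral_sin_sin k l).
  transitivity (\int[leb]_(t in `]0, 1[) \sum_j U.[y j] * h k j t); last first.
    apply: eq_Rintegral => t _; rewrite -[l.+1%:R * pi * t]mulrA UE.
    rewrite (lagrange_interpolation _ yI UN') mulr_sumr mulr_sumr mulr_sumr.
    by apply: eq_bigr => j _; rewrite /h /L; ring.
  have iU j : leb.-integrable `]0, 1[ (EFin \o (fun t => U.[y j] * h k j t)).
    exact: integrable_EFinZ (ih k j).
  have mI : measurable (`]0, 1[%classic : set (measurableTypeR R)) by exact: measurable_itv.
  have [_ ->] := Rintegral_bigsum (index_enum 'I_N) mI iU.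
  by apply: eq_bigr => j _; rewrite (RintegralZl _ mI (ih k j)).
have hB t : `|h k j t| <= 2 * (2 / g) ^+ N.-1.
  rewrite /h normrM ger0_norm// ler_pM2l//.
  rewrite !normrM -[leRHS]mul1r; apply: ler_pM => //.
  - by rewrite ler_norml sin_geN1 sin_le1.
  rewrite -[leRHS]mul1r; apply: ler_pM => //.
  - by rewrite ler_norml sin_geN1 sin_le1.
  rewrite normr_prod; apply: (@le_trans _ _ (\prod_(l < N | l != j) (2 / g))).
    apply: ler_prod => l lj; rewrite normr_ge0 normrM normfV /=.
    apply: ler_pM => //.
      apply: le_trans (ler_normB _ _) _.
      by apply: (@lerD _ _ 1 _ 1); rewrite ler_norml cos_geN1 cos_le1.
    by rewrite lef_pV2 ?posrE//; [apply: gx; rewrite eq_sym|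
      apply: lt_le_trans g0 _; apply: gx; rewrite eq_sym].
  rewrite prodr_const (eq_card (B := predC1 j))// cardC1 card_ord//.
rewrite normrM mulrAC; apply: le_trans (_ : s^-1 * (2 * (2 / g) ^+ N.-1) <= _); last first.
  by rewrite le_eqVlt; apply/orP; left; apply/eqP; ring.
apply: ler_pM => //.
  by rewrite gtr0_norm ?invr_gt0// lef_pV2 ?posrE.
apply: le_trans (le_normr_Rintegral _ (ih k j)) _ => //.
apply: (@le_trans _ _ (\int[leb]_(t in `]0, 1[) (2 * (2 / g) ^+ N.-1))).
  apply: le_Rintegral => //.
    by apply: (integrable_norm (ih k j)).
  exact/continuous_integrable_itv/cst_continuous.
rewrite Rintegral_cst// [X in fine X](lebesgue_measure_itv `]0, 1[)/= lte_fin ltr01.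
by rewrite oppr0 adde0 mulr1.
Qed.

End SineBasis.

(** * Sampling points *)

Section SamplingNodes.
Variable R : realType.

Lemma sin_ge_half (z : R) : 0 <= z <= 1 -> z / 2 <= sin z.
Proof.
move=> /andP[z0 z1].
have cs : {within `[0, z], continuous (@sin R)}.
  by apply: continuous_subspaceT => y; exact: continuous_sin.
have [c] := @MVT_segment _ (@sin R) cos 0 z z0 (fun y _ => is_derive_sin y) cs.
rewrite in_itv/= => /andP[c0 cz]; rewrite sin0 !subr0 => ->.
rewrite mulrC ler_wpM2r//.
have -> : c = c / 2 + c / 2 by rewrite -splitr.
rewrite cosD -!expr2.
have s1 : `|sin (c / 2)| <= 2^-1.
  apply: le_trans (normr_sin_le _) _; rewrite ger0_norm ?divr_ge0//.
  by rewrite ler_pdivrMr// mulVf// (le_trans cz).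
have := cos2Dsin2 (c / 2); have : sin (c / 2) ^+ 2 <= 2^-1 ^+ 2.
  by rewrite -[sin _ ^+ 2]real_normK ?num_real// lerXn2r ?nnegrE ?invr_ge0.
set s := sin _ ^+ 2; set d := cos _ ^+ 2; lra.
Qed.

(** The ratio of the two powers is exp (- alpha ln (1 + 1/i)), where
    ln (1 + 1/i) >= 1/(i + 1). *)
Lemma powRN_gap (alpha : R) (i : nat) : 0 < alpha -> (0 < i)%N ->
  i%:R `^ (- alpha) * (alpha / (i.+1%:R + alpha)) <=
  i%:R `^ (- alpha) - i.+1%:R `^ (- alpha).
Proof.
move=> a0 i0.
have iR : 0 < i%:R :> R by rewrite ltr0n.
have iR' : 0 < i.+1%:R :> R by [].
have e1 : i.+1%:R = i%:R * (i.+1%:R / i%:R) :> R by field; rewrite gt_eqF.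
have r0 : 0 < i.+1%:R / i%:R :> R by rewrite divr_gt0.
rewrite [X in _ - X `^ _]e1 powRM ?(ltW iR) ?(ltW r0)// -[X in X - _]mulr1 -mulrBr.
apply: ler_wpM2l; first exact: powR_ge0.
have lnr : i.+1%:R^-1 <= ln (i.+1%:R / i%:R) :> R.
  rewrite -[i.+1%:R / i%:R]invrK lnV ?posrE ?invr_gt0// lerNr invf_div.
  have -> : i%:R / i.+1%:R = 1 + - i.+1%:R^-1 :> R.
    by rewrite -natr1; field; rewrite natr1 gt_eqF.
  apply: le_ln1Dx; rewrite ltrN2 invf_lt1// ltr1n ltnS//.
rewrite {1}/powR gt_eqF// mulNr expRN.
set L := ln _ in lnr *.
have h : 1 + alpha / i.+1%:R <= expR (alpha * L).
  apply: le_trans (expR_ge1Dx _); rewrite lerD2l ler_pM2l//.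
have h0 : 0 < 1 + alpha / i.+1%:R by rewrite addr_gt0// divr_gt0.
have : (expR (alpha * L))^-1 <= (1 + alpha / i.+1%:R)^-1.
  by rewrite lef_pV2// posrE expR_gt0.
have -> : (1 + alpha / i.+1%:R)^-1 = 1 - alpha / (i.+1%:R + alpha).
  by field; rewrite !gt_eqF// addr_gt0.
lra.
Qed.

(** The nodes are (j + j0)^(-alpha), where j0 is so large that pi x_j <= 1; on [0, 1] one has
    sin z >= z / 2.  A difference of cosines is twice the product of the sines of the half sum
    and of the half difference, and consecutive nodes differ by at least a
    negative power of j ([powRN_gap]).  As
    D N >= 2, constants are absorbed in the exponent. *)
Lemma omega_nodes (alpha : R) : 0 < alpha ->
  exists (x : nat -> R) (D : R) (a : nat), [/\ 2 <= D,
    forall j, omega1 alpha (x j) /\ 0 < x j < 1,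
    forall N j, (j < N)%N -> (D * N%:R) ^- a <= sin (pi * x j) &
    forall N j l, (j < N)%N -> (l < N)%N -> j != l ->
      (D * N%:R) ^- a <= `|cos (pi * x j) - cos (pi * x l)|].
Proof.
move=> al0.
pose j0 := (Num.trunc ((pi : R) `^ alpha^-1)).+1.
have j0pi : pi `^ alpha^-1 <= j0%:R :> R by rewrite ltW// truncnS_gt.
pose b := (Num.trunc alpha).+1.
have bal : alpha <= b%:R by rewrite ltW// truncnS_gt.
pose x j : R := (j + j0)%N%:R `^ (- alpha).
have pos j : (0 < j + j0)%N by rewrite addnS.
have x0 j : 0 < x j by rewrite powR_gt0// ltr0n.
have pix j : pi * x j <= 1.
  rewrite /x powRN ler_pdivrMr ?powR_gt0 ?ltr0n// mul1r.
  have -> : pi = (pi `^ alpha^-1) `^ alpha :> R.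
    by rewrite -powRrM mulVf ?gt_eqF// powRr1// pi_ge0.
  apply: ge0_ler_powR; rewrite ?nnegrE ?powR_ge0 ?(ltW al0)//.
  by apply: le_trans j0pi _; rewrite ler_nat leq_addl.
have pi2 := pi_ge2 R.
have x1 j : x j <= 2^-1.
  have := pix j; have := x0 j; nra.
have xM M j : (j + j0 <= M)%N -> M%:R ^- b <= x j.
  move=> jM; have M0 : (0 < M)%N by exact: leq_trans jM.
  rewrite /x powRN lef_pV2 ?posrE ?exprn_gt0 ?powR_gt0 ?ltr0n//.
  apply: (@le_trans _ _ (M%:R `^ alpha)).
    by apply: ge0_ler_powR; rewrite ?nnegrE ?ler0n ?(ltW al0)// ler_nat.
  by rewrite -powR_mulrn// ler_powR// ler1n.
have xgt j l : (j < l)%N -> x l <= x j.+1.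
  move=> jl; rewrite /x !powRN lef_pV2 ?posrE ?powR_gt0 ?ltr0n//.
  apply: ge0_ler_powR; rewrite ?nnegrE ?ler0n ?(ltW al0)// ler_nat.
  by rewrite leq_add2r.
pose c := alpha / (1 + alpha).
have c0 : 0 < c by rewrite divr_gt0// addr_gt0.
pose D : R := j0.+1%:R + 2 / c.
have D2 : 2 <= D by rewrite /D ler_wpDr ?ler_nat// divr_ge0// ltW.
have DM N : (0 < N)%N -> (N + j0)%N%:R <= D * N%:R :> R.
  move=> N0; apply: (@le_trans _ _ (j0.+1%:R * N%:R)).
    by rewrite -natrM ler_nat mulSn leq_add2l leq_pmulr.
  by rewrite ler_wpM2r// /D lerDl divr_ge0// ltW.
have Q1 N : (0 < N)%N -> 1 <= D * N%:R :> R.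
  by move=> N0; apply: le_trans (DM N N0); rewrite ler1n addn_gt0 N0.
exists x, D, (b + b.+1).+1; split => //.
- move=> j; split; last by rewrite x0 (le_lt_trans (x1 j))// invf_lt1// ltr1n.
  by exists (j + j0)%N; [exact: pos|].
- move=> N j jN; have N0 : (0 < N)%N by exact: leq_ltn_trans jN.
  apply: (@le_trans _ _ (x j)).
    apply: le_trans (xM (N + j0)%N j _); last by rewrite leq_add2r ltnW.
    have MN0 : 0 < (N + j0)%N%:R :> R by rewrite ltr0n addn_gt0 N0.
    rewrite lef_pV2 ?posrE ?exprn_gt0//; last exact: lt_le_trans (DM N N0).
    apply: (@le_trans _ _ ((D * N%:R) ^+ b)).
      by rewrite lerXn2r ?nnegrE ?(ltW MN0)// ?DM// (le_trans _ (Q1 N N0)).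
    by apply: (ler_weXn2l (Q1 N N0)); rewrite -addnS leq_addr.
  apply: le_trans (sin_ge_half _); last by rewrite pix mulr_ge0 ?pi_ge0 ?ltW.
  by have := x0 j; nra.
- move=> N j l; wlog jl : j l / (j < l)%N.
    move=> H jN lN; rewrite neq_ltn => /orP[jl|lj].
      by apply: H => //; rewrite neq_ltn jl.
    by rewrite distrC; apply: H => //; rewrite neq_ltn lj.
  move=> jN lN _; have N0 : (0 < N)%N by exact: leq_ltn_trans jN.
  have MN0 : 0 < (N + j0)%N%:R :> R by rewrite ltr0n addn_gt0 N0.
  have -> : cos (pi * x j) - cos (pi * x l) =
     - 2 * (sin (pi * (x j + x l) / 2) * sin (pi * (x j - x l) / 2)).
    have -> : pi * x j = pi * (x j + x l) / 2 + pi * (x j - x l) / 2 by field.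
    have -> : pi * x l = pi * (x j + x l) / 2 - pi * (x j - x l) / 2 by field.
    by rewrite cosD cosB; ring.
  have xl : x l < x j.
    apply: le_lt_trans (xgt _ _ jl) _.
    rewrite /x !powRN ltf_pV2 ?posrE ?powR_gt0 ?ltr0n//.
    by apply: gt0_ltr_powR => //; rewrite ?nnegrE ?ler0n// ltr_nat addSn.
  have [pj pl] := (pix j, pix l); have [xj0 xl0] := (x0 j, x0 l).
  have s1 : pi * (x j + x l) / 2 / 2 <= sin (pi * (x j + x l) / 2).
    by apply: sin_ge_half; apply/andP; split; nra.
  have s2 : pi * (x j - x l) / 2 / 2 <= sin (pi * (x j - x l) / 2).
    by apply: sin_ge_half; apply/andP; split; nra.
  have h1 : x j / 2 <= sin (pi * (x j + x l) / 2).
    by apply: le_trans s1; nra.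
  have h2 : (x j - x l) / 2 <= sin (pi * (x j - x l) / 2).
    by apply: le_trans s2; nra.
  have g1 : x j * (alpha / ((j + j0).+1%:R + alpha)) <= x j - x l.
    apply: (le_trans (powRN_gap al0 (pos j))).
    by rewrite lerB// -addSn; exact: xgt.
  have M1 : 1 <= (N + j0)%N%:R :> R by rewrite ler1n addn_gt0 N0.
  have g2 : c / (N + j0)%N%:R <= alpha / ((j + j0).+1%:R + alpha).
    have jM : (j + j0).+1%:R <= (N + j0)%N%:R :> R.
      by rewrite ler_nat -addSn leq_add2r.
    rewrite /c -mulrA -invfM ler_pM2l// lef_pV2 ?posrE ?mulr_gt0 ?addr_gt0//.
    rewrite mulrDl mul1r lerD// ler_peMr// ltW//.
  have xjM := xM (N + j0)%N j (leq_add (ltnW jN) (leqnn _)).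
  rewrite mulNr normrN ger0_norm; last first.
    by rewrite mulr_ge0// mulr_ge0//; [apply: le_trans h1|apply: le_trans h2];
      rewrite divr_ge0// ?subr_ge0 ltW.
  set M := (N + j0)%N%:R in g2 xjM MN0 M1 *.
  have Mb : 0 < M ^- b by rewrite invr_gt0 exprn_gt0.
  have cM : 0 < c / M by rewrite divr_gt0.
  have g3 : M ^- b * (c / M) <= x j - x l.
    by apply: le_trans g1; apply: ler_pM => //; exact: ltW.
  apply: (@le_trans _ _ (2 * (M ^- b / 2 * (M ^- b * (c / M) / 2)))); last first.
    rewrite ler_pM2l//; apply: ler_pM.
    - by rewrite divr_ge0// ltW.
    - by rewrite divr_ge0// ltW// mulr_gt0.
    - by apply: le_trans h1; rewrite ler_pM2r.
    - by apply: le_trans h2; rewrite ler_pM2r.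
  have -> : 2 * (M ^- b / 2 * (M ^- b * (c / M) / 2)) = (2 / c * M ^+ (b + b.+1))^-1.
    have E (m p d : R) : 0 < m -> 0 < p -> 0 < d ->
        2 * (p^-1 / 2 * (p^-1 * (d / m) / 2)) = (2 / d * (p * (m * p)))^-1.
      by move=> m0 p0 d0; field; rewrite !gt_eqF.
    by rewrite exprD exprS E// exprn_gt0.
  have Q0 : 0 < D * N%:R by exact: lt_le_trans (DM N N0).
  rewrite lef_pV2; first last.
  - by rewrite posrE; apply: mulr_gt0; [exact: divr_gt0|exact: exprn_gt0].
  - by rewrite posrE; exact: exprn_gt0.
  rewrite exprS; apply: ler_pM.
  - by rewrite divr_ge0// ltW.
  - by rewrite exprn_ge0// ltW.
  - apply: (@le_trans _ _ D); first by rewrite /D lerDr.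
    by rewrite ler_peMr ?ler1n// (le_trans _ D2).
  - by rewrite lerXn2r ?nnegrE ?(ltW MN0) ?(ltW Q0)// DM.
Qed.

End SamplingNodes.

(** * Spectral inequality for sine polynomials *)

Section SinePolynomials.
Variable R : realType.

Lemma ln_le_powR (y s : R) : 0 < s -> 1 <= y -> ln y <= y `^ s / s.
Proof.
move=> s0 y1; rewrite ler_pdivlMr// mulrC -ln_powR.
have p0 : 0 < y `^ s by rewrite powR_gt0// (lt_le_trans _ y1).
have := @le_ln1Dx R (y `^ s - 1); rewrite addrCA subrr addr0 => h.
by apply: le_trans (h _) _; lra.
Qed.

(** The products over the coordinates of the weights of [sampling_weights] are dual to the
    products of sines, which gives each coefficient as a combination of values at the grid of
    nodes.  The l^1 norm of a product of weights and the number of coefficients are both powers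
    of Q = D0 N with exponent O(N), and N ln Q = O(N^(2 beta)) because 2 beta > 1. *)
Lemma finite_spectral (alpha beta : R) n : 0 < alpha -> 2^-1 < beta ->
  exists2 D : R, 0 < D & forall (N : nat) (c : {ffun 'I_n -> 'I_N} -> R) (B : R),
    (0 < N)%N ->
    (forall x, open_cube R n x -> omega_n alpha n x ->
      `|\sum_k c k * sine (fun i => (k i).+1) x| <= B) ->
    \sum_k `|c k| <= expR (D * N%:R `^ (2 * beta)) * B.
Proof.
move=> al0 be2.
have [x [D0 [a [D2 xo xs xg]]]] := omega_nodes al0.
pose s := 2 * beta - 1.
have s0 : 0 < s by rewrite /s; lra.
have D00 : 0 < D0 by exact: lt_le_trans D2.
exists ((n * (a + 3))%N%:R * (D0 `^ s / s) + 1).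
  by rewrite ltr_wpDl// mulr_ge0// divr_ge0 ?powR_ge0// ltW.
move=> N c B N0 cB.
have NR : 1 <= N%:R :> R by rewrite ler1n.
pose Q := D0 * N%:R.
have Q2 : 2 <= Q by rewrite /Q (le_trans D2)// ler_peMr// ltW.
have NQ : N%:R <= Q by rewrite /Q; nra.
have Q1 : 1 <= Q by lra.
have Q0 : 0 < Q by lra.
have g0 : 0 < Q ^- a by rewrite invr_gt0 exprn_gt0.
have [w [wd wB]] := @sampling_weights R N (fun j => x j) (Q ^- a) (Q ^- a) g0 g0
  (fun j => xs N j (ltn_ord j))
  (fun j l jl => xg N j l (ltn_ord j) (ltn_ord l) jl).
have wQ k : \sum_j `|w k j| <= Q ^+ ((a + 2) * N).
  apply: (@le_trans _ _ (\sum_(j < N) Q ^+ ((a + 1) * N))).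
    apply: ler_sum => j _; apply: le_trans (wB k j) _.
    rewrite invrK -exprS prednK// exprMn -exprM mulnDl mul1n addnC exprD.
    by rewrite ler_pM2r ?exprn_gt0// lerXn2r ?nnegrE// ltW.
  rewrite sumr_const card_ord -mulr_natl.
  have -> : ((a + 2) * N = N + (a + 1) * N)%N by rewrite addn2 addn1 mulSn.
  rewrite exprD ler_pM2r ?exprn_gt0//.
  apply: (@le_trans _ _ Q); first exact: NQ.
  by rewrite -[leLHS]expr1; apply: (ler_weXn2l Q1).
pose X (J : {ffun 'I_n -> 'I_N}) : 'rV[R]_n := \row_i x (J i).
have XB J : `|\sum_k c k * sine (fun i => (k i).+1) (X J)| <= B.
  by apply: cB => i; rewrite mxE; have [] := xo (J i).
have B0 : 0 <= B by exact: le_trans (XB [ffun=> Ordinal N0]).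
have cE k : c k = \sum_(J : {ffun 'I_n -> 'I_N}) (\prod_i w (k i) (J i)) *
    \sum_l c l * sine (fun i => (l i).+1) (X J).
  under eq_bigr do rewrite mulr_sumr.
  rewrite exchange_big/= (bigD1 k)//= [X in _ = _ + X]big1 => [|l lk].
    rewrite addr0; under eq_bigr => J _.
      rewrite mulrCA /sine /tensor -big_split/=.
      under eq_bigr do rewrite /sines mxE.
      over.
    rewrite -mulr_sumr -(bigA_distr_bigA (fun i j => w (k i) j * sin ((k i).+1%:R * pi * x j))).
    by rewrite big1 ?mulr1// => i _; rewrite wd eqxx.
  under eq_bigr => J _.
    rewrite mulrCA /sine /tensor -big_split/=.
    under eq_bigr do rewrite /sines mxE.
    over.
  rewrite -mulr_sumr -(bigA_distr_bigA (fun i j => w (k i) j * sin ((l i).+1%:R * pi * x j))).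
  have [i ki] : exists i, k i != l i.
    apply/existsP; apply: contraNT lk => /existsPn h; apply/eqP/ffunP => i.
    by have /negPn/eqP := h i.
  by rewrite (bigD1 i)//= wd (negPf ki) mul0r mulr0.
have ckB k : `|c k| <= Q ^+ ((a + 2) * N * n) * B.
  rewrite cE; apply: le_trans (ler_norm_sum _ _ _) _.
  apply: (@le_trans _ _ (\sum_(J : {ffun 'I_n -> 'I_N}) (\prod_i `|w (k i) (J i)|) * B)).
    apply: ler_sum => J _; rewrite normrM normr_prod.
    by apply: ler_wpM2l => //; exact: prodr_ge0.
  rewrite -mulr_suml -(bigA_distr_bigA (fun i j => `|w (k i) j|)).
  apply: ler_wpM2r => //.
  rewrite exprM -[X in _ ^+ X]card_ord -prodr_const.
  by apply: ler_prod => i _; rewrite wQ sumr_ge0.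
apply: (@le_trans _ _ (Q ^+ ((a + 3) * N * n) * B)).
  apply: (@le_trans _ _ (\sum_(k : {ffun 'I_n -> 'I_N}) Q ^+ ((a + 2) * N * n) * B)).
    by apply: ler_sum => k _; exact: ckB.
  rewrite sumr_const card_ffun !card_ord -mulr_natl mulrA.
  apply: ler_wpM2r => //.
  have -> : ((a + 3) * N * n = N * n + (a + 2) * N * n)%N.
    by rewrite addn3 addn2 mulSn mulnDl.
  rewrite exprD ler_pM2r ?exprn_gt0// natrX exprM.
  apply: lerXn2r; rewrite ?nnegrE ?exprn_ge0 ?(ltW Q0)//.
  apply: (@le_trans _ _ Q); first exact: NQ.
  by rewrite -[leLHS]expr1; apply: (ler_weXn2l Q1).
apply: ler_wpM2r => //.
rewrite -[X in X ^+ _ <= _](lnK Q0) -expRM_natl ler_expR.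
have lnQ := ln_le_powR s0 Q1.
apply: (@le_trans _ _ (((a + 3) * N * n)%N%:R * (Q `^ s / s))).
  by rewrite ler_wpM2l.
have -> : N%:R `^ (2 * beta) = N%:R * N%:R `^ s :> R.
  have -> : 2 * beta = 1 + s by rewrite /s; ring.
  by rewrite powRD ?powRr1//; apply/implyP => _; rewrite gt_eqF// (lt_le_trans _ NR).
rewrite /Q powRM ?(ltW D00)//.
have -> : ((a + 3) * N * n)%N%:R = (n * (a + 3))%N%:R * N%:R :> R.
  by rewrite -natrM mulnC mulnA.
rewrite mulrDl mul1r; set u := N%:R; set v := u `^ s; set d := D0 `^ s.
have : 0 <= u * v by rewrite mulr_ge0// powR_ge0.
have -> : (n * (a + 3))%N%:R * u * (d * v / s) = (n * (a + 3))%N%:R * (d / s) * (u * v) by ring.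
lra.
Qed.

End SinePolynomials.

(** * Fejer kernels *)

Section Fejer.
Variable R : realType.
Local Notation leb := (@lebesgue_measure R).

(** The denominator M + 1 keeps the weights of all the M frequencies positive. *)
Definition fejer_coef M j : R := 1 - j.+1%:R / M.+1%:R.

Definition fejer M (w : R) : R :=
  1 + 2 * \sum_(j < M) fejer_coef M j * cos (j.+1%:R * w).

Lemma dirichlet_kernel M (w : R) :
  (1 + 2 * \sum_(j < M) cos (j.+1%:R * w)) * (1 - cos w) =
  cos (M%:R * w) - cos (M.+1%:R * w).
Proof.
elim: M => [|M IH]; first by rewrite big_ord0 mul0r cos0 mul1r; ring.
rewrite big_ord_recr /=.
set S := \sum_(j < M) _ in IH *.
have -> : (1 + 2 * (S + cos (M.+1%:R * w))) * (1 - cos w) =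
  (1 + 2 * S) * (1 - cos w) + 2 * cos (M.+1%:R * w) * (1 - cos w) by ring.
rewrite IH.
have -> : M%:R * w = M.+1%:R * w - w by rewrite -[M.+1%:R]natr1; ring.
have -> : M.+2%:R * w = M.+1%:R * w + w by rewrite -[M.+2%:R]natr1; ring.
by rewrite cosB cosD; ring.
Qed.

Lemma fejerE M w : M.+1%:R * fejer M w =
  M.+1%:R + 2 * \sum_(j < M) (M%:R - j%:R) * cos (j.+1%:R * w).
Proof.
rewrite /fejer mulrDr mulr1; congr (_ + _); rewrite mulrCA; congr (_ * _).
rewrite mulr_sumr; apply: eq_bigr => j _; rewrite mulrA; congr (_ * _).
rewrite /fejer_coef mulrBr mulr1 mulrCA mulfV ?pnatr_eq0// mulr1.
by rewrite -!natr1; ring.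
Qed.

(** As 1 - cos w = 2 sin^2 (w / 2), this is the closed form of the Fejer kernel, multiplied out
    so as to hold also where 1 - cos w vanishes. *)
Lemma fejer_kernel M w : M.+1%:R * fejer M w * (1 - cos w) = 1 - cos (M.+1%:R * w).
Proof.
rewrite fejerE; elim: M => [|M IH]; first by rewrite big_ord0 !mul1r; ring.
transitivity ((M.+1%:R + 2 * \sum_(j < M) (M%:R - j%:R) * cos (j.+1%:R * w)) * (1 - cos w)
   + (1 + 2 * \sum_(j < M.+1) cos (j.+1%:R * w)) * (1 - cos w)); last first.
  by rewrite IH dirichlet_kernel; ring.
rewrite -mulrDl; congr (_ * _).
rewrite [\sum_(j < M.+1) cos _]big_ord_recr [X in _ + 2 * X = _]big_ord_recr /=.
have -> : \sum_(j < M) (M.+1%:R - j%:R) * cos (j.+1%:R * w) =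
    \sum_(j < M) (M%:R - j%:R) * cos (j.+1%:R * w) + \sum_(j < M) cos (j.+1%:R * w).
  by rewrite -big_split; apply: eq_bigr => j _ /=; rewrite -[M.+1%:R]natr1; ring.
by rewrite -[M.+2%:R]natr1 -[M.+1%:R]natr1; ring.
Qed.

Lemma fejer_ge0 M w : 0 <= fejer M w.
Proof.
have M0 : 0 < M.+1%:R :> R by [].
rewrite -(pmulr_rge0 _ M0).
have [c1|c1] := ltP (cos w) 1.
  rewrite -(pmulr_lge0 _ (x := 1 - cos w)) ?subr_gt0// fejer_kernel.
  by rewrite subr_ge0 cos_le1.
(* At a zero of 1 - cos w all the cosines in the sum equal 1. *)
have cw : cos w = 1 by apply/eqP; rewrite eq_le cos_le1 c1.
have sw : sin w = 0.
  apply/eqP; rewrite -sqrf_eq0; have := cos2Dsin2 w; rewrite cw => h.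
  by apply/eqP; lra.
have cj j : cos (j%:R * w) = 1.
  elim: j => [|j IH]; first by rewrite mul0r cos0.
  have -> : j.+1%:R * w = j%:R * w + w by rewrite -natr1; ring.
  by rewrite cosD cw sw mulr0 subr0 mulr1.
rewrite fejerE addr_ge0// mulr_ge0// sumr_ge0// => j _.
by rewrite cj mulr1 subr_ge0 ler_nat ltnW.
Qed.

Lemma fejer_small M w : fejer M w * (1 - cos w) <= 2 / M.+1%:R.
Proof.
rewrite ler_pdivlMr// mulrC mulrA fejer_kernel.
by have := cos_geN1 (M.+1%:R * w); lra.
Qed.

Lemma continuous_fejer M (a b : R) : continuous (fun y : R => fejer M (a + b * y)).
Proof.
have cS : continuous (fun y : R => \sum_(j < M) fejer_coef M j * cos (j.+1%:R * (a + b * y))).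
  apply: continuous_bigsum => j z; apply: cvgM; first exact: cvg_cst.
  apply: (continuous_comp (f := fun y : R => j.+1%:R * (a + b * y))); last exact: continuous_cos.
  apply: cvgM; first exact: cvg_cst.
  apply: cvgD; first exact: cvg_cst.
  by apply: cvgM; [exact: cvg_cst|exact: cvg_id].
move=> y; apply: cvgD; first exact: cvg_cst.
by apply: cvgM; [exact: cvg_cst|exact: cS].
Qed.

(** The circle is folded onto [0, 1] by y |-> - y.  The kernel of sine sums is [fejer_odd], which
    has no sign; it is [fejer_even] - [fejer_err], where [fejer_even] is a probability density
    in y and [fejer_err], the contribution of the reflected point, is small. *)
Definition fejer_err M (x y : R) : R := fejer M (pi * x + pi * y).
Definition fejer_even M (x y : R) : R :=
  (fejer M (pi * x + - pi * y) + fejer M (pi * x + pi * y)) / 2.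
Definition fejer_odd M (x y : R) : R :=
  (fejer M (pi * x + - pi * y) - fejer M (pi * x + pi * y)) / 2.

Lemma continuous_fejer_err M x : continuous (fejer_err M x).
Proof. exact: continuous_fejer. Qed.

Lemma continuous_fejer_even M x : continuous (fejer_even M x).
Proof.
move=> y; apply: cvgM; last exact: cvg_cst.
by apply: cvgD; exact: continuous_fejer.
Qed.

Lemma continuous_fejer_odd M x : continuous (fejer_odd M x).
Proof.
move=> y; apply: cvgM; last exact: cvg_cst.
by apply: cvgB; exact: continuous_fejer.
Qed.

Lemma fejer_oddE M x y : fejer_odd M x y =
  \sum_(j < M) fejer_coef M j * 2 * (sin (j.+1%:R * pi * x) * sin (j.+1%:R * pi * y)).
Proof.
rewrite /fejer_odd /fejer.
transitivity (\sum_(j < M) fejer_coef M j * cos (j.+1%:R * (pi * x + - pi * y)) -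
   \sum_(j < M) fejer_coef M j * cos (j.+1%:R * (pi * x + pi * y))).
  by set a := \sum_(j < M) _; set b := \sum_(j < M) _; field.
rewrite -sumrB; apply: eq_bigr => j _.
have -> : j.+1%:R * (pi * x + - pi * y) = j.+1%:R * pi * x - j.+1%:R * pi * y by ring.
have -> : j.+1%:R * (pi * x + pi * y) = j.+1%:R * pi * x + j.+1%:R * pi * y by ring.
by rewrite cosB cosD; ring.
Qed.

Lemma fejer_evenE M x y : fejer_even M x y =
  1 + \sum_(j < M) fejer_coef M j * 2 * cos (j.+1%:R * pi * x) * cos (j.+1%:R * pi * y).
Proof.
rewrite /fejer_even /fejer.
transitivity (1 + (\sum_(j < M) fejer_coef M j * cos (j.+1%:R * (pi * x + - pi * y)) +
   \sum_(j < M) fejer_coef M j * cos (j.+1%:R * (pi * x + pi * y)))).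
  by set a := \sum_(j < M) _; set b := \sum_(j < M) _; field.
rewrite -big_split; congr (_ + _); apply: eq_bigr => j _ /=.
have -> : j.+1%:R * (pi * x + - pi * y) = j.+1%:R * pi * x - j.+1%:R * pi * y by ring.
have -> : j.+1%:R * (pi * x + pi * y) = j.+1%:R * pi * x + j.+1%:R * pi * y by ring.
by rewrite cosB cosD; ring.
Qed.

Lemma integral_fejer_even M x : \int[leb]_(y in `]0, 1[) fejer_even M x y = 1.
Proof.
under eq_Rintegral do rewrite fejer_evenE.
have mI : measurable (`]0, 1[%classic : set (measurableTypeR R)) by exact: measurable_itv.
have ic (j : 'I_M) : leb.-integrable `]0, 1[ (EFin \o (fun y : R => cos (j.+1%:R * pi * y))).
  exact/continuous_integrable_itv/continuous_cos_scale.
have iF (j : 'I_M) : leb.-integrable `]0, 1[ (EFin \o (fun y : R =>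
    fejer_coef M j * 2 * cos (j.+1%:R * pi * x) * cos (j.+1%:R * pi * y))).
  exact: integrable_EFinZ (ic j).
have [iS ES] := Rintegral_bigsum (index_enum 'I_M) mI iF.
have i1 := continuous_integrable_itv (@cst_continuous _ _ (1 : R)).
rewrite (RintegralD mI i1 iS) ES big1 => [|j _].
  rewrite addr0 Rintegral_cst// [X in fine X](lebesgue_measure_itv `]0, 1[)/= lte_fin ltr01.
  by rewrite oppr0 adde0 mul1r.
by rewrite (RintegralZl _ mI (ic j)) integral_cos_natpi mulr0.
Qed.

(** For y in ]0, 1[ the angle pi (x + y) keeps away from the multiples of 2 pi, so that
    1 - cos (pi (x + y)) is bounded below and [fejer_small] applies. *)
Lemma fejer_errP (x : R) : 0 < x < 1 -> exists2 C : R, 0 <= C &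
  forall M (y : R), 0 < y < 1 -> [/\ 0 <= fejer_err M x y,
    fejer_err M x y <= C / M.+1%:R, 0 <= fejer_even M x y &
    fejer_even M x y * (1 - cos (pi * (x - y))) <= (1 + C) / M.+1%:R].
Proof.
move=> /andP[x0 x1].
have pi0 := pi_gt0 R.
have cosI (u v : R) : 0 <= v -> v < u -> u <= 1 -> cos (pi * u) < cos (pi * v).
  have mem w : 0 <= w -> w <= 1 -> pi * w \in `[0 : R, pi].
    by move=> w0 w1; rewrite in_itv/= mulr_ge0 ?(ltW pi0)//= ler_piMr ?(ltW pi0).
  by move=> v0 vu u1; rewrite ltr_cos ?ltr_pM2l//; apply: mem; lra.
pose d := 1 - `|cos (pi * x)|.
have d0 : 0 < d.
  rewrite /d subr_gt0 ltr_norml; apply/andP; split.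
    have := cosI 1 x; rewrite mulr1 cospi => -> //; lra.
  by have := cosI x 0; rewrite mulr0 cos0 => -> //; lra.
have hd (y : R) : 0 < y < 1 -> d <= 1 - cos (pi * x + pi * y).
  move=> /andP[y0 y1]; rewrite /d lerB//.
  have [xy|xy] := leP (x + y) 1.
    apply: le_trans (ler_norm _); rewrite -mulrDr ltW// cosI//; lra.
  have -> : cos (pi * x + pi * y) = cos (pi * (2 - (x + y))).
    have -> : pi * (2 - (x + y)) = - (pi * x + pi * y) + pi + pi by ring.
    by rewrite cosDpi cosDpi opprK cosN.
  rewrite -normrN; apply: le_trans (ler_norm _).
  have -> : - cos (pi * x) = cos (pi * (1 - x)).
    have -> : pi * (1 - x) = - (pi * x) + pi by ring.
    by rewrite cosDpi cosN.
  by rewrite ltW// cosI//; lra.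
exists (2 / d); first by rewrite divr_ge0// ltW.
move=> M y y01.
have M0 : 0 < M.+1%:R :> R by [].
have e0 : 0 <= fejer_err M x y by exact: fejer_ge0.
have e1 : fejer_err M x y <= 2 / d / M.+1%:R.
  rewrite mulrAC ler_pdivlMr//; apply: le_trans (fejer_small M (pi * x + pi * y)).
  by apply: ler_wpM2l => //; exact: hd.
split => //.
  by rewrite divr_ge0// addr_ge0// fejer_ge0.
have -> : pi * (x - y) = pi * x + - pi * y by ring.
rewrite /fejer_even -/(fejer_err M x y).
have := fejer_small M (pi * x + - pi * y).
have c2 : 1 - cos (pi * x + - pi * y) <= 2.
  by have := cos_geN1 (pi * x + - pi * y); lra.
have c0 : 0 <= 1 - cos (pi * x + - pi * y) by rewrite subr_ge0 cos_le1.
set u := 1 - cos _ in c2 c0 *; set a := fejer _ _ => h.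
have h2 : fejer_err M x y * u <= fejer_err M x y * 2 by exact: ler_wpM2l.
rewrite [X in _ <= X](_ : _ = 1 / M.+1%:R + 2 / d / M.+1%:R); last by rewrite -mulrDl.
have -> : (a + fejer_err M x y) / 2 * u = (a * u + fejer_err M x y * u) / 2 by ring.
rewrite ler_pdivrMr//.
move: h h2 e1; rewrite mul1r.
set p1 := a * u; set p2 := _ * u; set e := fejer_err M x y; set e' := 2 / d / _.
set q := _^-1; lra.
Qed.

(** Once both products are expanded, each term on the left occurs up to sign on the right. *)
Lemma prod_perturb I (r : seq I) (a b : I -> R) :
  (forall i, 0 <= a i) -> (forall i, 0 <= b i) ->
  `|\prod_(i <- r) (a i - b i) - \prod_(i <- r) a i| <=
  \prod_(i <- r) (a i + b i) - \prod_(i <- r) a i.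
Proof.
move=> a0 b0; elim: r => [|i r IH]; first by rewrite !big_nil !subrr normr0.
rewrite !big_cons.
have X0 : 0 <= \prod_(j <- r) a j by exact: prodr_ge0.
set X := \prod_(j <- r) a j in IH X0 *; set X' := \prod_(j <- r) (a j - b j) in IH *.
set Y := \prod_(j <- r) (a j + b j) in IH *.
have -> : (a i - b i) * X' - a i * X = a i * (X' - X) - b i * X' by ring.
apply: le_trans (ler_normB _ _) _; rewrite !normrM [ `|a i|]ger0_norm// [ `|b i|]ger0_norm//.
have -> : (a i + b i) * Y - a i * X = a i * (Y - X) + b i * Y by ring.
have X'Y : `|X'| <= Y.
  rewrite -[X'](subrK X); apply: le_trans (ler_normD _ _) _.
  by rewrite [ `|X|]ger0_norm// -lerBrDr.
apply: lerD; apply: ler_wpM2l; [exact: a0|exact: IH|exact: b0|exact: X'Y].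
Qed.

Lemma fejer_even_err_integral M x (C : R) : 0 < x < 1 ->
  (forall y : R, 0 < y < 1 -> fejer_err M x y <= C / M.+1%:R) ->
  0 <= \int[leb]_(y in `]0, 1[) (fejer_even M x y + fejer_err M x y) <= 1 + C / M.+1%:R.
Proof.
move=> x01 eC.
have i1 := continuous_integrable_itv (@continuous_fejer_even M x).
have i2 := continuous_integrable_itv (@continuous_fejer_err M x).
rewrite RintegralD// integral_fejer_even.
apply/andP; split.
  by rewrite addr_ge0// Rintegral_ge0// => y _; exact: fejer_ge0.
rewrite lerD2l.
apply: (@le_trans _ _ (\int[leb]_(y in `]0, 1[) (C / M.+1%:R))).
  apply: le_Rintegral => //.
  exact: (continuous_integrable_itv (@cst_continuous _ _ (C / M.+1%:R))).
rewrite Rintegral_cst// [X in fine X](lebesgue_measure_itv `]0, 1[)/= lte_fin ltr01.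
by rewrite oppr0 adde0 mulr1.
Qed.

End Fejer.

(** * Fejer summation on the cube *)

Section FejerCube.
Variables (R : realType) (n : nat).
Local Notation Om := (open_cube R n).
Local Notation mu := (@lebesgue_rV R n).
Local Notation leb := (@lebesgue_measure R).
Let mOm : measurable Om. Proof. exact: measurable_open_cube. Qed.

Definition succ_idx M (k : {ffun 'I_n -> 'I_M}) : 'I_n -> nat := fun i => (k i).+1.

Definition fejer_sum M (f : 'rV[R]_n -> R) (x : 'rV[R]_n) : R :=
  \sum_(k : {ffun 'I_n -> 'I_M}) (\prod_i (fejer_coef R M (k i) * 2)) *
    L2_inner Om f (sine (succ_idx k)) * sine (succ_idx k) x.

Lemma fejer_sumE M f x : LpOn Om 2%:E f -> fejer_sum M f x =
  \int[mu]_(y in Om) (f y * \prod_i fejer_odd M (x ord0 i) (y ord0 i)).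
Proof.
move=> lf.
have i1 (k : {ffun 'I_n -> 'I_M}) : mu.-integrable Om (EFin \o (fun y =>
    (\prod_i (fejer_coef R M (k i) * 2)) * sine (succ_idx k) x *
    (f y * sine (succ_idx k) y))).
  exact: (integrable_EFinZ
    ((\prod_i (fejer_coef R M (k i) * 2)) * sine (succ_idx k) x) mOm
    (LpOn2_mul_integrable lf (sine_LpOn2 R (succ_idx k)))).
have [_ E] := Rintegral_bigsum (index_enum {ffun 'I_n -> 'I_M}) mOm i1.
transitivity (\int[mu]_(y in Om) \sum_(k : {ffun 'I_n -> 'I_M})
   (\prod_i (fejer_coef R M (k i) * 2)) * sine (succ_idx k) x *
    (f y * sine (succ_idx k) y)).
  rewrite E; apply: eq_bigr => k _; rewrite mulrAC RintegralZl//.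
  exact: (LpOn2_mul_integrable lf (sine_LpOn2 R (succ_idx k))).
apply: eq_Rintegral => y _.
under [in RHS]eq_bigr do rewrite fejer_oddE.
rewrite bigA_distr_bigA mulr_sumr; apply: eq_bigr => k _.
by rewrite /sine /tensor /sines /succ_idx !big_split/=; ring.
Qed.

(** The kernel of the Fejer sum is the product of the differences [fejer_even] - [fejer_err]; by
    [prod_perturb] it is close in L^1 to the product P of the factors [fejer_even], which has
    integral 1.  Against P, the oscillation |f x - f y| is bounded by e / 2 plus a multiple of
    S(y) = sum_i (1 - cos (pi (x_i - y_i))), whose integral is O(1 / M) by [fejer_errP]. *)
Lemma fejer_cvg f x : LpOn Om 2%:E f -> cube_bounded f ->
  {for x, continuous f} -> Om x -> fejer_sum M f x @[M --> \oo] --> f x.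
Proof.
move=> lf [B0 fB0] cf xO.
pose B := `|B0|; have B_ge0 : 0 <= B by exact: normr_ge0.
have fB y : Om y -> `|f y| <= B.
  by move=> yO; apply: le_trans (fB0 y yO) (ler_norm _).
have [mf _] := (LpOn2P f).1 lf.
have /choice[Ci HC] : forall i : 'I_n, exists C : R, 0 <= C /\
  forall M (y : R), 0 < y < 1 -> [/\ 0 <= fejer_err M (x ord0 i) y,
    fejer_err M (x ord0 i) y <= C / M.+1%:R, 0 <= fejer_even M (x ord0 i) y &
    fejer_even M (x ord0 i) y * (1 - cos (pi * (x ord0 i - y))) <= (1 + C) / M.+1%:R].
  by move=> i; have [C C0 HC] := fejer_errP (xO i); exists C.
pose C := \big[Num.max/0]_i Ci i.
have CiC i : Ci i <= C by exact: le_bigmax.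
have C0 : 0 <= C by exact: bigmax_ge_id.
have HC' i M (y : R) : 0 < y < 1 -> [/\ 0 <= fejer_err M (x ord0 i) y,
    fejer_err M (x ord0 i) y <= C / M.+1%:R, 0 <= fejer_even M (x ord0 i) y &
    fejer_even M (x ord0 i) y * (1 - cos (pi * (x ord0 i - y))) <= (1 + C) / M.+1%:R].
  move=> y01; have [h1 h2 h3 h4] := (HC i).2 M y y01; split => //.
    by apply: le_trans h2 _; rewrite ler_pM2r ?invr_gt0.
  by apply: le_trans h4 _; rewrite ler_pM2r ?invr_gt0// lerD2l.
apply/cvgrPdist_le => e e0.
have [d d0 hd] : exists2 d : R, 0 < d < 1 & forall y : 'rV[R]_n,
    (forall i, `|x ord0 i - y ord0 i| < d) -> `|f x - f y| <= e / 2.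
  have e20 : 0 < e / 2 by rewrite divr_gt0.
  have /cvgrPdist_le /(_ _ e20) /rV_nbhsP[d d0 hd] := cf.
  exists (Num.min d 2^-1).
    by rewrite lt_min d0 invr_gt0 ltr0n /= gt_min invf_lt1// ltr1n orbT.
  by move=> y hy; apply: hd => i; apply: lt_le_trans (hy i) _; rewrite ge_min lexx.
have [d_gt0 d1] := andP d0.
have pi0 := pi_gt0 R.
(* If some coordinate of y is at distance at least d from x then S(y) >= g. *)
pose g := 1 - cos (pi * d).
have memI (w : R) : 0 <= w -> w <= 1 -> pi * w \in `[0 : R, pi].
  by move=> w0 w1; rewrite in_itv/= mulr_ge0 ?(ltW pi0)//= ler_piMr ?(ltW pi0).
have g0 : 0 < g.
  rewrite /g subr_gt0 -[ltRHS](@cos0 R) -[X in _ < cos X](mulr0 pi) ltr_cos.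
  - by rewrite ltr_pM2l.
  - by apply: memI; lra.
  - by apply: memI; lra.
pose S (y : 'rV[R]_n) := \sum_i (1 - cos (pi * (x ord0 i - y ord0 i))).
have term0 (w : R) : 0 <= 1 - cos w by rewrite subr_ge0 cos_le1.
have fxy y : Om y -> `|f x - f y| <= e / 2 + 2 * B / g * S y.
  move=> yO.
  have [h|/existsNP[i /negP]] := pselect (forall i, `|x ord0 i - y ord0 i| < d).
    apply: le_trans (hd y h) _; rewrite lerDl mulr_ge0 ?divr_ge0 ?mulr_ge0 ?(ltW g0)//.
    exact: sumr_ge0.
  rewrite -leNgt => di.
  apply: (@le_trans _ _ (2 * B / g * S y)); last by rewrite lerDr divr_ge0// ltW.
  apply: (@le_trans _ _ (2 * B / g * g)).
    rewrite divfK ?gt_eqF//; apply: le_trans (ler_normB _ _) _.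
    by have := fB x xO; have := fB y yO; lra.
  apply: ler_wpM2l; first by rewrite divr_ge0 ?mulr_ge0// ltW.
  rewrite /S (bigD1 i)//=; apply: (@le_trans _ _ (1 - cos (pi * (x ord0 i - y ord0 i)))); last first.
    by rewrite lerDl sumr_ge0.
  rewrite /g lerB//.
  have -> : cos (pi * (x ord0 i - y ord0 i)) = cos (pi * `|x ord0 i - y ord0 i|).
    by case: (ger0P (x ord0 i - y ord0 i)) => // _; rewrite mulrN cosN.
  have := xO i; have := yO i; set a := x ord0 i in di *; set b := y ord0 i in di *.
  move=> /andP[b0 b1] /andP[a0 a1].
  have ab1 : `|a - b| <= 1 by rewrite ler_norml; lra.
  rewrite leNgt ltr_cos ?memI//; last 2 first.
  - lra.
  - lra.
  by rewrite ltr_pM2l// -leNgt.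
pose K M (y : 'rV[R]_n) := \prod_i fejer_odd M (x ord0 i) (y ord0 i).
pose P M (y : 'rV[R]_n) := \prod_i fejer_even M (x ord0 i) (y ord0 i).
pose Y M (y : 'rV[R]_n) := \prod_i
  (fejer_even M (x ord0 i) (y ord0 i) + fejer_err M (x ord0 i) (y ord0 i)).
pose Z i M (y : 'rV[R]_n) := \prod_j (if j == i then
  fejer_even M (x ord0 j) (y ord0 j) * (1 - cos (pi * (x ord0 j - y ord0 j)))
  else fejer_even M (x ord0 j) (y ord0 j)).
have ccos (a : R) : continuous (fun y : R => 1 - cos (pi * (a - y))).
  move=> y; apply: cvgB; first exact: cvg_cst.
  apply: (continuous_comp (f := fun y : R => pi * (a - y))); last exact: continuous_cos.
  by apply: cvgM; [exact: cvg_cst|apply: cvgB; [exact: cvg_cst|exact: cvg_id]].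
have cY1 i M : continuous (fun y : R => fejer_even M (x ord0 i) y + fejer_err M (x ord0 i) y).
  by move=> y; exact: cvgD (@continuous_fejer_even _ _ _ y) (@continuous_fejer_err _ _ _ y).
have cZ1 i j M : continuous (fun y : R => if j == i then
   fejer_even M (x ord0 j) y * (1 - cos (pi * (x ord0 j - y)))
   else fejer_even M (x ord0 j) y).
  case: (j == i) => y; last exact: continuous_fejer_even.
  exact: cvgM (@continuous_fejer_even _ _ _ y) (ccos (x ord0 j) y).
have cK M : continuous (K M).
  apply: (@continuous_coord_prod R n (fun i => fejer_odd M (x ord0 i)) xpredT) => i.
  exact: continuous_fejer_odd.
have cP M : continuous (P M).
  apply: (@continuous_coord_prod R n (fun i => fejer_even M (x ord0 i)) xpredT) => i.
  exact: continuous_fejer_even.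
have cY M : continuous (Y M).
  exact: (@continuous_coord_prod R n (fun i y => fejer_even M (x ord0 i) y +
    fejer_err M (x ord0 i) y) xpredT (fun i => cY1 i M)).
have cZ i M : continuous (Z i M).
  exact: (@continuous_coord_prod R n (fun j y => if j == i then
   fejer_even M (x ord0 j) y * (1 - cos (pi * (x ord0 j - y)))
   else fejer_even M (x ord0 j) y) xpredT (fun j => cZ1 i j M)).
have iP1 M : \int[mu]_(y in Om) P M y = 1.
  rewrite (cube_integral_prod (g := fun i => fejer_even M (x ord0 i))).
    by rewrite big1// => i _; exact: integral_fejer_even.
  by move=> i; exact: continuous_fejer_even.
have iY1 M : \int[mu]_(y in Om) Y M y <= (1 + C / M.+1%:R) ^+ n.
  rewrite (cube_integral_prod (g := fun i y =>
     fejer_even M (x ord0 i) y + fejer_err M (x ord0 i) y)) => [|i]; last exact: cY1.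
  apply: (@le_trans _ _ (\prod_(i < n) (1 + C / M.+1%:R))).
    apply: ler_prod => i _; apply: (fejer_even_err_integral (xO i)) => y y01.
    by have [] := HC' i M y y01.
  by rewrite prodr_const card_ord.
have iZ1 i M : \int[mu]_(y in Om) Z i M y <= (1 + C) / M.+1%:R.
  rewrite (cube_integral_prod (g := fun j y => if j == i then
   fejer_even M (x ord0 j) y * (1 - cos (pi * (x ord0 j - y)))
   else fejer_even M (x ord0 j) y)) => [|j]; last exact: cZ1.
  rewrite (bigD1 i)//= eqxx big1 ?mulr1; last first.
    by move=> j /negPf ->; exact: integral_fejer_even.
  apply: (@le_trans _ _ (\int[leb]_(y in `]0, 1[) ((1 + C) / M.+1%:R))).
    apply: le_Rintegral => //.
    - have := @cZ1 i i M; rewrite eqxx => h; exact: (continuous_integrable_itv h).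
    - exact: (continuous_integrable_itv (@cst_continuous _ _ ((1 + C) / M.+1%:R))).
    - by move=> y y01; have [] := HC' i M y y01.
  rewrite Rintegral_cst// [X in fine X](lebesgue_measure_itv `]0, 1[)/= lte_fin ltr01.
  by rewrite oppr0 adde0 mulr1.
have KP M y : Om y -> `|K M y - P M y| <= Y M y - P M y.
  move=> yO.
  have -> : K M y = \prod_i (fejer_even M (x ord0 i) (y ord0 i) - fejer_err M (x ord0 i) (y ord0 i)).
    by apply: eq_bigr => i _; rewrite /fejer_odd /fejer_even /fejer_err; field.
  by apply: prod_perturb => i; have [] := HC' i M _ (yO i).
have P0 M y : Om y -> 0 <= P M y.
  by move=> yO; apply: prodr_ge0 => i _; have [] := HC' i M _ (yO i).
have PS M y : P M y * S y = \sum_i Z i M y.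
  rewrite mulr_sumr; apply: eq_bigr => i _.
  rewrite /P /Z (bigD1 i)//= [in RHS](bigD1 i)//= eqxx mulrAC; congr (_ * _).
  by apply: eq_bigr => j /negPf ->.
have bound M : `|f x - fejer_sum M f x| <=
   B * ((1 + C / M.+1%:R) ^+ n - 1) + e / 2 + 2 * B / g * (n%:R * ((1 + C) / M.+1%:R)).
  have ifK : mu.-integrable Om (EFin \o (fun y => f y * K M y)).
    exact: (LpOn2_mul_integrable lf (continuous_LpOn2 (cK M))).
  have iP := continuousT_cube_integrable (cP M).
  have iY := continuousT_cube_integrable (cY M).
  have iZ i := continuousT_cube_integrable (cZ i M).
  have [iSZ ESZ] := Rintegral_bigsum (index_enum 'I_n) mOm iZ.
  have ifP : mu.-integrable Om (EFin \o (fun y => f x * P M y)).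
    exact: (integrable_EFinZ (f x) mOm iP).
  have -> : f x - fejer_sum M f x = \int[mu]_(y in Om) (f x * P M y - f y * K M y).
    by rewrite RintegralB// RintegralZl// iP1 mulr1 fejer_sumE.
  have i1 : mu.-integrable Om (EFin \o (fun y => f x * P M y - f y * K M y)).
    exact: (integrable_EFinB mOm ifP ifK).
  apply: le_trans (le_normr_Rintegral mOm i1) _.
  have i2 : mu.-integrable Om (EFin \o (fun y => B * (Y M y - P M y))).
    exact: (integrable_EFinZ (B) mOm (integrable_EFinB mOm iY iP)).
  have i3 : mu.-integrable Om (EFin \o (fun y => e / 2 * P M y)).
    exact: (integrable_EFinZ (e / 2) mOm iP).
  have i4 : mu.-integrable Om (EFin \o (fun y => 2 * B / g * \sum_i Z i M y)).
    exact: (integrable_EFinZ (2 * B / g) mOm iSZ).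
  have i23 : mu.-integrable Om (EFin \o (fun y => B * (Y M y - P M y) + e / 2 * P M y)).
    exact: (integrable_EFinD mOm i2 i3).
  have i234 : mu.-integrable Om (EFin \o (fun y => B * (Y M y - P M y) + e / 2 * P M y +
      2 * B / g * \sum_i Z i M y)).
    exact: (integrable_EFinD mOm i23 i4).
  apply: (@le_trans _ _ (\int[mu]_(y in Om) (B * (Y M y - P M y) + e / 2 * P M y +
      2 * B / g * \sum_i Z i M y))).
    apply: le_Rintegral => //; first exact: (integrable_norm i1).
    move=> y yO.
    have -> : f x * P M y - f y * K M y = (f x - f y) * P M y - f y * (K M y - P M y) by ring.
    apply: le_trans (ler_normB _ _) _; rewrite !normrM [ `|P M y|]ger0_norm ?P0// addrC -addrA.
    apply: lerD; first by apply: ler_pM => //; [exact: fB|exact: KP].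
    have -> : e / 2 * P M y + 2 * B / g * \sum_i Z i M y =
      (e / 2 + 2 * B / g * S y) * P M y by rewrite -PS; ring.
    by apply: ler_wpM2r; [exact: P0|exact: fxy].
  rewrite RintegralD// RintegralD// !RintegralZl//; last first.
    exact: (integrable_EFinB mOm iY iP).
  rewrite RintegralB// iP1 ESZ mulr1; apply: lerD.
    by apply: lerD => //; apply: ler_wpM2l => //; rewrite lerD2r.
  apply: ler_wpM2l; first by rewrite divr_ge0 ?mulr_ge0// ltW.
  apply: (@le_trans _ _ (\sum_(i < n) (1 + C) / M.+1%:R)); first by apply: ler_sum => i _.
  by rewrite sumr_const card_ord mulr_natl.
have hM : (fun M : nat => M.+1%:R^-1 : R) @ \oo --> (0 : R) by exact: cvg_harmonic.
have lim : B * ((1 + C / M.+1%:R) ^+ n - 1) + e / 2 +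
    2 * B / g * (n%:R * ((1 + C) / M.+1%:R)) @[M --> \oo] --> e / 2.
  rewrite [X in _ --> X](_ : e / 2 =
      B * ((1 + C * 0) ^+ n - 1) + e / 2 + 2 * B / g * (n%:R * ((1 + C) * 0))); last first.
    by rewrite !mulr0 !addr0 expr1n subrr mulr0 add0r.
  have l1 : (1 + C / M.+1%:R) ^+ n @[M --> \oo] --> (1 + C * 0) ^+ n.
    apply: (cvg_comp (fun M : nat => 1 + C / M.+1%:R) (fun y => y ^+ n));
      last exact: exprn_continuous.
    by apply: cvgD; [exact: cvg_cst|apply: cvgM => //; exact: cvg_cst].
  have l2 : (1 + C) / M.+1%:R @[M --> \oo] --> (1 + C) * 0.
    by apply: cvgM => //; exact: cvg_cst.
  apply: cvgD; [apply: cvgD; [|exact: cvg_cst]|].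
    by apply: cvgM; [exact: cvg_cst|apply: cvgB => //; exact: cvg_cst].
  by apply: cvgM; [exact: cvg_cst|apply: cvgM => //; exact: cvg_cst].
have e2 : e / 2 < e by rewrite ltr_pdivrMr// ltr_pMr// ltr1n.
near=> M; apply: le_trans (bound M) _; apply: ltW; near: M.
by have /cvgr_lt /(_ _ e2) := lim.
Unshelve. all: by end_near. Qed.

End FejerCube.

(** * Integrals of arbitrary functions *)

Section IntegralNonMeasurable.
Context d (T : measurableType d) (R : realType) (mu : {measure set T -> \bar R}).
Implicit Types (D : set T).
Import HBNNSimple.

(** Suprema over [omega] and duality pairings are not known to be measurable in time.  The
    integral of a nonnegative function is a supremum over the simple functions below it, and
    comparing these needs only to cut them off on the exceptional null set. *)
Lemma ge0_ae_le_integral_any D (f g : T -> \bar R) :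
  (forall x, D x -> (0 <= f x)%E) -> (forall x, D x -> (0 <= g x)%E) ->
  {ae mu, forall x, D x -> (f x <= g x)%E} ->
  (\int[mu]_(x in D) f x <= \int[mu]_(x in D) g x)%E.
Proof.
move=> f0 g0 [N [mN N0 subN]].
rewrite !ge0_integralE//; apply: ge_ereal_sup => _ [h /= hf <-].
(* Cutting off the simple function on the null set does not change its integral. *)
pose h' := mul_nnsfun h (indic_nnsfun R (measurableC mN)).
have h'E x : h' x = h x * (x \in ~` N)%:R by rewrite /= mindicE.
have -> : sintegral mu h = sintegral mu h'.
  rewrite -!integralT_nnsfun; apply: ae_eq_integral => //.
  - by apply/measurable_EFinP.
  - by apply/measurable_EFinP.
  exists N; split => // x /=; apply: contra_notP => Nx _.
  by rewrite mindicE mem_set// mulr1.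
apply: ereal_sup_ubound; exists h' => // x.
rewrite [X in (X%:E <= _)%E]h'E patchE.
have [xN|xN] := pselect (N x).
  have -> : (x \in ~` N) = false by apply/negbTE; rewrite notin_setE /= => /(_ xN).
  by rewrite mulr0; case: ifPn => // /set_mem/g0.
have -> : (x \in ~` N) = true by rewrite mem_set.
rewrite mulr1; have := hf x; rewrite patchE.
case: ifPn => // xD hx; apply: le_trans hx _.
apply: contrapT => nfg; apply: xN; apply: subN => /= H.
by apply: nfg; apply: H; exact: set_mem.
Qed.

Lemma ae_eq_Rintegral_any D (f g : T -> R) :
  {ae mu, forall x, D x -> f x = g x} ->
  \int[mu]_(x in D) f x = \int[mu]_(x in D) g x.
Proof.
move=> fg; rewrite /Rintegral [in LHS]integralE [in RHS]integralE.
congr (fine (_ - _)); apply/eqP; rewrite eq_le; apply/andP; split;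
  apply: ge0_ae_le_integral_any => //;
  by apply: filterS fg => x /= h Dx; rewrite ?funeposE ?funenegE /= (h Dx).
Qed.

Lemma Rintegral_support D (f : T -> R) : (forall x, ~ D x -> f x = 0) ->
  \int[mu]_(x in D) f x = \int[mu]_x f x.
Proof.
move=> f0; rewrite Rintegral_mkcond; apply: eq_Rintegral => x _.
by rewrite patchE; case: ifPn => // /negP xD; rewrite f0// => /mem_set.
Qed.

End IntegralNonMeasurable.

(** * Continuous functions with vanishing weak derivative *)

Section DuBoisReymond.
Variable R : realType.
Local Notation leb := (@lebesgue_measure R).

Lemma smooth1_test (T : R) (eta : R -> R) p q : smooth1 eta -> 0 < p -> q < T ->
  (forall t, eta t != 0 -> p <= t <= q) -> time_test_function (`]0, T[%classic) eta.
Proof.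
move=> se p0 qT supp.
have scl : closure [set t | eta t != 0] `<=` `[p, q]%classic.
  rewrite closureE => x; apply; split; first exact: itv_closed.
  by move=> t /supp; rewrite /= in_itv.
split.
- by move=> k x; exact: smooth1_derive1n.
- apply: (subclosed_compact (@closed_closure _ _) (@segment_compact _ p q)).
  exact: scl.
- move=> x /scl; rewrite /= !in_itv/= => /andP[px xq].
  by rewrite (lt_le_trans p0)//= (le_lt_trans xq).
Qed.

Definition bump (a d t : R) : R := theta 0 (d + (t - a)) * theta 0 (d - (t - a)).

Lemma bump_smooth a d : smooth1 (bump a d).
Proof.
have cth m j : Ck j (theta m : R -> R).
  elim: j m => // j IH m.
  apply: CkS (theta_is_derive m) _; apply: CkD => //.
  by apply: CkM => //; exact: Ck_cst.
move=> k; apply: CkM.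
  rewrite (_ : (fun x => _) = theta 0 \o (fun x => x + (d - a))); last first.
    by apply/funext => x /=; congr theta; ring.
  by apply: Ck_comp => //; apply: CkD; [exact: Ck_id|exact: Ck_cst].
rewrite (_ : (fun x => _) = theta 0 \o (fun x => -1 * x + (d + a))); last first.
  by apply/funext => x /=; congr theta; ring.
apply: Ck_comp => //; apply: CkD; last exact: Ck_cst.
by apply: CkM; [exact: Ck_cst|exact: Ck_id].
Qed.

Lemma bump_ge0 a d t : 0 <= bump a d t.
Proof. by rewrite mulr_ge0// theta_ge0. Qed.

Lemma bump_supp a d t : bump a d t != 0 -> a - d < t < a + d.
Proof.
rewrite /bump /theta; case: ifPn => [h1|_]; last by rewrite mul0r eqxx.
case: ifPn => [h2 _|_]; last by rewrite mulr0 eqxx.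
by apply/andP; split; lra.
Qed.

Lemma bump_gt0 a d : 0 < d -> 0 < bump a d a.
Proof.
move=> d0; rewrite /bump /theta subrr addr0 subr0 d0 expr0 mul1r.
by rewrite mulr_gt0// expR_gt0.
Qed.

Lemma bump_eq0 a d t : t <= a - d \/ a + d <= t -> bump a d t = 0.
Proof.
move=> h; apply/eqP/negPn/negP => /bump_supp /andP[h1 h2].
by case: h; rewrite leNgt ?h1 ?h2.
Qed.

Lemma bump_integrable a d (D : set R) : measurable D -> leb.-integrable D (EFin \o bump a d).
Proof.
move=> mD; apply: (@integrableS _ _ R leb (setT : set (measurableTypeR R))) => //.
have cb : continuous (bump a d) by apply: smooth1_continuous; exact: bump_smooth.
have : leb.-integrable `[a - d, a + d] (EFin \o bump a d).
  apply: continuous_compact_integrable; first exact: segment_compact.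
  exact: continuous_subspaceT.
move=> h; rewrite (_ : EFin \o bump a d = (EFin \o bump a d) \_ `[a - d, a + d]).
  by apply/integrable_restrict => //; rewrite setTI.
apply/funext => t; rewrite patchE; case: ifPn => // /negP nt.
rewrite /= bump_eq0//; have [h1|h1] := leP t (a - d); first by left.
right; rewrite leNgt; apply/negP => h2; apply: nt; rewrite inE/= in_itv/=.
by rewrite !ltW.
Qed.

(** The base point -1 lies to the left of the supports of the bumps used, so the primitive
    vanishes before them. *)
Definition bump_prim a d t := \int[leb]_(s in `[-1, t]) bump a d s.

Definition bump_mass a d := \int[leb]_s bump a d s.

Lemma bump_prim_bounds a d t : 0 <= bump_prim a d t <= bump_mass a d.
Proof.
apply/andP; split; first by apply: Rintegral_ge0 => s _; exact: bump_ge0.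
rewrite /bump_prim Rintegral_mkcond; apply: le_Rintegral => //.
- rewrite -restrict_EFin; apply/integrable_restrict => //.
  by rewrite setTI; exact: bump_integrable.
- exact: bump_integrable.
- by move=> s _; rewrite patchE; case: ifP => // _; exact: bump_ge0.
Qed.

Lemma bump_prim_left a d t : t <= a - d -> bump_prim a d t = 0.
Proof.
move=> ht; rewrite /bump_prim (@eq_Rintegral _ _ _ _ _ (cst 0)).
  by rewrite Rintegral_cst// mul0r.
move=> s; rewrite inE/= in_itv/= => /andP[_ st].
by apply: bump_eq0; left; exact: le_trans ht.
Qed.

Lemma bump_prim_right a d t : 0 < a - d -> a + d <= t -> bump_prim a d t = bump_mass a d.
Proof.
move=> ad ht; apply: Rintegral_support => s /= ns; apply: bump_eq0.
have [h1|h1] := leP s (a - d); first by left.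
right; rewrite leNgt; apply/negP => h2; apply: ns; rewrite in_itv/=.
by apply/andP; split; lra.
Qed.

Lemma bump_prim_is_derive a d (t : R) : 0 < a - d -> is_derive t 1 (bump_prim a d) (bump a d t).
Proof.
move=> ad; have [t0|t0] := ltP t 0.
  rewrite bump_eq0; last by left; lra.
  apply: (@near_eq_is_derive R R^o R^o (fun=> 0)).
  near=> s; rewrite bump_prim_left//.
  have : s < 0 by near: s; exact: lt_nbhsl.
  by lra.
have t1 : -1 < t by lra.
have tt : t < t + 1 by rewrite ltrDl.
have cb : {for t, continuous (bump a d)}.
  by apply: smooth1_continuous; exact: bump_smooth.
have [h1 h2] := continuous_FTC1_closed tt (bump_integrable a d (measurable_itv _)) t1 cb.
by split; [exact: h1|rewrite -derive1E; exact: h2].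
Unshelve. all: by end_near. Qed.

Lemma bump_prim_smooth a d : 0 < a - d -> smooth1 (bump_prim a d).
Proof.
move=> ad; case => // k; apply: CkS (bump_smooth a d k).
by move=> t; exact: bump_prim_is_derive.
Qed.

Lemma bump_mass_gt0 a d : 0 < a - d -> 0 < d -> 0 < bump_mass a d.
Proof.
move=> ad d0; have /andP[h1 h2] := bump_prim_bounds a d a.
rewrite lt_neqAle (le_trans h1 h2) andbT eq_sym; apply/eqP => m0.
have P0 : bump_prim a d = cst 0.
  apply/funext => t; apply/eqP; rewrite eq_le; have := bump_prim_bounds a d t.
  by rewrite m0 andbC.
have [_ hd] := bump_prim_is_derive a ad.
have := bump_gt0 a d0; rewrite -hd P0.
by have [_ ->] := is_derive_cst (0 : R) a 1; rewrite ltxx.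
Qed.

(** The difference of two such steps is a test function whose derivative compares the local
    averages of a function around two points. *)
Lemma smooth_step a d : 0 < a - d -> 0 < d -> exists S : R -> R,
  [/\ smooth1 S, forall t, t <= a - d -> S t = 0, forall t, a + d <= t -> S t = 1 &
  [/\ forall t, 0 <= derive1 S t,
      forall t, derive1 S t != 0 -> a - d < t < a + d &
      forall T, a + d < T -> \int[leb]_(t in `]0, T[) derive1 S t = 1]].
Proof.
move=> ad d0; have m0 := bump_mass_gt0 ad d0.
have dS (t : R) : is_derive t 1 (fun t => (bump_mass a d)^-1 * bump_prim a d t)
    ((bump_mass a d)^-1 * bump a d t).
  have := is_derive1M (is_derive_cst ((bump_mass a d)^-1) t 1) (bump_prim_is_derive t ad).
  by rewrite (mulr0 (bump_prim a d t)) addr0.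
have dSE (t : R) : derive1 (fun t => (bump_mass a d)^-1 * bump_prim a d t) t =
    (bump_mass a d)^-1 * bump a d t by rewrite derive1E; case: (dS t).
exists (fun t => (bump_mass a d)^-1 * bump_prim a d t); split.
- by move=> k; apply: CkM; [exact: Ck_cst|exact: bump_prim_smooth].
- by move=> t /bump_prim_left ->; rewrite mulr0.
- by move=> t /(bump_prim_right ad) ->; rewrite mulVf// gt_eqF.
split.
- by move=> t; rewrite dSE mulr_ge0 ?bump_ge0// invr_ge0 ltW.
- by move=> t; rewrite dSE mulf_eq0 negb_or => /andP[_ /bump_supp].
- move=> T adT; under eq_Rintegral do rewrite dSE.
  rewrite RintegralZl//; last exact: bump_integrable.
  rewrite Rintegral_support ?mulVf ?gt_eqF// => t nt; apply: bump_eq0.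
  have [h1|h1] := leP t (a - d); first by left.
  right; rewrite leNgt; apply/negP => h2; apply: nt; rewrite /= in_itv/=.
  by apply/andP; split; lra.
Qed.

Lemma continuous_integrable_oo (f : R -> R) (T : R) : continuous f ->
  leb.-integrable `]0, T[ (EFin \o f).
Proof.
move=> cf; apply: (@integrableS _ _ R leb (`[0 : R, T]%classic : set (measurableTypeR R))) => //.
  exact: subset_itv_oo_cc.
apply: continuous_compact_integrable; first exact: segment_compact.
exact: continuous_subspaceT.
Qed.

Lemma weighted_average (g b : R -> R) v (T e : R) : continuous g -> continuous b ->
  (forall t, 0 <= b t) -> \int[leb]_(t in `]0, T[) b t = 1 ->
  (forall t, b t != 0 -> `|g t - v| <= e) ->
  `|\int[leb]_(t in `]0, T[) (b t * g t) - v| <= e.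
Proof.
move=> cg cb b0 b1 ge.
have cbg : continuous (fun t => b t * g t) by move=> t; exact: cvgM (cb t) (cg t).
have mI : measurable (`]0, T[%classic : set (measurableTypeR R)) by [].
have i1 := continuous_integrable_oo T cbg.
have i2 := continuous_integrable_oo T cb.
have i3 := integrable_EFinZ v mI i2.
have i4 := integrable_EFinB mI i1 i3.
have i5 := integrable_EFinZ e mI i2.
have -> : \int[leb]_(t in `]0, T[) (b t * g t) - v =
    \int[leb]_(t in `]0, T[) (b t * g t - v * b t).
  by rewrite (RintegralB mI i1 i3) (RintegralZl _ mI i2) b1 mulr1.
apply: le_trans (le_normr_Rintegral mI i4) _.
rewrite -[leRHS]mulr1 -b1 -(RintegralZl _ mI i2).
apply: le_Rintegral => //; first exact: (integrable_norm i4).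
move=> t _; have -> : b t * g t - v * b t = (g t - v) * b t by ring.
rewrite normrM [ `|b t|]ger0_norm//.
have [->|/ge h] := eqVneq (b t) 0; first by rewrite !mulr0.
by rewrite ler_wpM2r.
Qed.

(** For a < b the test function is the difference of two steps located at a and b: its
    derivative averages [g] near a with sign + and near b with sign -, hence g a = g b.  The end
    points are reached by continuity. *)
Lemma du_bois_reymond (T : R) (g : R -> R) : 0 < T -> continuous g ->
  (forall zeta, smooth1 zeta -> (exists p q, [/\ 0 < p, q < T &
     forall t, zeta t != 0 -> p <= t <= q]) ->
     \int[leb]_(t in `]0, T[) (derive1 zeta t * g t) = 0) ->
  forall t, t \in `[0, T] -> g t = g 0.
Proof.
move=> T0 cg H.
have inner a b : 0 < a -> a < b -> b < T -> g a = g b.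
  move=> a0 ab bT; apply/eqP; rewrite -subr_eq0 -normr_le0.
  apply/ler_addgt0Pr => e e0; rewrite add0r.
  have e20 : 0 < e / 2 by rewrite divr_gt0.
  have [d [d0 da db hd]] : exists d : R, [/\ 0 < d, d < a, d < T - b &
      forall t, (a - d < t < a + d -> `|g t - g a| <= e / 2) /\
        (b - d < t < b + d -> `|g t - g b| <= e / 2)].
    have /cvgrPdist_le /(_ _ e20) /nbhs_ballP[d1 d10 h1] := cg a.
    have /cvgrPdist_le /(_ _ e20) /nbhs_ballP[d2 d20 h2] := cg b.
    rewrite /= in d10 d20.
    exists (Num.min (Num.min d1 d2) (Num.min (a / 2) ((T - b) / 2))).
    set d := Num.min _ _.
    have dd1 : d <= d1 by rewrite /d !ge_min lexx.
    have dd2 : d <= d2 by rewrite /d !ge_min lexx orbT.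
    have dd3 : d <= a / 2 by rewrite /d !ge_min lexx !orbT.
    have dd4 : d <= (T - b) / 2 by rewrite /d !ge_min lexx !orbT.
    split.
    - by rewrite /d !lt_min d10 d20 !divr_gt0// subr_gt0.
    - by apply: le_lt_trans dd3 _; lra.
    - by apply: le_lt_trans dd4 _; lra.
    - move=> t; split => /andP[t1 t2]; rewrite distrC.
        by apply: h1; rewrite /ball/= ltr_norml; lra.
      by apply: h2; rewrite /ball/= ltr_norml; lra.
  have ad : 0 < a - d by rewrite subr_gt0.
  have bd : 0 < b - d by lra.
  have [S1 [s1 l1 r1 [p1 u1 I1]]] := smooth_step ad d0.
  have [S2 [s2 l2 r2 [p2 u2 I2]]] := smooth_step bd d0.
  have adT : a + d < T by lra.
  have bdT : b + d < T by lra.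
  have c1 : continuous (derive1 S1) by apply: smooth1_continuous; exact: smooth1_derive1.
  have c2 : continuous (derive1 S2) by apply: smooth1_continuous; exact: smooth1_derive1.
  pose zeta t := S1 t + -1 * S2 t.
  have zE t : derive1 zeta t = derive1 S1 t - derive1 S2 t.
    have h1 := is_derive1M (is_derive_cst (-1 : R) t 1) (smooth1_is_derive t s2).
    have [_ h2] := is_derive1D (smooth1_is_derive t s1) h1.
    by rewrite derive1E; apply: etrans h2 _; rewrite /cst mulr0 addr0 mulN1r.
  have Hz : \int[leb]_(t in `]0, T[) (derive1 zeta t * g t) = 0.
    apply: H.
      by move=> k; apply: CkD; [exact: s1|apply: CkM; [exact: Ck_cst|exact: s2]].
    exists (a - d), (b + d); split; [exact: ad|exact: bdT|].
    move=> t; rewrite /zeta; have [h|h] := ltP t (a - d).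
      by rewrite l1 ?l2 ?mulr0 ?addr0 ?eqxx//; lra.
    have [//|h2] := leP t (b + d).
    by rewrite r1 ?r2 ?mulr1 ?subrr ?eqxx//; lra.
  have cg1 : continuous (fun t => derive1 S1 t * g t).
    by move=> t; exact: cvgM (c1 t) (cg t).
  have cg2 : continuous (fun t => derive1 S2 t * g t).
    by move=> t; exact: cvgM (c2 t) (cg t).
  have E : \int[leb]_(t in `]0, T[) (derive1 S1 t * g t) =
      \int[leb]_(t in `]0, T[) (derive1 S2 t * g t).
    apply/eqP; rewrite -subr_eq0; apply/eqP.
    rewrite -(RintegralB _ (continuous_integrable_oo T cg1) (continuous_integrable_oo T cg2))//.
    by rewrite -[RHS]Hz; apply: eq_Rintegral => t _; rewrite zE mulrBl.
  have h1 := weighted_average cg c1 p1 (I1 T adT) (fun t ut => (hd t).1 (u1 t ut)).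
  have h2 := weighted_average cg c2 p2 (I2 T bdT) (fun t ut => (hd t).2 (u2 t ut)).
  move: h1 h2; rewrite E; set I := \int[leb]_(t in _) _ => h1 h2.
  have -> : g a - g b = - (I - g a) + (I - g b) by ring.
  by apply: le_trans (ler_normD _ _) _; rewrite normrN [leRHS]splitr; exact: lerD.
pose v := g (T / 2).
have inT : forall t, `]0, T[%classic t -> g t = v.
  move=> t /=; rewrite in_itv/= => /andP[t0 tT].
  have [h|h|->//] := ltgtP t (T / 2); first by apply: inner => //; lra.
  by apply/esym/inner => //; lra.
have all t : t \in `[0, T] -> g t = v.
  move=> tT; apply/eqP; rewrite -subr_eq0 -normr_le0.
  apply/ler_addgt0Pr => e e0; rewrite add0r.
  have /cvgrPdist_le /(_ _ e0) /nbhs_ballP[d d0 h1] := cg t.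
  rewrite /= in d0.
  move: tT; rewrite in_itv/= => /andP[t0 tT].
  (* Moving t towards T / 2 by this proportion enters ]0, T[ and stays within d of t. *)
  pose r := Num.min 2^-1 (d / (2 * T)).
  have r0 : 0 < r by rewrite lt_min invr_gt0 ltr0n/= divr_gt0// mulr_gt0.
  have r1 : r <= 2^-1 by rewrite ge_min lexx.
  have r2 : r * (2 * T) <= d by rewrite -ler_pdivlMr ?mulr_gt0// ge_min lexx orbT.
  pose s := t + r * (T / 2 - t).
  have sT : `]0, T[%classic s.
    by rewrite /= in_itv/= /s; apply/andP; split; nra.
  rewrite -(inT _ sT); apply: h1.
  rewrite /ball/= /s opprD addrA subrr sub0r normrN normrM gtr0_norm//.
  have : `|T / 2 - t| <= T by rewrite ler_norml; lra.
  by have := normr_ge0 (T / 2 - t); nra.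
by move=> t tT; rewrite all// -(all 0)// in_itv/= lexx ltW.
Qed.

End DuBoisReymond.

(** * Sine coefficients of weak solutions *)

Section HeatCoefficients.
Variables (R : realType) (n : nat).
Local Notation Om := (open_cube R n).
Local Notation leb := (@lebesgue_measure R).

(** Composition with [clamp T] extends a continuous function on [0, T] to the line. *)
Definition clamp (T t : R) : R := Num.max 0 (Num.min T t).

Lemma clamp_in (T t : R) : 0 <= T -> clamp T t \in `[0, T].
Proof. by move=> T0; rewrite in_itv/= /clamp le_max lexx/= ge_max T0 ge_min lexx. Qed.

Lemma clamp_id (T t : R) : t \in `[0, T] -> clamp T t = t.
Proof. by rewrite in_itv/= /clamp => /andP[t0 tT]; rewrite (min_idPr tT) (max_idPr t0). Qed.

Lemma clamp_continuous (T : R) : continuous (clamp T).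
Proof.
move=> t; apply: continuous_max; first exact: cst_continuous.
by apply: continuous_min; [exact: cst_continuous|exact: cvg_id].
Qed.

Lemma continuous_clamp (T : R) (c : R -> R) : 0 <= T ->
  (forall t, t \in `[0, T] -> c s @[s --> within `[0, T]%classic (nbhs t)] --> c t) ->
  continuous (c \o clamp T).
Proof.
move=> T0 hc t; apply: cvg_trans (hc _ (clamp_in t T0)).
move=> A hA.
have hB : nbhs (clamp T t) [set s | `[0, T]%classic s -> A (c s)] by exact: hA.
have := clamp_continuous (T := T) (x := t) hB.
move=> h; apply: (@filterS R (nbhs t) _ _ _ _ h) => s /=; apply; exact: clamp_in.
Qed.

Lemma LpOn2_norm_bound f : LpOn Om 2%:E f ->
  exists2 e : R, 0 < e & (LpNorm Om 2%:E f <= e%:E)%E.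
Proof.
move=> /LpOn2P[mf If].
have I0 : (0 <= \int[@lebesgue_rV R n]_(x in Om) (f x ^+ 2)%:E)%E.
  by apply: integral_ge0 => x _; rewrite lee_fin sqr_ge0.
have fI : (\int[@lebesgue_rV R n]_(x in Om) (f x ^+ 2)%:E)%E \is a fin_num.
  by rewrite ge0_fin_numE.
set J := fine (\int[@lebesgue_rV R n]_(x in Om) (f x ^+ 2)%:E)%E.
have J0 : 0 <= J by rewrite fine_ge0.
exists (J + 1); first by rewrite ltr_wpDl.
apply/LpNorm2_le; first by rewrite addr_ge0.
rewrite -[X in (X <= _)%E]fineK// lee_fin -/J.
by rewrite sqrrD expr1n mulr1 mulr2n; have := sqr_ge0 J; lra.
Qed.

Lemma expR_scale_is_derive (m t : R) :
  is_derive t 1 (fun s => expR (m * s)) (m * expR (m * t)).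
Proof.
have h : is_derive t 1 (fun s : R => m * s) m.
  have := is_derive1M (is_derive_cst m t 1) (is_derive_id t 1).
  by rewrite /= (_ : _ + _ = m)// /cst; ring.
have := @is_derive1_comp R expR (fun s => m * s) t _ _ (is_derive_expR _) h.
by rewrite mulrC.
Qed.

Lemma expR_scale_smooth (m : R) : smooth1 (fun s => expR (m * s)).
Proof.
elim=> [//|k IH]; apply: (CkS (expR_scale_is_derive m)).
by apply: CkM => //; exact: Ck_cst.
Qed.

Lemma heat_coef_continuous T u0 u k : 0 < T -> heat_weak_solution Om T u0 u ->
  continuous ((fun t => L2_inner Om (u t) (sine k)) \o clamp T).
Proof.
move=> T0 [[G [du [_ _ _ _ hc]]] _]; apply: continuous_clamp; first exact: ltW.
move=> t tT; have [lt ht] := hc t tT.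
apply/cvgrPdist_le => e e0.
have hn : \forall s \near within `[0, T]%classic (nbhs t),
    (LpNorm Om 2%:E (u s - u t)%R <= e%:E)%E.
  have [hf hl] := (@fine_cvgP R R (within `[0, T]%classic (nbhs t)) _ _ 0).1 ht.
  move/cvgr0Pnorm_le : hl => /(_ e e0) hl.
  near=> s.
  have h1 : LpNorm Om 2%:E (u s - u t) \is a fin_num by near: s.
  have h2 : `|fine (LpNorm Om 2%:E (u s - u t))| <= e by near: s.
  by rewrite -(fineK h1) lee_fin (le_trans _ h2)// ler_norm.
have hi : \forall s \near within `[0, T]%classic (nbhs t), s \in `[0, T].
  by apply: (@withinT R (nbhs t)).
near=> s.
have sT : s \in `[0, T] by near: s.
have h1 : (LpNorm Om 2%:E (u s - u t)%R <= e%:E)%E by near: s.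
have [ls _] := hc s sT.
have lk := sine_LpOn2 R k.
rewrite distrC -L2_innerB// -[leRHS]mul1r.
apply: L2_inner_le => //; first exact: LpOn2B.
by move=> x _; exact: normr_sine_le1.
Unshelve. all: by end_near. Qed.

Lemma Rintegral_clamp T (f g : R -> R) :
  \int[leb]_(t in `]0, T[) (f t * g (clamp T t)) = \int[leb]_(t in `]0, T[) (f t * g t).
Proof.
apply: eq_Rintegral => t; rewrite inE/= in_itv/= => /andP[t0 tT].
by rewrite clamp_id// in_itv/= !ltW.
Qed.

(** The equation tested against the sine, where [H10_sine] eliminates the gradient. *)
Lemma heat_coef_weak T u0 u k : 0 < T -> heat_weak_solution Om T u0 u ->
  let c := fun t => L2_inner Om (u (clamp T t)) (sine k) in
  forall eta, smooth1 eta -> time_test_function (`]0, T[%classic) eta ->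
  \int[leb]_(t in `]0, T[) (derive1 eta t * c t) =
  sine_eigenvalue R k * \int[leb]_(t in `]0, T[) (eta t * c t).
Proof.
move=> T0 hu c eta seta teta.
have cc : continuous c := heat_coef_continuous T0 hu.
have ceta := smooth1_continuous seta.
case: hu => [[G [du [[aeH _ _] _ wt aeE _]]] _].
have := wt _ _ (sine_H10 R k) teta => /=.
rewrite -(Rintegral_clamp T (derive1 eta) (fun t => L2_inner Om (u t) (sine k))) => ->.
have -> : \int[leb]_(t in `]0, T[) (eta t * du t (sob (sine k))) =
    \int[leb]_(t in `]0, T[) (- sine_eigenvalue R k * (eta t * c t)).
  apply: ae_eq_Rintegral_any.
  have FF : Filter (almost_everywhere leb) by exact: ae_filter_ringOfSetsType.
  have K := @filterS2 _ _ FF _ _ _ _ aeH aeE.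
  apply: K => t h1 h2 tI.
  have hH := h1 tI; have := h2 tI _ (sine_H10 R k).
  rewrite (H10_sine k hH)/= => /eqP; rewrite addr_eq0 => /eqP ->.
  have ct : clamp T t = t.
    by move: tI; rewrite /= in_itv/= => /andP[t0 tT]; rewrite clamp_id// in_itv/= !ltW.
  by rewrite /c ct; ring.
rewrite RintegralZl//; last first.
  by apply: continuous_integrable_oo => t; apply: cvgM; [exact: ceta|exact: cc].
by rewrite mulNr opprK.
Qed.

(** The coefficient c satisfies c' = - mu c in the sense of distributions.  Testing with
    zeta(t) exp (mu t) shows that exp (mu t) c(t) has zero weak derivative; it is continuous,
    hence constant. *)
Lemma heat_coef T u0 u k : 0 < T -> heat_weak_solution Om T u0 u ->
  forall t, t \in `[0, T] -> L2_inner Om (u t) (sine k) =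
    expR (- (sine_eigenvalue R k * t)) * L2_inner Om (u 0) (sine k).
Proof.
move=> T0 hu t tT.
pose c := fun t => L2_inner Om (u (clamp T t)) (sine k).
pose m := sine_eigenvalue R k.
have cc : continuous c := heat_coef_continuous T0 hu.
have ce := smooth1_continuous (expR_scale_smooth m).
pose g t := expR (m * t) * c t.
have cg : continuous g by move=> s; apply: cvgM; [exact: ce|exact: cc].
suff gE : g t = g 0.
  have c0 : clamp T 0 = 0 by rewrite clamp_id// in_itv/= lexx ltW.
  have := gE; rewrite /g /c (clamp_id tT) c0 mulr0 expR0 mul1r => <-.
  by rewrite mulrA -expRD addNr expR0 mul1r.
apply: (du_bois_reymond T0 cg) => // zeta szeta [p [q [p0 qT hz]]].
pose eta s := zeta s * expR (m * s).
have seta : smooth1 eta by move=> j; apply: CkM; [exact: szeta|exact: expR_scale_smooth].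
have teta : time_test_function (`]0, T[%classic) eta.
  apply: (smooth1_test seta p0 qT) => s; rewrite /eta mulf_eq0 negb_or => /andP[zs _].
  exact: hz.
have := heat_coef_weak k T0 hu seta teta; rewrite -/c -/m.
have dE s : derive1 eta s = derive1 zeta s * expR (m * s) + m * eta s.
  have := is_derive1M (smooth1_is_derive s szeta) (expR_scale_is_derive m s).
  move=> [_ h]; rewrite derive1E; apply: (etrans h); rewrite /eta; ring.
have cdz := smooth1_continuous (smooth1_derive1 szeta).
have ceta := smooth1_continuous seta.
have i1 : leb.-integrable `]0, T[ (EFin \o (fun s => derive1 zeta s * g s)).
  by apply: continuous_integrable_oo => s; apply: cvgM; [exact: cdz|exact: cg].
have i2 : leb.-integrable `]0, T[ (EFin \o (fun s => eta s * c s)).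
  by apply: continuous_integrable_oo => s; apply: cvgM; [exact: ceta|exact: cc].
rewrite -RintegralZl//.
have i3 : leb.-integrable `]0, T[ (EFin \o (fun s => m * (eta s * c s))).
  exact: integrable_EFinZ.
rewrite (_ : Rintegral _ _ _ = \int[leb]_(s in `]0, T[)
    (derive1 zeta s * g s + m * (eta s * c s))); last first.
  by apply: eq_Rintegral => s _; rewrite dE /g /eta mulrDl !mulrA.
rewrite RintegralD// => h; apply: (addIr (\int[leb]_(s in `]0, T[) (m * (eta s * c s)))).
by rewrite add0r; exact: h.
Qed.
End HeatCoefficients.

(** * Truncated sine expansions *)

Section Truncation.
Variable n : nat.

Lemma sum_low_frequencies (V : nmodType) (N M : nat) (G : ('I_n -> nat) -> V) : (0 < N <= M)%N ->
  \sum_(k : {ffun 'I_n -> 'I_M} | [forall i, (k i < N)%N]) G (succ_idx k) =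
  \sum_(k : {ffun 'I_n -> 'I_N}) G (succ_idx k).
Proof.
case: N => // N /= NM.
pose h (k : {ffun 'I_n -> 'I_N.+1}) : {ffun 'I_n -> 'I_M} := [ffun i => widen_ord NM (k i)].
pose h' (k : {ffun 'I_n -> 'I_M}) : {ffun 'I_n -> 'I_N.+1} := [ffun i => inord (k i)].
have hh k : h' (h k) = k.
  by apply/ffunP => i; rewrite !ffunE; apply/val_inj; rewrite /= inordK.
rewrite (reindex_onto h h') => [|k /forallP kN]; last first.
  by apply/ffunP => i; rewrite !ffunE; apply/val_inj; rewrite /= inordK.
apply: eq_big => [k|k _].
  by rewrite hh eqxx andbT; apply/forallP => i; rewrite ffunE /=.
by congr G; apply/funext => i; rewrite /succ_idx ffunE.
Qed.

End Truncation.

Section SineExpansion.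
Variables (R : realType) (n : nat).
Local Notation Om := (open_cube R n).
Implicit Types (f : 'rV[R]_n -> R) (x : 'rV[R]_n).

Definition sine_coef f (k : 'I_n -> nat) : R := 2 ^+ n * L2_inner Om f (sine k).

Definition sine_sum N f x : R :=
  \sum_(k : {ffun 'I_n -> 'I_N}) sine_coef f (succ_idx k) * sine (succ_idx k) x.

(** A point of the closed cube enters the open one when moved slightly towards the centre. *)
Lemma closed_cube_closure :
  [set x : 'rV[R]_n | forall i, `[0, 1]%classic (x ord0 i)] `<=` closure Om.
Proof.
move=> x hx B /rV_nbhsP[d d0 dB].
pose e := Num.min (d / 2) 2^-1.
have e0 : 0 < e by rewrite lt_min divr_gt0//= invr_gt0.
have ed : e < d.
  by rewrite (@le_lt_trans _ _ (d / 2)) ?ge_min ?lexx// ltr_pdivrMr// ltr_pMr// ltr1n.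
have e2 : e <= 2^-1 by rewrite ge_min lexx orbT.
pose y : 'rV[R]_n := \row_i ((1 - e) * x ord0 i + e / 2).
exists y; split.
  move=> i; rewrite mxE; have := hx i; rewrite /= in_itv/= => /andP[x0 x1].
  have h1 : 0 <= (1 - e) * x ord0 i by apply: mulr_ge0 => //; lra.
  have h2 : (1 - e) * x ord0 i <= 1 - e by rewrite ler_piMr//; lra.
  by apply/andP; split; lra.
apply: dB => i; rewrite mxE; have := hx i; rewrite /= in_itv/= => /andP[x0 x1].
rewrite (_ : _ - _ = e * (x ord0 i - 2^-1)); last by field.
rewrite normrM gtr0_norm// (le_lt_trans _ ed)// ler_piMr ?(ltW e0)//.
by rewrite ler_norml; apply/andP; split; lra.
Qed.

Lemma open_open_cube : open Om.
Proof.
rewrite openE => x xO; apply/rV_nbhsP.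
pose d := \big[Num.min/1]_i Num.min (x ord0 i) (1 - x ord0 i).
have d0 : 0 < d.
  rewrite /d; elim/big_ind : _ => // [a b a0 b0|i _]; first by rewrite lt_min a0.
  by have /andP[h1 h2] := xO i; rewrite lt_min h1 subr_gt0.
exists d => // y hy i; have := hy i.
have di : d <= Num.min (x ord0 i) (1 - x ord0 i) by exact: bigmin_le_cond.
move: di; rewrite le_min => /andP[h1 h2]; rewrite ltr_norml => /andP[h3 h4].
by apply/andP; split; lra.
Qed.

Lemma continuous_vanishing_bounded f : continuous_vanishing Om f -> cube_bounded f.
Proof.
move=> [cf _]; apply: continuous_cube_bounded.
exact: (continuous_subspaceW closed_cube_closure cf).
Qed.

Lemma continuous_vanishing_at f x : continuous_vanishing Om f -> Om x ->
  {for x, continuous f}.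
Proof.
move=> [cf _] xO.
have := continuous_subspaceW (@subset_closure _ Om) cf.
by rewrite (continuous_open_subspace f open_open_cube); apply; rewrite inE.
Qed.

Lemma fejer_coef_cvg j : fejer_coef R M j @[M --> \oo] --> (1 : R).
Proof.
rewrite /fejer_coef -[X in _ --> X]subr0; apply: cvgB; first exact: cvg_cst.
rewrite -[X in _ --> X](mulr0 j.+1%:R); apply: cvgMr; exact: cvg_harmonic.
Qed.

Lemma fejer_coef_itv M j : (j < M)%N -> 0 <= fejer_coef R M j <= 1.
Proof.
move=> jM; rewrite /fejer_coef lerBlDr lerDl divr_ge0// andbT subr_ge0.
by rewrite ler_pdivrMr// mul1r ler_nat ltnS ltnW.
Qed.

(** At a fixed frequency the Fejer weights tend to 1, so the low part of the Fejer sum tends to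
    the truncated expansion; its high part is bounded by [E] since the weights are at most 1. *)
Lemma sine_sum_approx N f x (E : R) : (0 < N)%N -> LpOn Om 2%:E f -> cube_bounded f ->
  {for x, continuous f} -> Om x ->
  (forall M, (N <= M)%N ->
    \sum_(k : {ffun 'I_n -> 'I_M} | ~~ [forall i, (k i < N)%N])
      `|sine_coef f (succ_idx k)| <= E) ->
  `|f x - sine_sum N f x| <= E.
Proof.
move=> N0 lf bf cf xO hE.
have hF := fejer_cvg lf bf cf xO.
pose low M := \sum_(k : {ffun 'I_n -> 'I_N}) (\prod_i fejer_coef R M (k i)) *
  (sine_coef f (succ_idx k) * sine (succ_idx k) x).
have hlow : low M @[M --> \oo] --> sine_sum N f x.
  rewrite /low /sine_sum; apply: cvg_big => [|k _]; first exact: add_continuous.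
  rewrite -[X in _ --> X]mul1r; apply: cvgMl.
  rewrite -[X in _ --> X](@big1_eq R 1 *%R 'I_n (index_enum 'I_n) predT).
  apply: cvg_big => [|i _]; [exact: mul_continuous|exact: fejer_coef_cvg].
have hD : `|fejer_sum M f x - low M| @[M --> \oo] --> `|f x - sine_sum N f x|.
  by apply: cvg_norm; exact: cvgB.
apply: (cvgr_to_le hD).
near=> M.
have NM : (N <= M)%N by near: M; exact: nbhs_infty_ge.
have -> : fejer_sum M f x - low M =
    \sum_(k : {ffun 'I_n -> 'I_M} | ~~ [forall i, (k i < N)%N])
      (\prod_i fejer_coef R M (k i)) * (sine_coef f (succ_idx k) * sine (succ_idx k) x).
  pose G (k : 'I_n -> nat) := (\prod_i fejer_coef R M (k i).-1) * (sine_coef f k * sine k x).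
  have -> : low M = \sum_(k : {ffun 'I_n -> 'I_M} | [forall i, (k i < N)%N]) G (succ_idx k).
    by rewrite (@sum_low_frequencies n R N M G) ?N0.
  rewrite /fejer_sum (bigID (fun k : {ffun 'I_n -> 'I_M} => [forall i, (k i < N)%N]))/=.
  rewrite addrAC (_ : \sum_(_ | _) _ = \sum_(k : {ffun 'I_n -> 'I_M} | [forall i, (k i < N)%N]) G (succ_idx k)).
    rewrite subrr add0r; apply: eq_bigr => k _.
    by rewrite big_split/= prodr_const card_ord /sine_coef; ring.
  apply: eq_bigr => k _.
  by rewrite /G big_split/= prodr_const card_ord /sine_coef; ring.
apply: le_trans (hE M NM); apply: le_trans (ler_norm_sum _ _ _) _.
apply: ler_sum => k _; rewrite normrM -[leRHS]mul1r ler_pM//.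
  rewrite normr_prod; apply: (@le_trans _ _ (\prod_(i < n) 1)); last by rewrite big1.
  apply: ler_prod => i _; rewrite normr_ge0 ger0_norm.
    by have /andP[_ ->] := fejer_coef_itv (ltn_ord (k i)).
  by have /andP[->] := fejer_coef_itv (ltn_ord (k i)).
by rewrite normrM ler_piMr// normr_sine_le1.
Unshelve. all: by end_near. Qed.

End SineExpansion.

(** * Eigenfunctions as sine polynomials *)

Section SpectralProjector.
Variables (R : realType) (n : nat).
Local Notation Om := (open_cube R n).
Implicit Types (f : 'rV[R]_n -> R) (x : 'rV[R]_n).

Lemma sine_eigenvalue_high M N (k : {ffun 'I_n -> 'I_M}) : ~~ [forall i, (k i < N)%N] ->
  N%:R ^+ 2 <= sine_eigenvalue R (succ_idx k).
Proof.
move=> /forallPn[i]; rewrite -leqNgt => Nk.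
rewrite /sine_eigenvalue (bigD1 i)//= -[leLHS]addr0 lerD ?sumr_ge0//; last first.
  by move=> j _; exact: sqr_ge0.
have p1 : 1 <= pi :> R by apply: le_trans (pi_ge2 R); rewrite ler1n.
rewrite lerXn2r ?nnegrE ?mulr_ge0 ?(le_trans _ p1)// -[leLHS]mulr1 ler_pM//.
by rewrite ler_nat (leq_trans Nk).
Qed.

Lemma eigenfunction_LpOn lambda phi : dirichlet_eigenfunction Om lambda phi ->
  LpOn Om 2%:E phi.
Proof. by move=> [_ _ [G [[[]]]]]. Qed.

(** Only the frequencies with eigenvalue [lambda] contribute, and they are below [N]. *)
Lemma eigenfunction_sine_sum lambda phi N x : (0 < N)%N -> lambda < N%:R ^+ 2 ->
  dirichlet_eigenfunction Om lambda phi -> Om x -> phi x = sine_sum N phi x.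
Proof.
move=> N0 hN hphi xO; have lphi := eigenfunction_LpOn hphi.
case: (hphi) => cv _ _.
apply/eqP; rewrite -subr_eq0 -normr_le0.
apply: sine_sum_approx => //.
- exact: continuous_vanishing_bounded.
- exact: continuous_vanishing_at.
move=> M NM; rewrite big1// => k /sine_eigenvalue_high hk.
rewrite /sine_coef (eigenfunction_sine_orthogonal hphi) ?mulr0 ?normr0//.
by apply/eqP => h; move: hN; rewrite h ltNge hk.
Qed.

Lemma sine_sum_inner f g N : LpOn Om 2%:E f ->
  (forall x, Om x -> g x = sine_sum N g x) ->
  L2_inner Om g f = \sum_(k : {ffun 'I_n -> 'I_N})
    sine_coef g (succ_idx k) * L2_inner Om f (sine (succ_idx k)).
Proof.
move=> lf gE.
have mOm : measurable Om by exact: measurable_open_cube.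
have i1 (k : {ffun 'I_n -> 'I_N}) : (@lebesgue_rV R n).-integrable Om (EFin \o (fun y =>
    sine_coef g (succ_idx k) * (f y * sine (succ_idx k) y))).
  exact: (integrable_EFinZ _ mOm (LpOn2_mul_integrable lf (sine_LpOn2 R (succ_idx k)))).
have [_ E] := Rintegral_bigsum (index_enum {ffun 'I_n -> 'I_N}) mOm i1.
rewrite /L2_inner; transitivity (\int[@lebesgue_rV R n]_(y in Om)
   \sum_(k : {ffun 'I_n -> 'I_N}) sine_coef g (succ_idx k) * (f y * sine (succ_idx k) y)).
  apply: eq_Rintegral => y; rewrite inE => yO; rewrite gE// mulr_suml.
  by apply: eq_bigr => k _; rewrite mulrAC mulrA.
rewrite E; apply: eq_bigr => k _; rewrite RintegralZl//.
exact: (LpOn2_mul_integrable lf (sine_LpOn2 R (succ_idx k))).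
Qed.

(** The eigenfunctions concerned are orthonormal combinations of N^n sines: the matrices of
    their coordinates satisfy A' A^T = 1, which bounds their number by N^n.  Thus the finitely
    supported sum in the spectral projector is the whole sum. *)
Lemma finite_eigenvalues phi lambda Lambda : dirichlet_eigenbasis Om phi lambda ->
  finite_set [set k | lambda k <= Lambda].
Proof.
move=> [hphi ortho _].
have [N N0 hN] : exists2 N, (0 < N)%N & Lambda < N%:R ^+ 2.
  pose N := (Num.trunc `|Lambda|).+1; exists N => //.
  have /andP[_ h] := truncn_itv (normr_ge0 Lambda).
  rewrite (le_lt_trans (ler_norm _))// (lt_le_trans h)//.
  by rewrite -natrX ler_nat -/N -{1}(expn1 N) leq_pexp2l.
apply: contrapT => hinf.
pose K := #|{ffun 'I_n -> 'I_N}|.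
have [B BA BK] := infinite_set_fset K.+1 hinf.
pose A : 'M[R]_(#|` B|%fset, K) := \matrix_(i, j)
  L2_inner Om (phi (nth 0%N B i)) (sine (succ_idx (enum_val j))).
pose A' : 'M[R]_(#|` B|%fset, K) := \matrix_(i, j)
  sine_coef (phi (nth 0%N B i)) (succ_idx (enum_val j)).
suff /mulmx1_min h : A' *m A^T = 1%:M by move: BK; rewrite ltnNge h.
apply/matrixP => i l; rewrite !mxE.
have memB (j : 'I_(#|` B|%fset)) : lambda (nth 0%N B j) <= Lambda.
  by apply: BA => /=; exact: mem_nth.
have := ortho (nth 0%N B i) (nth 0%N B l).
rewrite nth_uniq// => [/=<-|]; last exact: fset_uniq.
rewrite (sine_sum_inner (N := N)) ?(eigenfunction_LpOn (hphi _))//; last first.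
  by move=> x xO; apply: (eigenfunction_sine_sum N0 (le_lt_trans (memB i) hN) (hphi _)).
rewrite [RHS](reindex (@enum_val {ffun 'I_n -> 'I_N} predT))/=; last first.
  by apply: onW_bij; exact: enum_val_bij.
by apply: eq_bigr => j _; rewrite !mxE.
Qed.

End SpectralProjector.

(** * Spectral inequality on the cube *)

Section SpectralInequality.
Variables (R : realType) (n : nat).
Local Notation Om := (open_cube R n).
Implicit Types (f : 'rV[R]_n -> R) (x : 'rV[R]_n).

Lemma sampling_point (alpha : R) : 0 < alpha ->
  exists x : 'rV[R]_n, Om x /\ omega_n alpha n x.
Proof.
move=> a0; have [y [_ [_ [_ hy _ _]]]] := omega_nodes a0.
by exists (\row_i y 0%N); split => i; rewrite mxE; have [] := hy 0%N.
Qed.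

Lemma le_sup_on omega f x : omega x -> (`|f x|%:E <= sup_on omega f)%E.
Proof. by move=> ox; apply: ereal_sup_ubound; exists x. Qed.

Lemma sup_on_ge0 (alpha : R) f : 0 < alpha -> (0 <= sup_on (omega_n alpha n) f)%E.
Proof.
move=> /sampling_point[x [_ ox]]; apply: le_trans (le_sup_on f ox).
by rewrite lee_fin.
Qed.

Lemma frequency_cutoff (Lambda beta : R) : 0 < Lambda -> 2^-1 < beta < 1 ->
  exists N : nat, [/\ (0 < N)%N, Lambda < N%:R ^+ 2 &
    N%:R `^ (2 * beta) <= 4 * (1 + Lambda `^ beta)].
Proof.
move=> L0 /andP[b0 b1]; set s := Num.sqrt Lambda.
have s0 : 0 < s by rewrite sqrtr_gt0.
have sL : s ^+ 2 = Lambda by rewrite sqr_sqrtr// ltW.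
have /andP[h1 h2] := truncn_itv (ltW s0).
exists (Num.trunc s).+1; split => //.
  by rewrite -sL ltrXn2r ?nnegrE// ltW.
have b20 : 0 <= 2 * beta by lra.
pose m := Num.max 1 s.
have m1 : 1 <= m by rewrite le_max lexx.
have hN : (Num.trunc s).+1%:R <= 2 * m.
  rewrite -natr1; have : s <= m by rewrite le_max lexx orbT.
  by lra.
apply: (@le_trans _ _ ((2 * m) `^ (2 * beta))).
  by apply: ge0_ler_powR => //; rewrite nnegrE// mulr_ge0// (le_trans _ m1).
rewrite powRM//; last by rewrite (le_trans _ m1).
apply: ler_pM; rewrite ?powR_ge0//.
  rewrite (_ : 4 = 2 `^ 2%:R); last by rewrite powR_mulrn//; ring.
  by apply: ler_powR => //; [rewrite ler1n|lra].
rewrite /m maxEle; case: ifPn => _.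
  by rewrite powRrM powR_mulrn ?(ltW s0)// sL lerDr.
by rewrite powR1 lerDl powR_ge0.
Qed.

Lemma LpNorm2_le_sup f (B : R) : 0 <= B -> (forall x, Om x -> `|f x| <= B) ->
  (LpNorm Om 2%:E f <= B%:E)%E.
Proof.
move=> B0 fB; apply/LpNorm2_le => //.
apply: (@le_trans _ _ (\int[@lebesgue_rV R n]_(x in Om) cst (B ^+ 2)%:E x)%E).
  apply: ge0_ae_le_integral_any => [x _|x _|]; rewrite ?lee_fin ?sqr_ge0//.
  apply: aeW => x xO; rewrite lee_fin /cst -(real_normK (num_real (f x))) lerXn2r ?nnegrE//.
  exact: fB.
rewrite integral_cst; last exact: measurable_open_cube.
by rewrite [X in (_ * X)%E]lebesgue_open_cube mule1.
Qed.

(** The projection is a sine polynomial with frequencies at most N, and [finite_spectral] bounds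
    the l^1 norm of its coefficients, hence its supremum, hence its L^2 norm as the cube has
    measure 1. *)
Lemma spec_cube (alpha beta : R) : 0 < alpha -> 2^-1 < beta < 1 ->
  exists2 C : R, 0 < C & spec Om (omega_n alpha n) C beta.
Proof.
move=> a0 b12; have /andP[b0 b1] := b12.
have [D D0 hD] := @finite_spectral R alpha beta n a0 b0.
exists (expR (4 * D)); first exact: expR_gt0.
rewrite /spec => phi lambda hphi Lambda u L0 lu /=.
set Pu := spectral_projector _ _ _ _ _.
have [Poo|Pfin] := eqVneq (sup_on (omega_n alpha n) Pu) +oo%E.
  by rewrite Poo gt0_muley ?leey// lte_fin mulr_gt0 ?expR_gt0.
have s0 := sup_on_ge0 Pu a0.
have /fineK sE : sup_on (omega_n alpha n) Pu \is a fin_num.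
  by rewrite ge0_fin_numE// lt_neqAle Pfin leey.
set B := fine _ in sE; rewrite -sE -EFinM.
have B0 : 0 <= B by rewrite fine_ge0.
have [N [N0 LN Nb]] := frequency_cutoff L0 b12.
have finL := finite_eigenvalues Lambda hphi.
pose c (j : {ffun 'I_n -> 'I_N}) : R := \sum_(k <- fset_set [set k | lambda k <= Lambda])
  L2_inner Om u (phi k) * sine_coef (phi k) (succ_idx j).
have PuE x : Om x -> Pu x = \sum_j c j * sine (succ_idx j) x.
  move=> xO; rewrite /Pu /spectral_projector fsbig_finite//=.
  under [RHS]eq_bigr do rewrite mulr_suml.
  rewrite exchange_big/= big_seq [RHS]big_seq; apply: eq_bigr => k.
  rewrite in_fset_set// inE => kL; have [hk _ _] := hphi.
  rewrite (eigenfunction_sine_sum N0 (le_lt_trans kL LN) (hk k) xO).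
  by rewrite /sine_sum mulr_sumr; apply: eq_bigr => j _; rewrite mulrA.
have hc : \sum_j `|c j| <= expR (D * N%:R `^ (2 * beta)) * B.
  apply: hD => // x xO ox; rewrite -(PuE _ xO).
  by rewrite -lee_fin sE; exact: le_sup_on.
apply: LpNorm2_le_sup; first by rewrite mulr_ge0// mulr_ge0// expR_ge0.
move=> x xO; rewrite PuE//; apply: le_trans (ler_norm_sum _ _ _) _.
apply: (@le_trans _ _ (\sum_j `|c j|)).
  by apply: ler_sum => j _; rewrite normrM ler_piMr// normr_sine_le1.
apply: le_trans hc _; apply: ler_wpM2r => //.
rewrite -expRD ler_expR; apply: (@le_trans _ _ (D * (4 * (1 + Lambda `^ beta)))).
  by rewrite ler_wpM2l ?(ltW D0).
have : 4 * D * Lambda `^ beta <= expR (4 * D) * Lambda `^ beta.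
  rewrite ler_wpM2r ?powR_ge0//; apply: le_trans (expR_ge1Dx _).
  by rewrite lerDr.
lra.
Qed.

End SpectralInequality.

(** * Majorant of a solution of the heat equation *)

Section HeatSeries.
Variables (R : realType) (n : nat).
Local Notation Om := (open_cube R n).

Section Majorant.
Variables (a : ('I_n -> nat) -> R) (A : R).
Hypothesis (a0 : forall k, 0 <= a k) (aA : forall k, a k <= A).

Definition heat_term (k : 'I_n -> nat) (t : R) : R := expR (- (sine_eigenvalue R k * t)) * a k.

Definition heat_sum M (t : R) : R := \sum_(k : {ffun 'I_n -> 'I_M}) heat_term (succ_idx k) t.

(** The sum over all frequencies of the moduli of the coefficients at time t, as a supremum of
    sums over boxes of frequencies; each term is nonincreasing in t. *)
Definition heat_sup (t : R) : R := sup (range (fun M => heat_sum M.+1 t)).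

Lemma heat_term_ge0 k t : 0 <= heat_term k t.
Proof. by rewrite mulr_ge0// expR_ge0. Qed.

(** Multiplied by t the sum telescopes: t exp (- (j + 1) t) <= exp (- j t) - exp (- (j + 1) t). *)
Lemma geometric_expR_le M (t : R) : 0 < t -> \sum_(j < M) expR (- (j.+1%:R * t)) <= t^-1.
Proof.
move=> t0; rewrite -[leRHS]mul1r ler_pdivlMr//.
suff h : (\sum_(j < M) expR (- (j.+1%:R * t))) * t <= 1 - expR (- (M%:R * t)).
  by rewrite (le_trans h)// gerBl expR_ge0.
elim: M => [|M IH]; first by rewrite big_ord0 !mul0r oppr0 expR0 subrr.
rewrite big_ord_recr/= mulrDl; set q := expR (- (M.+1%:R * t)).
have -> : 1 - q = (1 - expR (- (M%:R * t))) + q * (expR t - 1).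
  by rewrite mulrBr mulr1 /q -expRD -natr1 (_ : - _ + t = - (M%:R * t)); ring.
apply: lerD => //; rewrite ler_wpM2l ?expR_ge0//.
by rewrite lerBrDl expR_ge1Dx.
Qed.

(** As pi^2 k_i^2 >= k_i, the sum is at most a product of n geometric series. *)
Lemma heat_sum_le M (t : R) : 0 < t -> heat_sum M t <= A * t^-1 ^+ n.
Proof.
move=> t0; apply: (@le_trans _ _
    (\sum_(k : {ffun 'I_n -> 'I_M}) A * \prod_i expR (- ((k i).+1%:R * t)))).
  apply: ler_sum => k _; rewrite /heat_term mulrC ler_pM ?expR_ge0//.
  rewrite -expR_sum ler_expR sumrN lerN2 /sine_eigenvalue mulr_suml.
  apply: ler_sum => i _; rewrite ler_wpM2r ?(ltW t0)// /succ_idx.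
  have p1 : 1 <= pi :> R by apply: le_trans (pi_ge2 R); rewrite ler1n.
  have h1 : 1 <= (k i).+1%:R :> R by rewrite ler1n.
  have h2 : (k i).+1%:R <= (k i).+1%:R * pi :> R by rewrite ler_peMr.
  by rewrite expr2 (le_trans h2)// ler_peMl ?(le_trans _ h2)// (le_trans h1).
rewrite -mulr_sumr -(bigA_distr_bigA (fun (_ : 'I_n) (j : 'I_M) => expR (- (j.+1%:R * t)))).
have A0 : 0 <= A by apply: le_trans (a0 (fun=> 0%N)) (aA _).
rewrite ler_wpM2l//; apply: (@le_trans _ _ (\prod_(i < n) t^-1)).
  by apply: ler_prod => i _; rewrite geometric_expR_le// sumr_ge0// => j _; exact: expR_ge0.
by rewrite prodr_const card_ord.
Qed.

Lemma heat_sum_has_sup (t : R) : 0 < t -> has_sup (range (fun M => heat_sum M.+1 t)).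
Proof.
move=> t0; split; first by exists (heat_sum 1 t); exists 0%N.
by exists (A * t^-1 ^+ n) => _ [M _ <-]; exact: heat_sum_le.
Qed.

Lemma heat_sum_le_sup M (t : R) : 0 < t -> (0 < M)%N -> heat_sum M t <= heat_sup t.
Proof.
by case: M => // M t0 _; apply: (sup_upper_bound (heat_sum_has_sup t0)); exists M.
Qed.

Lemma heat_sup_leP (t b : R) : 0 < t -> (forall M, (0 < M)%N -> heat_sum M t <= b) -> heat_sup t <= b.
Proof.
move=> t0 h; apply: ge_sup; first by exists (heat_sum 1 t); exists 0%N.
by move=> _ [M _ <-]; exact: h.
Qed.

Lemma heat_sup_ge0 (t : R) : 0 < t -> 0 <= heat_sup t.
Proof.
move=> t0; apply: le_trans (heat_sum_le_sup t0 (isT : (0 < 1)%N)).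
by apply: sumr_ge0 => k _; exact: heat_term_ge0.
Qed.

Lemma heat_term_decay (k : 'I_n -> nat) (s t m : R) : s <= t -> m <= sine_eigenvalue R k ->
  heat_term k t <= expR (- (m * (t - s))) * heat_term k s.
Proof.
move=> st mk; rewrite /heat_term mulrA -expRD ler_wpM2r// ler_expR.
have : m * (t - s) <= sine_eigenvalue R k * (t - s) by rewrite ler_wpM2r// subr_ge0.
lra.
Qed.

Lemma heat_sup_decreasing (s t : R) : 0 < s -> s <= t -> heat_sup t <= heat_sup s.
Proof.
move=> s0 st; apply: heat_sup_leP => [|M M0]; first exact: lt_le_trans st.
apply: le_trans (heat_sum_le_sup s0 M0); apply: ler_sum => k _.
apply: le_trans (heat_term_decay (m := 0) st _) _.
  by apply: sumr_ge0 => i _; exact: sqr_ge0.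
by rewrite mul0r oppr0 expR0 mul1r.
Qed.

Lemma heat_sum_split N M (t : R) : (0 < N <= M)%N -> heat_sum M t =
  heat_sum N t + \sum_(k : {ffun 'I_n -> 'I_M} | ~~ [forall i, (k i < N)%N]) heat_term (succ_idx k) t.
Proof.
move=> NM; rewrite /heat_sum (bigID (fun k : {ffun 'I_n -> 'I_M} => [forall i, (k i < N)%N]))/=.
by rewrite (@sum_low_frequencies n R N M (heat_term ^~ t)).
Qed.

(** A frequency with some index above N has eigenvalue at least N^2, whence the decay between
    the times s and t. *)
Lemma heat_tail_le N M (s t : R) : (0 < N <= M)%N -> 0 < s -> s <= t ->
  \sum_(k : {ffun 'I_n -> 'I_M} | ~~ [forall i, (k i < N)%N]) heat_term (succ_idx k) t <=
  expR (- (N%:R ^+ 2 * (t - s))) * heat_sup s.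
Proof.
move=> NM s0 st; have /andP[N0 leNM] := NM.
have M0 : (0 < M)%N by exact: leq_trans leNM.
apply: (@le_trans _ _ (expR (- (N%:R ^+ 2 * (t - s))) *
  \sum_(k : {ffun 'I_n -> 'I_M} | ~~ [forall i, (k i < N)%N]) heat_term (succ_idx k) s)).
  rewrite mulr_sumr; apply: ler_sum => k hk; apply: heat_term_decay => //.
  exact: sine_eigenvalue_high.
rewrite ler_wpM2l ?expR_ge0//; apply: le_trans (heat_sum_le_sup s0 M0).
rewrite (heat_sum_split _ NM) lerDr; apply: sumr_ge0 => k _; exact: heat_term_ge0.
Qed.

Lemma heat_sup_split N (s t : R) : (0 < N)%N -> 0 < s -> s <= t ->
  heat_sup t <= heat_sum N t + expR (- (N%:R ^+ 2 * (t - s))) * heat_sup s.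
Proof.
move=> N0 s0 st; apply: heat_sup_leP => [|M M0]; first exact: lt_le_trans st.
have h0 : 0 <= expR (- (N%:R ^+ 2 * (t - s))) * heat_sup s.
  by rewrite mulr_ge0 ?expR_ge0 ?heat_sup_ge0.
have [MN|NM] := leqP M N.
  rewrite (heat_sum_split (N := M) (M := N)) ?M0// -addrA lerDl addr_ge0//.
  by apply: sumr_ge0 => k _; exact: heat_term_ge0.
have NM' : (0 < N <= M)%N by rewrite N0 ltnW.
by rewrite (heat_sum_split _ NM') lerD2l heat_tail_le.
Qed.

End Majorant.

Section Solution.
Variables (T : R) (u0 : 'rV[R]_n -> R) (u : R -> 'rV[R]_n -> R).
Hypotheses (T0 : 0 < T) (hu : heat_solution Om T u0 u).

Let a k := `|sine_coef (u 0) k|.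

Lemma heat_LpOn t : t \in `[0, T] -> LpOn Om 2%:E (u t).
Proof. by move=> tT; case: hu => -[[G [du [_ _ _ _ h]]] _] _; case: (h t tT). Qed.

Lemma heat_initial_coef_bounded : exists A, forall k, a k <= A.
Proof.
have l0 : LpOn Om 2%:E (u 0) by apply: heat_LpOn; rewrite in_itv/= lexx ltW.
have [e e0 he] := LpOn2_norm_bound l0.
exists (2 ^+ n * (1 * e)) => k; rewrite /a /sine_coef normrM ger0_norm ?exprn_ge0//.
rewrite ler_wpM2l ?exprn_ge0//; apply: L2_inner_le => //; first exact: sine_LpOn2.
by move=> x _; exact: normr_sine_le1.
Qed.

Lemma normr_heat_coef t k : t \in `[0, T] -> `|sine_coef (u t) k| = heat_term a k t.
Proof.
move=> tT; case: hu => hw _; rewrite /heat_term /a /sine_coef (heat_coef k T0 hw tT).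
by rewrite mulrCA normrM ger0_norm ?expR_ge0.
Qed.

Lemma heat_sine_sum_approx t x N E : 0 < t <= T -> Om x -> (0 < N)%N ->
  (forall M, (N <= M)%N -> \sum_(k : {ffun 'I_n -> 'I_M} | ~~ [forall i, (k i < N)%N])
     heat_term a (succ_idx k) t <= E) ->
  `|u t x - sine_sum N (u t) x| <= E.
Proof.
move=> /andP[t0 tT] xO N0 hE; case: (hu) => _ /(_ t); rewrite in_itv/= t0 tT => /(_ isT) cv.
have tT' : t \in `[0, T] by rewrite in_itv/= ltW.
apply: sine_sum_approx => //; first exact: heat_LpOn.
- exact: continuous_vanishing_bounded.
- exact: continuous_vanishing_at.
move=> M NM; under eq_bigr do rewrite normr_heat_coef//; exact: hE.
Qed.

Lemma heat_le_sup t x : 0 < t <= T -> Om x -> `|u t x| <= heat_sup a t.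
Proof.
move=> tT xO; have /andP[t0 tT'] := tT; have [A aA] := heat_initial_coef_bounded.
have a0 k : 0 <= a k by exact: normr_ge0.
have h1 : `|u t x - sine_sum 1 (u t) x| <= heat_sup a t - heat_sum a 1 t.
  apply: heat_sine_sum_approx => // M M1.
  rewrite lerBrDl -heat_sum_split// (heat_sum_le_sup a0 aA)//.
have h2 : `|sine_sum 1 (u t) x| <= heat_sum a 1 t.
  apply: le_trans (ler_norm_sum _ _ _) _; apply: ler_sum => k _.
  by rewrite normrM normr_heat_coef ?in_itv/= ?(ltW t0)// ler_piMr ?heat_term_ge0// normr_sine_le1.
by rewrite -[u t x](subrK (sine_sum 1 (u t) x)) (le_trans (ler_normD _ _))//; lra.
Qed.

(** Let E = exp (- N^2 (t - s)) F(s).  The truncation of u(t) at frequency N is at most g + E at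
    the sampling points, and the spectral inequality bounds the sum of its coefficients; the
    tail of the series adds E once more, whence the factor 2. *)
Lemma heat_observation (alpha beta D : R) N s t g :
  (forall (N : nat) (c : {ffun 'I_n -> 'I_N} -> R) (B : R), (0 < N)%N ->
    (forall x, Om x -> omega_n alpha n x ->
      `|\sum_k c k * sine (fun i => (k i).+1) x| <= B) ->
    \sum_k `|c k| <= expR (D * N%:R `^ (2 * beta)) * B) ->
  0 <= D -> (0 < N)%N -> 0 < s -> s <= t <= T -> 0 <= g ->
  (forall x, Om x -> omega_n alpha n x -> `|u t x| <= g) ->
  heat_sup a t <= 2 * expR (D * N%:R `^ (2 * beta)) *
    (g + expR (- (N%:R ^+ 2 * (t - s))) * heat_sup a s).
Proof.
move=> hD D0 N0 s0 /andP[st tT] g0 hg; have [A aA] := heat_initial_coef_bounded.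
have a0 k : 0 <= a k by exact: normr_ge0.
have t0 : 0 < t := lt_le_trans s0 st.
set K := expR _; set E := expR _ * _.
have K1 : 1 <= K by rewrite -expR0 ler_expR mulr_ge0 ?powR_ge0.
have E0 : 0 <= E by rewrite mulr_ge0 ?expR_ge0 ?(heat_sup_ge0 a0 aA).
have h1 : heat_sum a N t <= K * (g + E).
  have -> : heat_sum a N t = \sum_(k : {ffun 'I_n -> 'I_N}) `|sine_coef (u t) (succ_idx k)|.
    by apply: eq_bigr => k _; rewrite normr_heat_coef ?in_itv/= ?(ltW t0).
  apply: hD => // x xO ox.
  have h : `|u t x - sine_sum N (u t) x| <= E.
    apply: heat_sine_sum_approx => //; first by rewrite t0.
    by move=> M NM; apply: (heat_tail_le a0 aA); rewrite ?N0.
  rewrite -[X in `|X| <= _](subKr (u t x)) (le_trans (ler_normB _ _))//.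
  by apply: lerD => //; exact: hg.
have := heat_sup_split a0 aA N0 s0 st; rewrite -/E.
have : E <= K * (g + E) by rewrite (@le_trans _ _ (g + E)) ?lerDr// ler_peMl// addr_ge0.
lra.
Qed.

End Solution.
End HeatSeries.

(** * Choice of the frequencies *)

Section FrequencySchedule.
Variable R : realType.
Implicit Types beta D : R.

(** The integer nu tau is of the order of B tau^(-r) with r = 1 / (2 (1 - beta)), the exponent
    for which the cost D N^(2 beta) and the dissipation N^2 tau are both of the order of
    tau^(-p).  They grow like B^(2 beta) and B^2: for large B the dissipation at scale tau beats
    the cost at scale tau / 2. *)
Lemma frequency_schedule beta D : 0 < D -> 2^-1 < beta < 1 ->
  let p := beta / (1 - beta) in
  exists (E : R) (nu : R -> nat), 0 < E /\ forall tau : R, 0 < tau <= 2^-1 ->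
    [/\ (0 < nu tau)%N, tau^-1 <= (nu tau)%:R,
        D * (nu tau)%:R `^ (2 * beta) <= E * (2 * tau) `^ (- p) &
        4 * expR (D * (nu (tau / 2))%:R `^ (2 * beta)) *
          expR (- ((nu tau)%:R ^+ 2 * (tau / 2))) <= 1].
Proof.
move=> D0 /andP[b0 b1] p.
have b20 : 0 < 2 * beta by lra.
have nb0 : 0 < 1 - beta by lra.
pose r := (2 * (1 - beta))^-1.
have r1 : 1 <= r by rewrite -[leLHS]invr1 lef_pV2 ?posrE//; lra.
have rp : - r * (2 * beta) = - p by rewrite /r /p; field; lra.
have r2 : - r * 2%:R + 1 = - p by rewrite /r /p; field; lra.
pose c := (2^-1 : R) `^ (- p).
have c0 : 0 < c by rewrite powR_gt0// invr_gt0.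
pose Q := D * 2 `^ (2 * beta) * c.
have Q0 : 0 < Q by rewrite !mulr_gt0// powR_gt0.
(* B >= 3 pays for the factor 4 <= exp 2, the other bound for the cost at the next scale. *)
pose B := Num.max 3 ((4 * Q) `^ (2 - 2 * beta)^-1).
have B3 : 3 <= B by rewrite le_max lexx.
have B0 : 0 < B by lra.
have BQ : Q * B `^ (2 * beta) <= B ^+ 2 / 4.
  have h : 4 * Q <= B `^ (2 - 2 * beta).
    have nz : 2 - 2 * beta != 0 by lra.
    have -> : 4 * Q = ((4 * Q) `^ (2 - 2 * beta)^-1) `^ (2 - 2 * beta).
      by rewrite -powRrM mulVf// powRr1// mulr_ge0// ltW.
    apply: ge0_ler_powR; rewrite ?nnegrE ?powR_ge0 ?(ltW B0)//; first by lra.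
    by rewrite le_max lexx orbT.
  have -> : B ^+ 2 = B `^ (2 - 2 * beta) * B `^ (2 * beta).
    rewrite -powRD; last by rewrite (gt_eqF B0) implybT.
    by rewrite subrK -powR_mulrn ?(ltW B0).
  by have := ler_wpM2r (powR_ge0 B (2 * beta)) h; lra.
pose nu (tau : R) := (Num.trunc (B * tau `^ (- r))).+1.
have small (tau : R) : 0 < tau <= 2^-1 -> 1 <= tau^-1 /\ tau^-1 <= tau `^ (- r).
  move=> /andP[t0 t2]; split; first by rewrite invf_ge1//; lra.
  rewrite -powR_inv1 ?(ltW t0)//; apply: ger_powR; last by lra.
  by rewrite t0; lra.
have nuP (tau : R) : 0 < tau <= 2^-1 ->
    B * tau `^ (- r) <= (nu tau)%:R <= 2 * (B * tau `^ (- r)).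
  move=> ht; have [h1 h2] := small _ ht.
  have h3 : 1 <= B * tau `^ (- r).
    by apply: (@le_trans _ _ (1 * 1)); [rewrite mul1r|apply: ler_pM; lra].
  have /andP[h4 h5] := truncn_itv (le_trans ler01 h3).
  by rewrite /nu (ltW h5)/= -natr1; lra.
have nuE (tau : R) : 0 < tau <= 2^-1 ->
    D * (nu tau)%:R `^ (2 * beta) <= Q * B `^ (2 * beta) * (2 * tau) `^ (- p).
  move=> ht; have /andP[t0 _] := ht; have /andP[_ h] := nuP _ ht.
  have -> : Q * B `^ (2 * beta) * (2 * tau) `^ (- p) = D * (2 * (B * tau `^ (- r))) `^ (2 * beta).
    rewrite !powRM ?mulr_ge0 ?powR_ge0 ?(ltW B0) ?(ltW t0)// -powRrM rp /Q.
    have c2 : c * 2 `^ (- p) = 1.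
      by rewrite /c -powRM// mulVf// powR1.
    transitivity (D * 2 `^ (2 * beta) * B `^ (2 * beta) * tau `^ (- p) * (c * 2 `^ (- p))).
      ring.
    by rewrite c2; ring.
  rewrite ler_wpM2l ?(ltW D0)//; apply: ge0_ler_powR; rewrite ?nnegrE ?(ltW b20)//.
  by rewrite !mulr_ge0 ?powR_ge0 ?(ltW B0).
exists (Q * B `^ (2 * beta)), nu; split; first by rewrite mulr_gt0// powR_gt0.
move=> tau ht; have [h1 h2] := small _ ht; have /andP[t0 t2] := ht.
have /andP[h3 h4] := nuP _ ht.
split => //.
- apply: le_trans h3; apply: (le_trans h2); rewrite ler_peMl ?powR_ge0//; lra.
- exact: nuE.
have ht2 : 0 < tau / 2 <= 2^-1 by apply/andP; split; lra.
have h5 := nuE _ ht2.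
have {}h5 : D * (nu (tau / 2))%:R `^ (2 * beta) <= B ^+ 2 / 4 * tau `^ (- p).
  apply: le_trans h5 _; rewrite (_ : 2 * (tau / 2) = tau); last by field.
  by rewrite ler_wpM2r ?powR_ge0.
have y1 : 1 <= tau `^ (- p).
  rewrite powRN invf_ge1 ?powR_gt0//.
  apply: (@le_trans _ _ (tau `^ 0)); last by rewrite powRr0.
  apply: ger_powR; first by rewrite t0; lra.
  by rewrite /p divr_ge0//; lra.
have h6 : B ^+ 2 / 2 * tau `^ (- p) <= (nu tau)%:R ^+ 2 * (tau / 2).
  have -> : B ^+ 2 / 2 * tau `^ (- p) = (B * tau `^ (- r)) ^+ 2 * (tau / 2).
    rewrite -r2 powRD ?(gt_eqF t0) ?implybT// powRrM powRr1 ?(ltW t0)// powR_mulrn ?powR_ge0//.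
    ring.
  rewrite ler_wpM2r ?divr_ge0 ?(ltW t0)// lerXn2r ?nnegrE ?mulr_ge0 ?powR_ge0 ?(ltW B0)//.
have e4 : 4 <= expR 2 :> R.
  rewrite (_ : 2 = 1 + 1)// expRD (_ : 4 = 2 * 2); last by ring.
  have e2 : 2 <= expR 1 :> R by apply: le_trans (expR_ge1Dx 1).
  by apply: ler_pM.
apply: (@le_trans _ _ (expR 2 * expR (D * (nu (tau / 2))%:R `^ (2 * beta)) *
          expR (- ((nu tau)%:R ^+ 2 * (tau / 2))))).
  by rewrite !ler_wpM2r ?expR_ge0.
rewrite -!expRD -[leRHS]expR0 ler_expR.
have : 2 <= B ^+ 2 / 4 * tau `^ (- p).
  apply: (@le_trans _ _ (B ^+ 2 / 4)); last by rewrite ler_peMr// divr_ge0// sqr_ge0.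
  have : 3 ^+ 2 <= B ^+ 2 by rewrite lerXn2r ?nnegrE ?(ltW B0).
  by lra.
have {}h6 : 2 * (B ^+ 2 / 4 * tau `^ (- p)) <= (nu tau)%:R ^+ 2 * (tau / 2).
  by apply: le_trans h6; rewrite le_eqVlt (_ : 2 * _ = B ^+ 2 / 2 * tau `^ (- p)) ?eqxx//; field.
move: h5 h6; set Y := B ^+ 2 / 4 * _; set Z := (nu tau)%:R ^+ 2 * _; set X := D * _.
clear; lra.
Qed.

End FrequencySchedule.

(** * Telescoping in time *)

Section Telescoping.
Variable R : realType.
Local Notation leb := (@lebesgue_measure R).

(** The intervals carrying the steps are disjoint, so the step function is below [G]. *)
Lemma sum_steps_le_integral (T : R) (v : nat -> R) (G : R -> \bar R) L : 0 < T ->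
  (forall t, 0 <= G t)%E -> (forall m, 0 <= v m) ->
  (forall m t, T / 2 ^+ m * (3 / 4) < t < T / 2 ^+ m -> ((v m)%:E <= G t)%E) ->
  ((\sum_(m < L) v m * (T / 2 ^+ m / 4))%:E <= \int[leb]_(t in `]0%R, T[) G t)%E.
Proof.
move=> T0 G0 v0 hv.
pose a m := T / 2 ^+ m.
have a0 m : 0 < a m by rewrite divr_gt0// exprn_gt0.
have aT m : a m <= T by rewrite ler_pdivrMr ?exprn_gt0// ler_peMr ?(ltW T0)// exprn_ege1// ler1n.
pose J m : set R := `]a m * (3 / 4), a m[%classic.
pose h K t := \sum_(m < K) v m * \1_(J m) t.
have h0 K t : 0 <= h K t by apply: sumr_ge0 => m _; rewrite mulr_ge0.
(* The second half says that the first K steps live to the right of a_K. *)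
have hG K t : ((h K t)%:E <= G t)%E /\ (t <= a K -> h K t = 0).
  elim: K => [|K [IH1 IH2]]; first by rewrite /h big_ord0; split.
  have hS : h K.+1 t = h K t + v K * \1_(J K) t by rewrite /h big_ord_recr.
  have aK : a K.+1 = a K / 2 by rewrite /a exprS invfM; ring.
  rewrite hS indicE; split.
    have [tJ|tJ] := boolP (t \in J K); last by rewrite mulr0 addr0.
    have /andP[t1 t2] : a K * (3 / 4) < t < a K by move: tJ; rewrite inE /J/= in_itv.
    by rewrite IH2 ?(ltW t2)// add0r mulr1; apply: hv; rewrite -/(a K) t1.
  move=> taK; have := a0 K => aK0.
  rewrite IH2; last by rewrite (le_trans taK)// aK; lra.
  rewrite add0r memNset ?mulr0// /J/= in_itv/= => /andP[t1 _].
  by move: taK t1; rewrite aK; lra.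
have mJ m : measurable (J m) by exact: measurable_itv.
have JT m : J m `&` `]0%R, T[%classic = J m.
  apply/setIidl => t; rewrite /J/= !in_itv/= => /andP[t1 t2].
  by rewrite (lt_le_trans t2)// andbT (lt_trans _ t1)// mulr_gt0.
have -> : (\sum_(m < L) v m * (a m / 4))%:E = (\int[leb]_(t in `]0%R, T[) (h L t)%:E)%E.
  under eq_integral do rewrite /h -sumEFin.
  rewrite ge0_integral_sum//; last first.
  - by move=> m t _; rewrite lee_fin mulr_ge0.
  - move=> m; apply/measurable_EFinP; apply: measurable_funM => //; exact: (measurable_indic (mJ m)).
  rewrite -sumEFin; apply: eq_bigr => m _.
  under eq_integral do rewrite EFinM.
  rewrite ge0_integralZl//; last first.
  - by rewrite lee_fin.
  - by apply/measurable_EFinP; exact: (measurable_indic (mJ m)).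
  rewrite integral_indic; [|exact: measurable_itv|exact: mJ].
  rewrite JT EFinM; congr (_ * _)%E.
  have am := a0 m.
  rewrite [RHS](lebesgue_measure_itv `]a m * (3 / 4), a m[)/= lte_fin.
  rewrite (_ : a m * (3 / 4) < a m); last by lra.
  by rewrite -EFinB; congr EFin; field.
apply: ge0_ae_le_integral_any => // [t _|]; first by rewrite lee_fin.
by apply: aeW => t _; have [] := hG L t.
Qed.

(** Let a_m = T / 2^m, and let K_m be the constant of the interpolation inequality for the
    frequency N_m.  On the right half of ]a_(m+1), a_m[ that inequality bounds [G] from below.
    Integration over this interval I_m, with al_m = a_m / (8 K_m), gives
      al_m F(a_m) <= (integral of G over I_m) + al_(m+1) F(a_(m+1)),
    where the choice of the frequencies was used in the last term.  After summation over m < L,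
    al_L F(a_L) remains; it tends to 0 because K_L grows faster than any power of 1 / a_L. *)
Lemma observability_le1 (beta D A : R) (n : nat) (nu : R -> nat) (T : R)
    (F : R -> R) (G : R -> \bar R) :
  0 < D -> 2^-1 < beta -> 0 < T <= 1 ->
  (forall tau : R, 0 < tau <= 2^-1 -> [/\ (0 < nu tau)%N, tau^-1 <= (nu tau)%:R &
     4 * expR (D * (nu (tau / 2))%:R `^ (2 * beta)) *
       expR (- ((nu tau)%:R ^+ 2 * (tau / 2))) <= 1]) ->
  (forall t, 0 < t -> 0 <= F t) -> (forall s t, 0 < s -> s <= t -> F t <= F s) ->
  (forall t, 0 < t -> F t <= A * t^-1 ^+ n) -> (forall t, 0 <= G t)%E ->
  (forall N s t g, (0 < N)%N -> 0 < s -> s <= t <= T -> 0 <= g -> (G t <= g%:E)%E ->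
     F t <= 2 * expR (D * N%:R `^ (2 * beta)) *
       (g + expR (- (N%:R ^+ 2 * (t - s))) * F s)) ->
  ((F T)%:E <= (8 * expR (D * (nu (T / 2))%:R `^ (2 * beta)) / T)%:E *
     \int[leb]_(t in `]0%R, T[) G t)%E.
Proof.
have eq_le_weak (x y : R) : x = y -> x <= y by move=> ->.
have weighted_step (x k f g z : R) : k != 0 ->
  x / (8 * k) * f = (f / (2 * k) - z * g) * (x / 4) + z * (x / 4) * g by move=> k0; field.
move=> D0 b0 /andP[T0 T1] hnu F0 Fd FA G0 obs.
set I := (\int[leb]_(t in _) _)%E.
pose a m := T / 2 ^+ m; pose N m := nu (a m / 2).
pose K m := expR (D * (N m)%:R `^ (2 * beta)).
pose q m := expR (- ((N m)%:R ^+ 2 * (a m / 4))).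
have a0 m : 0 < a m by rewrite divr_gt0// exprn_gt0.
have aT m : a m <= T by rewrite ler_pdivrMr ?exprn_gt0// ler_peMr ?(ltW T0)// exprn_ege1// ler1n.
have aS m : a m.+1 = a m / 2 by rewrite /a exprS invfM; ring.
have a00 : a 0%N = T by rewrite /a expr0 divr1.
have K0 m : 0 < K m by exact: expR_gt0.
have q0 m : 0 < q m by exact: expR_gt0.
have hN m : [/\ (0 < N m)%N, (a m / 2)^-1 <= (N m)%:R & 4 * K m.+1 * q m <= 1].
  have am := a0 m; have am1 := le_trans (aT m) T1.
  have [|h1 h2 h3] := hnu (a m / 2); first by apply/andP; split; lra.
  by split => //; rewrite /K /q /N aS (_ : a m / 4 = a m / 2 / 2)//; field.
have [Ioo|Ifin] := eqVneq I +oo%E.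
  by rewrite Ioo gt0_muley ?leey// lte_fin divr_gt0// mulr_gt0// expR_gt0.
have I0 : (0 <= I)%E by apply: integral_ge0 => t _; exact: G0.
have /fineK IE : I \is a fin_num by rewrite ge0_fin_numE// lt_neqAle Ifin leey.
rewrite -IE -EFinM lee_fin; set J := fine I.
(* Solving the interpolation inequality for the observation; w_m may be negative. *)
pose w m := F (a m) / (2 * K m) - q m * F (a m.+1).
pose v m := Num.max 0 (w m).
have wG m t : a m * (3 / 4) < t < a m -> ((v m)%:E <= G t)%E.
  move=> /andP[t1 t2]; have [Goo|Gfin] := eqVneq (G t) +oo%E; first by rewrite Goo leey.
  have /fineK GE : G t \is a fin_num by rewrite ge0_fin_numE// lt_neqAle Gfin leey.
  have g0 : 0 <= fine (G t) by rewrite fine_ge0.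
  rewrite -GE lee_fin /v ge_max g0/= /w lerBlDr ler_pdivrMr ?mulr_gt0//.
  have am := a0 m; have aSm := aS m; have [N0 _ _] := hN m.
  have st : a m.+1 <= t by rewrite aSm; lra.
  have tT : t <= T by rewrite ltW// (lt_le_trans t2).
  have h := obs (N m) (a m.+1) t (fine (G t)) N0 (a0 m.+1).
  rewrite st tT GE lexx in h; have {}h := h isT g0 isT.
  rewrite mulrC; apply: le_trans (Fd t (a m) (lt_le_trans (a0 m.+1) st) (ltW t2)) _.
  apply: le_trans h _; rewrite -/(K m) ler_wpM2l ?mulr_ge0 ?(ltW (K0 m))// lerD2l.
  rewrite ler_wpM2r ?F0// ler_expR lerN2 ler_wpM2l ?sqr_ge0// aSm; lra.
have hsum L : \sum_(m < L) v m * (a m / 4) <= J.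
  rewrite -lee_fin IE; apply: (sum_steps_le_integral L T0 G0 _ wG) => m.
  by rewrite /v le_max lexx.
pose al m := a m / (8 * K m).
have step m : al m * F (a m) <= v m * (a m / 4) + al m.+1 * F (a m.+1).
  have [_ _ h] := hN m; have Fm := F0 _ (a0 m.+1).
  have h1 : w m * (a m / 4) <= v m * (a m / 4).
    apply: ler_wpM2r; first by rewrite divr_ge0 ?(ltW (a0 m)).
    by rewrite /v le_max lexx orbT.
  have h2 : q m * (a m / 4) <= al m.+1.
    rewrite /al aS ler_pdivlMr ?mulr_gt0//.
    rewrite (_ : _ * (8 * _) = (4 * K m.+1 * q m) * (a m / 2)); last by field.
    by rewrite ler_piMl// divr_ge0 ?(ltW (a0 m)).
  apply: le_trans (lerD h1 (ler_wpM2r Fm h2)); apply: eq_le_weak.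
  by apply: weighted_step; rewrite gt_eqF.
have tele L : al 0%N * F T <= \sum_(m < L) v m * (a m / 4) + al L * F (a L).
  elim: L => [|L IH]; first by rewrite big_ord0 add0r a00.
  rewrite big_ord_recr/= -addrA; apply: le_trans IH _.
  by rewrite lerD2l step.
have A0 : 0 <= A.
  by have := le_trans (F0 1 ltr01) (FA 1 ltr01); rewrite invr1 expr1n mulr1.
pose c := A * (n.+1)`!%:R / (2 * D) ^+ n.+1.
have c0 : 0 <= c by rewrite /c divr_ge0 ?exprn_ge0 ?mulr_ge0 ?(ltW D0).
have rest L : al L * F (a L) <= c * a L.
  have aL := a0 L; have [N0 hNL _] := hN L.
  have aL1 := le_trans (aT L) T1.
  have N1 : 1 <= (N L)%:R :> R by rewrite ler1n.
  have x0 : 0 <= 2 * D / a L by apply: divr_ge0; [apply: mulr_ge0 => //; exact: ltW|exact: ltW].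
  (* The term of order n + 1 of the exponential series leaves one factor a_L to spare. *)
  have hK : (2 * D / a L) ^+ n.+1 / (n.+1)`!%:R <= K L.
    apply: (@le_trans _ _ (expR (2 * D / a L))).
      by apply: le_trans (expR_ge1Dxn n x0); rewrite lerDr.
    rewrite ler_expR (_ : 2 * D / a L = D * (a L / 2)^-1); last first.
      by field; rewrite (gt_eqF aL).
    rewrite ler_wpM2l ?(ltW D0)// (le_trans hNL)//.
    rewrite -[leLHS]powRr1//; apply: ler_powR => //; lra.
  have f0 : 0 < (n.+1)`!%:R :> R by rewrite ltr0n fact_gt0.
  have hF : F (a L) <= c * a L * K L.
    apply: le_trans (FA _ aL) _.
    rewrite (_ : A * _ = c * a L * ((2 * D / a L) ^+ n.+1 / (n.+1)`!%:R)); last first.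
      rewrite /c !exprMn !exprVn !(exprS (a L)).
      field; rewrite (gt_eqF aL) (gt_eqF f0) !expf_neq0 ?(gt_eqF aL) ?(gt_eqF D0)//.
    by rewrite ler_wpM2l// mulr_ge0// ltW.
  rewrite /al mulrAC ler_pdivrMr ?mulr_gt0//.
  apply: (@le_trans _ _ (F (a L))); first by rewrite ler_piMl// F0.
  apply: le_trans hF _; apply: ler_wpM2l; first by rewrite mulr_ge0// ltW.
  by apply: ler_peMl; [exact: ltW|rewrite ler1n].
have main : al 0%N * F T <= J.
  apply/ler_addgt0Pr => e e0.
  pose L := Num.trunc (c / e).
  apply: le_trans (tele L) _; apply: lerD; first exact: hsum.
  apply: le_trans (rest L) _.
  have /andP[_ h] := truncn_itv (divr_ge0 c0 (ltW e0)).
  rewrite ltr_pdivrMr// in h; apply: (@le_trans _ _ (c / 2 ^+ L)).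
    by rewrite /a mulrA ler_wpM2r ?invr_ge0 ?exprn_ge0// ler_piMr.
  rewrite ler_pdivrMr ?exprn_gt0// (le_trans (ltW h))// mulrC ler_wpM2l ?(ltW e0)//.
  by rewrite -natrX ler_nat ltn_expl.
have alE : al 0%N = (8 * K 0%N / T)^-1 by rewrite /al a00 invf_div.
move: main; rewrite alE mulrC ler_pdivrMr ?divr_gt0 ?mulr_gt0//.
by rewrite /K /N a00 mulrC.
Qed.

End Telescoping.

(** * Observability of the heat equation *)

Section HeatObservability.
Variables (R : realType) (n : nat).
Local Notation Om := (open_cube R n).
Local Notation leb := (@lebesgue_measure R).

Lemma LpNorm_oo_le (f : 'rV[R]_n -> R) (B : R) : 0 <= B -> (forall x, Om x -> `|f x| <= B) ->
  (LpNorm Om +oo f <= B%:E)%E.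
Proof.
move=> B0 fB; rewrite /LpNorm unlock; case: ifPn => _; last by rewrite lee_fin.
apply: (@ess_sup_inf.ess_sup_ler _ _ _ (@lebesgue_rV R n) (fun x => `|(f \_ Om) x|)) => x.
rewrite lee_fin patchE; case: ifPn => [|_]; last by rewrite normr0.
by rewrite inE => /fB.
Qed.

Lemma ge0_le_integral_oo (S T : R) (G : R -> \bar R) : S <= T -> (forall t, 0 <= G t)%E ->
  (\int[leb]_(t in `]0%R, S[) G t <= \int[leb]_(t in `]0%R, T[) G t)%E.
Proof.
move=> ST G0; rewrite [leLHS]integral_mkcond [leRHS]integral_mkcond.
apply: ge0_ae_le_integral_any => [t _|t _|]; rewrite ?patchE.
- by case: ifPn.
- by case: ifPn.
apply: aeW => t _; rewrite !patchE; case: ifPn => [|_]; last by case: ifPn.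
rewrite inE/= in_itv/= => /andP[t0 tS].
by rewrite ifT// inE/= in_itv/= t0 (lt_le_trans tS).
Qed.

(** The case T > 1 is reduced to S = min (T, 1), because the majorant is nonincreasing; then
    S^(-p) <= 1 + T^(-p), and the factor 1 / S is at most exp (S^(-p)) as p >= 1. *)
Lemma heat_observability (alpha beta : R) : 0 < alpha -> 2^-1 < beta < 1 ->
  exists2 C : R, 0 < C &
     forall (T : R) (u0 : 'rV[R]_n -> R) (u : R -> 'rV[R]_n -> R), 0 < T ->
       heat_solution Om T u0 u ->
       (LpNorm Om +oo (u T) <= (C * expR (C * T `^ (- (beta / (1 - beta)))))%:E *
          \int[leb]_(t in `]0%R, T[) sup_on (omega_n alpha n) (u t))%E.
Proof.
move=> a0 b12; have /andP[b0 b1] := b12.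
have [D D0 hD] := @finite_spectral R alpha beta n a0 b0.
have [E [nu [E0 hnu]]] := frequency_schedule D0 b12.
set p := beta / (1 - beta) in hnu *.
have p1 : 1 <= p by rewrite /p ler_pdivlMr; lra.
exists (8 * expR (E + 1)); first by rewrite mulr_gt0// expR_gt0.
move=> T u0 u T0 hu.
pose a k := `|sine_coef (u 0) k|.
have [A aA] := heat_initial_coef_bounded T0 hu.
have ak k : 0 <= a k by exact: normr_ge0.
pose S := Num.min T 1.
have S0 : 0 < S by rewrite lt_min T0 ltr01.
have S1 : S <= 1 by rewrite ge_min lexx orbT.
have ST : S <= T by rewrite ge_min lexx.
pose G t := sup_on (omega_n alpha n) (u t).
have G0 t : (0 <= G t)%E by exact: sup_on_ge0.
have h1 : ((heat_sup a S)%:E <= (8 * expR (D * (nu (S / 2))%:R `^ (2 * beta)) / S)%:E *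
     \int[leb]_(t in `]0%R, S[) G t)%E.
  apply: (@observability_le1 R beta D A n nu S (heat_sup a) G D0 b0) => //.
  - by rewrite S0.
  - by move=> tau /hnu[].
  - by move=> t t0; exact: (heat_sup_ge0 ak aA).
  - by move=> s t; exact: (heat_sup_decreasing ak aA).
  - move=> t t0; apply: (heat_sup_leP t0) => M _; exact: (heat_sum_le ak aA).
  move=> N s t g N0 s0 /andP[st tS] g0 hg.
  apply: (heat_observation T0 hu hD (ltW D0) N0 s0 _ g0).
    by rewrite st (le_trans tS).
  by move=> x _ ox; rewrite -lee_fin (le_trans _ hg)//; exact: le_sup_on.
apply: (@le_trans _ _ (heat_sup a S)%:E).
  apply: LpNorm_oo_le; first exact: (heat_sup_ge0 ak aA).
  move=> x xO; apply: le_trans (heat_sup_decreasing ak aA S0 ST).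
  by apply: (heat_le_sup T0 hu) => //; rewrite T0 lexx.
apply: (le_trans h1); apply: lee_pmul.
- by rewrite lee_fin divr_ge0 ?(ltW S0)// mulr_ge0// expR_ge0.
- by apply: integral_ge0 => t _; exact: G0.
- rewrite lee_fin.
  have hS2 : 0 < S / 2 <= 2^-1 by apply/andP; split; lra.
  have [_ _ hE _] := hnu _ hS2; rewrite (_ : 2 * (S / 2) = S) in hE; last by field.
  pose y := T `^ (- p); pose z := S `^ (- p).
  have y0 : 0 <= y by exact: powR_ge0.
  have zy : z <= 1 + y.
    rewrite /z /S minEle; case: ifPn => _; first by rewrite lerDr.
    by rewrite powR1 lerDl.
  have Sz : S^-1 <= expR z.
    apply: (@le_trans _ _ z); last by apply: le_trans (expR_ge1Dx z); rewrite lerDr.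
    by rewrite -powR_inv1 ?(ltW S0)// ger_powR// ?S0//; lra.
  apply: (@le_trans _ _ (8 * expR ((E + 1) * z))).
    rewrite -[leLHS]mulrA ler_wpM2l// (_ : (E + 1) * z = E * z + z); last by ring.
    rewrite expRD.
    by apply: ler_pM; rewrite ?expR_ge0 ?invr_ge0 ?(ltW S0)// ler_expR.
  rewrite -mulrA ler_wpM2l// -expRD ler_expR.
  have h2 : (E + 1) * z <= (E + 1) * (1 + y) by rewrite ler_wpM2l// addr_ge0 ?(ltW E0).
  apply: (le_trans h2); rewrite mulrDr mulr1 lerD2l ler_wpM2r//.
  have := expR_ge1Dx (E + 1); lra.
- exact: ge0_le_integral_oo.
Qed.

End HeatObservability.

Theorem corollary3p9 (R : realType) (alpha beta : R) (n : nat)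
    (halpha : 0 < alpha) (hbeta : 2^-1 < beta < 1) (hn : (1 <= n)%N) :
  (exists2 C : R, 0 < C & spec (open_cube R n) (omega_n alpha n) C beta) /\
  (exists2 C : R, 0 < C &
     forall (T : R) (u0 : 'rV[R]_n -> R) (u : R -> 'rV[R]_n -> R),
       0 < T ->
       LpOn (open_cube R n) 2%:E u0 ->
       heat_solution (open_cube R n) T u0 u ->
       (LpNorm (open_cube R n) +oo (u T) <=
          (C * expR (C * T `^ (- (beta / (1 - beta)))))%:E *
          \int[lebesgue_measure]_(t in `]0%R, T[) sup_on (omega_n alpha n) (u t))%E).
Proof.
split; first exact: spec_cube.
have [C C0 hC] := @heat_observability R n alpha beta halpha hbeta.
by exists C => // T u0 u T0 _; exact: hC.
Qed.
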